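(* Let $K$ be an infinite field, let $X=(x_{ij})$ be an $m\times n$ matrix of distinct variables over $K$, and let $S=K[x_{ij} : 1\leq i\leq m,\ 1\leq j\leq n]$ be endowed with the $\mathbb{Z}^n$-grading induced by $\deg(x_{ij})=e_j$. Let $1\leq t\leq\min\{m,n\}$ and let $I_t(X)\subseteq S$ be the ideal generated by the $t$-minors of $X$. Then $I_t(X)$ is a Cartwright-Sturmfels ideal if and only if $t=1$, $t=2$, or $t=\min\{m,n\}$.
   Context: $e_j\in\mathbb{Z}^n$ denotes the $j$-th standard basis vector. The group $G=\mathrm{GL}_{m}(K)\times\cdots\times\mathrm{GL}_{m}(K)$ ($n$ factors) acts on $S$ by $\mathbb{Z}^n$-graded $K$-algebra automorphisms, the $j$-th factor acting by linear substitutions on the variables $x_{1j},\dots,x_{mj}$ of degree $e_j$. Term orders used to define generic initial ideals satisfy $x_{1j}>x_{2j}>\cdots>x_{mj}$ for all $j$. For a $\mathbb{Z}^n$-graded ideal $I\subseteq S$ and such a term order $\sigma$, there is a nonempty Zariski open subset $U\subseteq G$ such that the initial ideal $\mathrm{in}_\sigma(gI)$ is the same for all $g\in U$; this common ideal is the multigraded generic initial ideal $\mathrm{gin}_\sigma(I)$. A $\mathbb{Z}^n$-graded ideal $I$ of $S$ is called Cartwright-Sturmfels if it has a radical multigraded generic initial ideal. *)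

(* Defs.v *)
From mathcomp Require Import all_boot all_order all_algebra.
From mathcomp Require Import mpoly.

Set Implicit Arguments.
Unset Strict Implicit.
Unset Printing Implicit Defensive.

Import GRing.Theory.
Local Open Scope ring_scope.

Definition infinite (T : eqType) : Prop := forall s : seq T, exists x, x \notin s.

(* Ideals need not have decidable membership, so they are Prop-valued
   predicates; two ideals are compared by pointwise equivalence. *)
Section Ideals.
Variable R : comNzRingType.
Implicit Types I G : R -> Prop.

Definition is_ideal I : Prop :=
  [/\ I 0, forall p q, I p -> I q -> I (p + q) & forall a p, I p -> I (a * p)].

Definition ideal_gen G (p : R) : Prop :=
  exists2 s : seq (R * R),
    (forall u, u \in s -> G u.2) & p = \sum_(u <- s) u.1 * u.2.

Definition is_radical I : Prop := forall p k, I (p ^+ k) -> I p.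

End Ideals.

Section InitialIdeal.
Variables (K : fieldType) (N : nat).
Implicit Types (le : rel 'X_{1..N}) (I : {mpoly K[N]} -> Prop).

Definition is_term_order le : Prop :=
  [/\ reflexive le, antisymmetric le, transitive le & total le] /\
  (forall u, le 0%MM u) /\
  (forall u v w, le u v -> le (u + w)%MM (v + w)%MM).

Definition is_leading_mon le (p : {mpoly K[N]}) (u : 'X_{1..N}) : Prop :=
  u \in msupp p /\ forall v, v \in msupp p -> le v u.

Definition initial_ideal le I : {mpoly K[N]} -> Prop :=
  ideal_gen (fun q => exists p u,
    [/\ I p, is_leading_mon le p u & q = 'X_[u]]).

End InitialIdeal.

(* S = K[x_ij] is {mpoly K[m * n]}, the variable x_ij having index
   [mxvec_index i j]; correspondingly [mxvec M 0] is the family of entries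
   of an m x n matrix M, indexed by the variables of S. *)
Section Multigraded.
Variables (K : fieldType) (m n : nat).
Local Notation S := {mpoly K[m * n]}.
Implicit Types (I J : S -> Prop) (g : 'I_n -> 'M[K]_m).

Definition generic_matrix : 'M[S]_(m, n) :=
  \matrix_(i, j) 'X_(mxvec_index i j).

Definition multideg (u : 'X_{1..m * n}) : 'rV[int]_n :=
  \sum_(i < m) \sum_(j < n) delta_mx 0 j *+ u (mxvec_index i j).

Definition hom_component (d : 'rV[int]_n) (p : S) : S :=
  \sum_(u <- msupp p | multideg u == d) p@_u *: 'X_[u].

Definition is_graded_ideal I : Prop :=
  is_ideal I /\ forall d p, I p -> I (hom_component d p).

(* The group G = GL_m(K)^n is the set of families of invertible matrices. *)
Definition in_G g : Prop := forall j, g j \in unitmx.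

(* g sends x_ij to \sum_l (g_j)_li x_lj. *)
Definition G_act g (p : S) : S :=
  let M : 'M[S]_(m, n) :=
    \matrix_(i, j) \sum_(l < m) g j l i *: generic_matrix l j in
  p \mPo [tuple mxvec M 0 k | k < m * n].

Definition G_image g I (q : S) : Prop := exists2 p, I p & q = G_act g p.

Definition G_coords g : 'I_(n * (m * m)) -> K :=
  mxvec (\matrix_j mxvec (g j)) 0.

(* Zariski open subsets of G, as complements in G of zero loci of families of
   polynomials in the matrix entries; the determinants being units on G,
   allowing their inverses in these polynomials gives the same open sets. *)
Definition zariski_open (U : ('I_n -> 'M[K]_m) -> Prop) : Prop :=
  exists F : {mpoly K[n * (m * m)]} -> Prop,
    forall g, U g <-> in_G g /\ exists2 f, F f & f.@[G_coords g] != 0.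

Definition column_decreasing (le : rel 'X_{1..m * n}) : Prop :=
  forall (i i' : 'I_m) (j : 'I_n), (i < i')%N ->
    le U_(mxvec_index i' j)%MM U_(mxvec_index i j)%MM.

Definition is_gin (le : rel 'X_{1..m * n}) I J : Prop :=
  exists U, [/\ zariski_open U, exists g, U g &
    forall g, U g -> forall p, initial_ideal le (G_image g I) p <-> J p].

Definition cartwright_sturmfels I : Prop :=
  is_graded_ideal I /\
  exists le J, [/\ is_term_order le, column_decreasing le,
    is_gin le I J & is_radical J].

Definition is_minor (t : nat) (p : S) : Prop :=
  exists (r : 'I_t -> 'I_m) (c : 'I_t -> 'I_n),
    [/\ forall a b : 'I_t, (a < b)%N -> (r a < r b)%N,
        forall a b : 'I_t, (a < b)%N -> (c a < c b)%N &
        p = \det (mxsub r c generic_matrix)].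

Definition determinantal_ideal (t : nat) : S -> Prop := ideal_gen (is_minor t).

End Multigraded.

(* Main.v *)
(** Let g be generic, let b_lj be the l-th row of g_j and v_j = sum_l x_lj b_lj the
    j-th column of the generic matrix after the substitution by g, so that gI_t is
    generated by the t-minors of (v_1, .., v_n).

    For t = 1, 2, min(m, n) the initial ideal is generated by squarefree monomials.
    A polynomial p of gI_t is killed by every substitution x |-> y making v_1, .., v_n
    span less than t dimensions; choosing y_k = P x_k up to smaller terms and scalars
    for the variables x_k occurring in a bad monomial u, one sees that u cannot be the
    leading monomial of p.  That the remaining minimal monomials do occur follows from
    the minors when t = m, and from a count in multilinear degrees when t = n (as many
    minors as monomials) and t = 2 (more multilinear monomials than sorted ones, and
    the latter span the quotient).

    For 2 < t < min(m, n) write t = 3 + e, m = 4 + kap + e.  On 4 + e columns consider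
    the monomial Y with rows 1, 1, kap+1, kap+1, 0, .., 0 and the four monomials X_i
    obtained by lowering by one the row of the i-th column, i < 4.  For each i some
    element of gI_t has a leading monomial dividing a power of X_i, so a radical initial
    ideal contains X_0, .., X_3.  The smallest of them, X_i, is the leading monomial of a
    multilinear F in gI_t, and every other monomial of F involving only rows up to those
    of Y is Y itself.  Evaluate F modulo a quadratic q in K[z], at points p_0, .., p_3 of
    two lines and two linear spaces of dimension kap + 2 that are, modulo q, dependent on
    p_0, p_1 and v_c for the remaining e columns (classically: two transversals, conjugate
    over K).  This gives alpha x + beta y = 0 mod q with x, y linear in z and alpha != 0,
    which is absurd since q has degree two. *)
Require Import Defs.
From mathcomp Require Import all_boot all_order all_algebra.
From mathcomp Require Import all_fingroup.
From mathcomp Require Import mpoly.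
From mathcomp Require Import ring.

Set Implicit Arguments.
Unset Strict Implicit.
Unset Printing Implicit Defensive.

Import GRing.Theory.
Local Open Scope ring_scope.

(** * Leading terms *)

(** The two halves treat term orders differently. For the positive half one order may be chosen:
    [mnmc_le] compares total degrees first, so multiplying every variable by the same [P] preserves
    the order of all monomials. The negative half must refute every order decreasing along columns.
    There the variables of the top rows are cancelled by explicit identities, and the leading
    monomial of what remains is forced by [column_decreasing] alone. Leading terms carry a
    coefficient that may be zero ([top_term]). Determinants can then be bounded without case
    distinctions, and genericity is needed only to see that one final coefficient is nonzero.
    Working modulo a quadratic polynomial avoids any field extension and any question about its
    factorisation: only coprimality with certain linear forms is needed, and this is the
    nonvanishing of a resultant. All these conditions are tested on one family with integer entries
    where they equal 1 or -1, so no characteristic is special. *)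

Local Notation widen := (widen_ord (leqnSn _)).

Section InfiniteField.
Variable K : fieldType.
Hypothesis Kinf : infinite K.

Lemma poly_nonroot (q : {poly K}) : q != 0 -> exists z, q.[z] != 0.
Proof.
move=> q_neq0.
have [s sU sS] : exists2 s : seq K, uniq s & size s = size q.
  elim: (size q) => [|d [s sU sS]]; first by exists [::].
  by have [x xs] := Kinf s; exists (x :: s); rewrite /= ?xs ?sS.
have [a_root|/allPn[z _ z_nr]] := boolP (all (root q) s); last by exists z.
by have := max_poly_roots q_neq0 a_root sU; rewrite sS ltnn.
Qed.

(** As a polynomial in its last variable, [p] has a nonzero coefficient. Induction gives values of
    the other variables that keep it nonzero, and a univariate nonroot finishes. *)
Lemma mpoly_nonroot n (p : {mpoly K[n]}) : p != 0 -> exists x, p.@[x] != 0.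
Proof.
elim: n p => [|n IH] p p_neq0.
  exists (fun=> 0); rewrite (nvar0_mpolyC p) mevalC.
  by apply: contraNneq p_neq0 => p0; rewrite (nvar0_mpolyC p) p0 mpolyC0.
pose u := mlead p; pose u' : 'X_{1..n} := [multinom u (widen i) | i < n].
have cE : ((muni p)`_(u ord_max))@_u' = p@_u.
  rewrite muniE coef_sum raddf_sum /= (bigD1_seq u) ?mlead_supp ?msupp_uniq //=.
  rewrite !coefZ coefXn eqxx mulr1 mcoeffZ mcoeffX eqxx mulr1 big1 ?addr0 // => v vu.
  rewrite !coefZ coefXn mulr_natr mulrb; case: eqP => [vmax|]; last by rewrite ?scaler0 mcoeff0.
  rewrite mcoeffZ mcoeffX; case: eqP => [vu'|]; last by rewrite mulr0.
  case/eqP: vu; apply/mnmP => i; case: (unliftP ord_max i) => [j ->|->] //.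
  have /mnmP/(_ j) := vu'; rewrite !mnmE.
  by have -> : widen_ord (leqnSn n) j = lift ord_max j; first by apply/val_inj; rewrite /= /bump leqNgt ltn_ord.
have c_neq0 : (muni p)`_(u ord_max) != 0.
  apply: contraTneq (mlead_supp p_neq0) => c0; rewrite mcoeff_msupp negbK.
  by rewrite -/u -cE c0 mcoeff0.
have [x xP] := IH _ c_neq0.
have q_neq0 : map_poly (meval x) (muni p) != 0.
  by apply: contraNneq xP => q0; rewrite -coef_map /= q0 coef0.
have [z zP] := poly_nonroot q_neq0.
exists (fun i => if unlift ord_max i is Some j then x j else z).
apply: contraNneq zP => pz; rewrite -[X in _ == X]pz; apply/eqP.
rewrite muniE rmorph_sum horner_sum mevalE; apply: eq_bigr => m _ /=.
rewrite map_polyZ map_polyXn hornerZ hornerXn /= mevalZ mevalX big_ord_recr /= unlift_none -mulrA.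
congr (_ * (_ * _)); apply: eq_bigr => i _; rewrite mnmE.
have -> : widen i = lift ord_max i by apply/val_inj; rewrite /= /bump leqNgt ltn_ord.
by rewrite liftK.
Qed.

End InfiniteField.

Section LeadingTerms.
Variables (K : fieldType) (N : nat) (le : rel 'X_{1..N}).
Hypothesis leP : is_term_order le.
Implicit Types (p q : {mpoly K[N]}) (u v w : 'X_{1..N}) (c d : K).

Let le_refl : reflexive le. Proof. by case: leP => -[]. Qed.
Let le_anti : antisymmetric le. Proof. by case: leP => -[]. Qed.
Let le_trans : transitive le. Proof. by case: leP => -[]. Qed.
Let le_total : total le. Proof. by case: leP => -[]. Qed.
Let le0 u : le 0%MM u. Proof. by case: leP => _ []. Qed.

Lemma term_order_add2r u v w : le u v -> le (u + w)%MM (v + w)%MM.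
Proof. by case: leP => _ [_ H]; apply: H. Qed.

Lemma term_order_add u u' v v' : le u u' -> le v v' -> le (u + v)%MM (u' + v')%MM.
Proof.
move=> uu' vv'; apply: (le_trans (term_order_add2r v uu')).
by rewrite addmC [(u' + v')%MM]addmC term_order_add2r.
Qed.

Lemma term_order_sum (I : Type) (r : seq I) (P : pred I) (F G : I -> 'X_{1..N}) :
  (forall i, P i -> le (F i) (G i)) ->
  le (\big[+%MM/0%MM]_(i <- r | P i) F i) (\big[+%MM/0%MM]_(i <- r | P i) G i).
Proof.
move=> H; elim: r => [|i r IH]; first by rewrite !big_nil.
by rewrite !big_cons; case: ifP => // /H Hi; apply: term_order_add.
Qed.

(* [p] has no monomial above [w], and [c], possibly zero, is its coefficient
   at [w]. *)
Definition top_term w c p := (forall v, v \in msupp p -> le v w) /\ p@_w = c.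

Lemma top_termX u : top_term u 1 'X_[u].
Proof. by split=> [v|]; rewrite ?msuppX ?mcoeffX ?eqxx ?inE // => /eqP->. Qed.

Lemma top_termC c : top_term 0%MM c c%:MP.
Proof.
split; last by rewrite mcoeffC eqxx mulr1.
by move=> v; rewrite msuppC; case: ifP => //= _; rewrite inE => /eqP->.
Qed.

Lemma top_term0 w : top_term w 0 0.
Proof. by split; rewrite ?mcoeff0 // => v; rewrite msupp0. Qed.

Lemma top_term_lt w w' c p : le w w' -> w != w' -> top_term w c p -> top_term w' 0 p.
Proof.
move=> ww' ne [pw _]; split=> [v /pw vw|]; first exact: le_trans ww'.
apply/eqP; rewrite mcoeff_eq0; apply: contra ne => /pw w'w.
by apply/eqP/le_anti; rewrite ww'.
Qed.

Lemma top_termD w c d p q :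
  top_term w c p -> top_term w d q -> top_term w (c + d) (p + q).
Proof.
move=> [pw <-] [qw <-]; split; last by rewrite mcoeffD.
by move=> v /msuppD_le; rewrite mem_cat => /orP[/pw|/qw].
Qed.

Lemma top_term_sum w (I : Type) (r : seq I) (P : pred I) (F : I -> {mpoly K[N]}) C :
  (forall i, P i -> top_term w (C i) (F i)) ->
  top_term w (\sum_(i <- r | P i) C i) (\sum_(i <- r | P i) F i).
Proof.
move=> H; elim: r => [|i r IH]; first by rewrite !big_nil; apply: top_term0.
by rewrite !big_cons; case: ifP => // /H Hi; apply: top_termD.
Qed.

Lemma top_term_sum0 w (I : Type) (r : seq I) (P : pred I) (F : I -> {mpoly K[N]}) :
  (forall i, P i -> top_term w 0 (F i)) -> top_term w 0 (\sum_(i <- r | P i) F i).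
Proof. by move=> H; have := top_term_sum r H; rewrite big1. Qed.

(** By translation invariance, monomials bounded by [u] and [v] have product [u + v] only if they
    are [u] and [v], so nothing can cancel there; this holds even if [c] or [d] is zero. *)
Lemma top_termM u v c d p q :
  top_term u c p -> top_term v d q -> top_term (u + v)%MM (c * d) (p * q).
Proof.
move=> [pu <-] [qv <-]; split=> [w /msuppM_le/allpairsP[[u' v'] /= [/pu u'u /qv v'v ->]]|].
  exact: term_order_add.
rewrite mpolyME raddf_sum /= (eq_big_seq (fun s : 'X_{1..N} * 'X_{1..N} =>
  if s == (u, v) then p@_u * q@_v else 0)) /=; last first.
  case=> _ _ /allpairsP[[u' v'] /= [/pu u'u /qv v'v [-> ->]]].
  rewrite mcoeffZ mcoeffX; case: (_ =P _) => e; case: (_ =P _) => e'.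
  - by case: e' => -> ->; rewrite mulr1.
  - case: e'; have /= e1 := e.
    suff e' : u' = u by rewrite e'; congr (_, _); apply: (@addmI _ u); rewrite -{1}e' e1.
    apply: (@addIm _ v'); apply: le_anti; rewrite term_order_add2r //= e1.
    by rewrite addmC [(u + v)%MM]addmC term_order_add2r.
  - by case: e' e => -> ->.
  - by rewrite mulr0.
rewrite -big_mkcond /=.
have [uvP|] := boolP ((u, v) \in allpairs pair (msupp p) (msupp q)).
  rewrite -big_filter (filter_pred1_uniq _ uvP) ?big_seq1 //.
  by apply: allpairs_uniq; rewrite ?msupp_uniq // => -[? ?] [? ?].
move=> uvP; rewrite big_seq_cond big1 => [|i /andP[/[swap]/eqP->]]; last by rewrite (negPf uvP).
suff : p@_u * q@_v == 0 by move/eqP.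
rewrite mulf_eq0 !mcoeff_eq0 -negb_and; apply: contra uvP => /andP[up vq].
by apply/allpairsP; exists (u, v).
Qed.

Lemma top_termMl u c d p : top_term u c p -> top_term u (d * c) (d%:MP * p).
Proof. by move=> /(top_termM (top_termC d)); rewrite add0m. Qed.

Lemma top_termMr u c d p : top_term u c p -> top_term u (c * d) (p * d%:MP).
Proof. by move=> /top_termM/(_ (top_termC d)); rewrite addm0. Qed.

Lemma top_termZ u c d p : top_term u c p -> top_term u (d * c) (d *: p).
Proof. by rewrite -mul_mpolyC; apply: top_termMl. Qed.

Lemma top_termN u c p : top_term u c p -> top_term u (- c) (- p).
Proof. by move=> /(@top_termZ _ _ (-1)); rewrite scaleN1r mulN1r. Qed.

Lemma top_termB w c d p q :
  top_term w c p -> top_term w d q -> top_term w (c - d) (p - q).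
Proof. by move=> ? ?; apply/top_termD/top_termN. Qed.

Lemma top_term_prod (I : Type) (r : seq I) (P : pred I) (F : I -> {mpoly K[N]}) W C :
  (forall i, P i -> top_term (W i) (C i) (F i)) ->
  top_term (\big[+%MM/0%MM]_(i <- r | P i) W i) (\prod_(i <- r | P i) C i)
    (\prod_(i <- r | P i) F i).
Proof.
move=> H; elim: r => [|i r IH]; first by rewrite !big_nil -mpolyC1; apply: top_termC.
by rewrite !big_cons; case: ifP => // /H Hi; apply: top_termM.
Qed.

Lemma top_termXn u c p k : top_term u c p -> top_term (u *+ k)%MM (c ^+ k) (p ^+ k).
Proof.
move=> H; elim: k => [|k IH]; first by rewrite mulm0n !expr0 -mpolyC1; apply: top_termC.
by rewrite mulmS !exprS; apply: top_termM.
Qed.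

(** The bound [W i] depends on the row only, so all terms of the Leibniz expansion share one
    bounding monomial and their coefficients add up to [\det C]. *)
Lemma top_term_det k (W : 'I_k -> 'X_{1..N}) (C : 'M[K]_k) (M : 'M[{mpoly K[N]}]_k) :
  (forall i j, top_term (W i) (C i j) (M i j)) ->
  top_term (\big[+%MM/0%MM]_i W i) (\det C) (\det M).
Proof.
move=> H; apply: top_term_sum => s _.
case: (odd_perm s); rewrite /= ?expr0 ?expr1 ?mul1r ?mulN1r.
  by apply/top_termN/top_term_prod.
exact/top_term_prod.
Qed.

Lemma top_term_leading u c p : c != 0 -> top_term u c p -> is_leading_mon le p u.
Proof. by move=> cn0 [pu pc]; split=> //; rewrite mcoeff_msupp pc. Qed.

Lemma leading_top_term u p : is_leading_mon le p u -> top_term u p@_u p.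
Proof. by case=> _ pu; split. Qed.

Lemma leading_exists p : p != 0 -> exists u, is_leading_mon le p u.
Proof.
rewrite -msupp_eq0 => pn0.
suff [u us uP] : exists2 u, u \in msupp p & forall v, v \in msupp p -> le v u by exists u.
elim: (msupp p) pn0 => // u [|v s] IH _.
  by exists u => [|v]; rewrite inE // => /eqP->.
have [//|w ws wP] := IH; have [uw|wu] := orP (le_total u w).
  by exists w => [|x]; rewrite inE ?ws ?orbT // => /predU1P[->//|/wP].
exists u => [|x]; rewrite inE ?eqxx // => /predU1P[->//|/wP xw].
exact: le_trans wu.
Qed.

(* The specialisation x_k |-> y_k shifts the monomials of a given degree by the
   same power of P, up to smaller terms, so it cannot kill the leading term. *)
Lemma leading_comp_neq0 (y : N.-tuple {mpoly K[N]}) P (C : 'I_N -> K) p u :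
    (forall v w, le v w -> (mdeg v <= mdeg w)%N) ->
    (forall k, top_term (P + U_(k))%MM (C k) (tnth y k)) ->
    (forall k, u k != 0%N -> C k != 0) ->
  is_leading_mon le p u -> p \mPo y != 0.
Proof.
move=> le_mdeg yP Cu [up uP].
have XP v : top_term (P *+ mdeg v + v)%MM (\prod_k C k ^+ v k) ('X_[v] \mPo y).
  rewrite comp_mpolyX.
  have -> : (P *+ mdeg v + v = \big[+%MM/0%MM]_k ((P + U_(k)) *+ v k))%MM.
    apply/mnmP => i; rewrite mnmDE mulmnE mnm_sumE mdegE big_distrr /=.
    rewrite [X in (_ + X)%N](_ : v i = \sum_k (k == i) * v k)%N; last first.
      by rewrite (bigD1 i) //= eqxx mul1n big1 ?addn0 // => k /negPf ->.
    by rewrite -big_split /=; apply: eq_bigr => k _; rewrite mulmnE mnmDE mnm1E mulnDl.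
  by apply: top_term_prod => k _; apply: top_termXn.
suff [_ H] : top_term (P *+ mdeg u + u)%MM (p@_u * \prod_k C k ^+ u k) (p \mPo y).
  apply: contraTneq (up) => p0; rewrite mcoeff_msupp negbK.
  move: H; rewrite p0 mcoeff0 => /esym/eqP; rewrite mulf_eq0 => /orP[//|].
  move=> /prodf_eq0[k _]; have [->|/Cu Ck] := eqVneq (u k) 0%N; first by rewrite expr0 oner_eq0.
  by rewrite expf_eq0 (negPf Ck) andbF.
have -> : p \mPo y = \sum_(v <- msupp p) p@_v *: ('X_[v] \mPo y).
  by rewrite {1}[p]mpolyE raddf_sum /=; apply: eq_bigr => v _; rewrite linearZ.
have -> : p@_u * \prod_k C k ^+ u k =
  \sum_(v <- msupp p) if v == u then p@_v * \prod_k C k ^+ v k else 0.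
  rewrite (bigD1_seq u) ?msupp_uniq //= eqxx [X in _ = _ + X]big1 ?addr0 // => v /negPf -> //.
rewrite big_seq [in X in top_term _ _ X]big_seq; apply: top_term_sum => v vp.
case: (v =P u) => [->|/eqP vu]; first exact/top_termZ/XP.
apply: top_term_lt (top_termZ p@_v (XP v)); last first.
  apply: contraNneq vu => e.
  (* Distinct monomials cannot collide after the shift: if [v] were below [u], its degree, hence its
     power of [P], would be no larger. *)
  have le_uv : le u v.
    have [//|vu] := orP (le_total u v).
    have : le (P *+ mdeg v + u)%MM (P *+ mdeg u + u)%MM.
      apply: term_order_add2r; have := le_mdeg _ _ vu; move/subnKC <-.
      elim: (mdeg u - mdeg v)%N => [|d IH]; first by rewrite addn0.
      apply: le_trans IH _; rewrite addnS mulmSr -[X in le X _]addm0.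
      exact: term_order_add.
    rewrite -e => H; suff -> : u = v by [].
    apply: (@addmI _ (P *+ mdeg v)%MM); apply: le_anti; rewrite H /=.
    by rewrite addmC [(_ + u)%MM]addmC term_order_add2r.
  by apply/eqP/le_anti; rewrite le_uv uP.
apply: term_order_add (uP _ vp); have := le_mdeg _ _ (uP _ vp); move/subnKC <-.
elim: (mdeg u - mdeg v)%N => [|d IH]; first by rewrite addn0.
apply: le_trans IH _; rewrite addnS mulmSr -[X in le X _]addm0.
exact: term_order_add.
Qed.

End LeadingTerms.

(** * Ideals of minors and the group action *)

Section IdealTheory.
Variable R : comNzRingType.
Implicit Types I G : R -> Prop.

Lemma ideal_gen_ideal G : is_ideal (ideal_gen G).
Proof.
split=> [|p q [s sG ->] [s' sG' ->]|a p [s sG ->]].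
- by exists [::]; rewrite ?big_nil.
- by exists (s ++ s'); rewrite ?big_cat // => u; rewrite mem_cat => /orP[/sG|/sG'].
- exists [seq (a * u.1, u.2) | u <- s] => [_ /mapP[u us ->]|]; first exact: (sG _ us).
  by rewrite big_map mulr_sumr; apply: eq_bigr => u _; rewrite mulrA.
Qed.

Lemma ideal_gen_sub G p : G p -> ideal_gen G p.
Proof.
by move=> Gp; exists [:: (1, p)]; rewrite ?big_seq1 ?mul1r // => u; rewrite inE => /eqP->.
Qed.

Lemma ideal_sum I (A : eqType) (r : seq A) (P : pred A) F : is_ideal I ->
  (forall i, i \in r -> P i -> I (F i)) -> I (\sum_(i <- r | P i) F i).
Proof.
move=> [I0 ID _] H; rewrite big_seq_cond; elim/big_ind: _ => // i /andP[]; exact: H.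
Qed.

Lemma ideal_genP I G p : is_ideal I -> (forall q, G q -> I q) -> ideal_gen G p -> I p.
Proof.
move=> II GI [s sG ->]; apply: ideal_sum => // u us _.
by case: II => _ _; apply; apply/GI/sG.
Qed.

Lemma ideal_sign I p k : is_ideal I -> I ((-1) ^+ k * p) -> I p.
Proof. by move=> [_ _ IM] /(IM ((-1) ^+ k)); rewrite mulrA -signr_odd -expr2 sqrr_sign mul1r. Qed.

End IdealTheory.

Lemma sorting_perm t m (r : 'I_t -> 'I_m) : injective r ->
  exists s : 'S_t, forall a b : 'I_t, (a < b)%N -> (r (s a) < r (s b))%N.
Proof.
move=> r_inj; pose l := [tuple r i | i < t].
have /tuple_permP[s sE] : perm_eq (sort_tuple (fun i j : 'I_m => i <= j)%N l) l by rewrite perm_sort.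
exists s => a b ab.
have lE (k : 'I_t) : r (s k) = tnth (sort_tuple (fun i j : 'I_m => i <= j)%N l) k.
  by rewrite (tnth_nth (r k)) sE (nth_map k) ?size_enum_ord ?ltn_ord // nth_ord_enum tnth_mktuple.
have l_sorted : sorted ltn [seq val i | i <- sort (fun i j : 'I_m => i <= j)%N l].
  rewrite ltn_sorted_uniq_leq map_inj_uniq ?sort_uniq; last exact: val_inj.
  rewrite map_inj_uniq ?enum_uniq //= sorted_map.
  by apply: sort_sorted => i j; apply: leq_total.
rewrite !lE !(tnth_nth (r a)) /=.
have := @sorted_ltn_nth _ _ ltn_trans 0%N _ l_sorted a b.
rewrite !inE !size_map size_sort size_tuple !ltn_ord => /(_ isT isT ab).
by rewrite !(nth_map (r a)) ?size_sort ?size_tuple.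
Qed.

Lemma increasing_inj t m (r : 'I_t -> 'I_m) :
  (forall a b : 'I_t, (a < b)%N -> (r a < r b)%N) -> injective r.
Proof.
move=> rP a b e; apply/val_inj; case: (ltngtP a b) => // /rP; by rewrite e ltnn.
Qed.

Lemma det_row_perm (R : comNzRingType) k (s : 'S_k) (A : 'M[R]_k) :
  \det (row_perm s A) = (-1) ^+ s * \det A.
Proof. by rewrite row_permE det_mulmx det_perm. Qed.

Lemma det_col_perm (R : comNzRingType) k (s : 'S_k) (A : 'M[R]_k) :
  \det (col_perm s A) = (-1) ^+ s * \det A.
Proof. by rewrite -det_tr tr_col_perm det_row_perm det_tr. Qed.

Section Determinantal.
Variables (K : fieldType) (m n : nat).
Local Notation S := {mpoly K[m * n]}.
Local Notation X := (@generic_matrix K m n).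
Implicit Types g : 'I_n -> 'M[K]_m.

(** This lifts the restriction to increasing index maps in [is_minor]: a repeated index gives zero,
    and injective maps are sorted at the cost of a sign. *)
Lemma det_mxsub_ideal t (r : 'I_t -> 'I_m) (c : 'I_t -> 'I_n) :
  @determinantal_ideal K m n t (\det (mxsub r c X)).
Proof.
have II := ideal_gen_ideal (@is_minor K m n t).
have [/injectiveP r_inj|/injectivePn[a [b ab e]]] := boolP (injectiveb r); last first.
  rewrite (@determinant_alternate _ _ _ a b) //; first by case: II.
  by move=> i; rewrite !mxE e.
have [/injectiveP c_inj|/injectivePn[a [b ab e]]] := boolP (injectiveb c); last first.
  rewrite -det_tr (@determinant_alternate _ _ _ a b) //; first by case: II.
  by move=> i; rewrite !mxE e.
have [s sP] := sorting_perm r_inj; have [s' sP'] := sorting_perm c_inj.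
apply: (ideal_sign (k := s) II); apply: (ideal_sign (k := s') II).
rewrite -det_row_perm -det_col_perm; apply: ideal_gen_sub.
exists (r \o s), (c \o s'); split; [exact: sP|exact: sP'|].
by congr (\det _); apply/matrixP => i j; rewrite !mxE.
Qed.

Lemma determinantal_ideal_morph t (R : comNzRingType) (psi : {rmorphism S -> R})
    (J : R -> Prop) p : is_ideal J ->
    (forall (r : 'I_t -> 'I_m) (c : 'I_t -> 'I_n), injective r -> injective c ->
       J (\det (mxsub r c (map_mx psi X)))) ->
  determinantal_ideal t p -> J (psi p).
Proof.
move=> II JP [s sG ->]; rewrite rmorph_sum; apply: ideal_sum => // u us _.
rewrite rmorphM; case: (II) => _ _; apply; have [r [c [rP cP ->]]] := sG _ us.
by rewrite -det_map_mx map_mxsub; apply: JP; apply: increasing_inj.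
Qed.

Definition G_subst (g : 'I_n -> 'M[K]_m) : (m * n).-tuple S :=
  [tuple mxvec (\matrix_(i < m, j < n) \sum_(l < m) g j l i *: X l j) 0 k | k < m * n].

Lemma G_actE g p : G_act g p = p \mPo G_subst g.
Proof. by []. Qed.

Lemma tnth_G_subst g i j :
  tnth (G_subst g) (mxvec_index i j) = \sum_(l < m) g j l i *: 'X_(mxvec_index l j).
Proof. by rewrite tnth_mktuple mxvecE mxE; apply: eq_bigr => l _; rewrite mxE. Qed.

Lemma mPoA k (p : S) (y : (m * n).-tuple {mpoly K[k]}) (h : (m * n).-tuple S) :
  (p \mPo h) \mPo y = p \mPo [tuple tnth h i \mPo y | i < m * n].
Proof.
set z := [tuple _ | i < _].
rewrite [p]mpolyE (raddf_sum (comp_mpoly h)) (raddf_sum (comp_mpoly y)) (raddf_sum (comp_mpoly z)).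
apply: eq_bigr => u _ /=.
rewrite !comp_mpolyZ; congr (_ *: _); rewrite !comp_mpolyX rmorph_prod.
by apply: eq_bigr => i _; rewrite rmorphXn /= tnth_mktuple.
Qed.

Lemma mPoXU k (y : (m * n).-tuple {mpoly K[k]}) i : 'X_i \mPo y = tnth y i.
Proof. by rewrite comp_mpolyXU -tnth_nth. Qed.

Lemma G_actX g i j :
  G_act g 'X_(mxvec_index i j) = \sum_(l < m) g j l i *: 'X_(mxvec_index l j).
Proof. by rewrite G_actE mPoXU tnth_G_subst. Qed.

Lemma G_act_comp (g h : 'I_n -> 'M[K]_m) p : G_act h (G_act g p) = G_act (fun j => h j *m g j) p.
Proof.
rewrite !G_actE mPoA; congr (_ \mPo _); apply: eq_from_tnth => k.
case/mxvec_indexP: k => i j; rewrite tnth_mktuple !tnth_G_subst raddf_sum /=.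
under eq_bigr => l _ do rewrite comp_mpolyZ mPoXU tnth_G_subst scaler_sumr.
rewrite exchange_big; apply: eq_bigr => l _; rewrite mxE scaler_suml.
by apply: eq_bigr => s _; rewrite scalerA mulrC.
Qed.

Lemma G_act_id g p : (forall j, g j = 1%:M) -> G_act g p = p.
Proof.
move=> g1; rewrite G_actE -[RHS]comp_mpoly_id; congr (_ \mPo _).
apply: eq_from_tnth => k; case/mxvec_indexP: k => i j.
rewrite tnth_mktuple !tnth_G_subst (bigD1 i) //= g1 mxE eqxx scale1r big1 ?addr0 // => l li.
by rewrite mxE (negPf li) scale0r.
Qed.

Lemma G_actK g p : in_G g -> G_act g (G_act (fun j => invmx (g j)) p) = p.
Proof. by move=> gG; rewrite G_act_comp G_act_id // => j; rewrite mulmxV ?gG. Qed.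

Lemma G_image_ideal g (I : S -> Prop) : in_G g -> is_ideal I -> is_ideal (G_image g I).
Proof.
move=> gG [I0 ID IM]; split.
- by exists 0; rewrite // G_actE comp_mpoly0.
- move=> _ _ [p Ip ->] [q Iq ->]; exists (p + q); first exact: ID.
  by rewrite !G_actE comp_mpolyD.
- move=> a _ [p Ip ->]; exists (G_act (fun j => invmx (g j)) a * p); first exact: IM.
  by rewrite [RHS]G_actE rmorphM /= -!G_actE G_actK.
Qed.

(* The j-th column of the generic matrix after the substitution by [g] is
   sum_l x_lj b_lj, where b_lj denotes the l-th row of g_j. *)
Definition spread (R : comNzRingType) (f : K -> R) (g : 'I_n -> 'M[K]_m) (y : 'I_m -> 'I_n -> R) j :
  'rV[R]_m := \sum_l y l j *: map_mx f (row l (g j)).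

Lemma spreadE R f g y j i : @spread R f g y j 0 i = \sum_l y l j * f (g j l i).
Proof. by rewrite summxE; apply: eq_bigr => l _; rewrite !mxE. Qed.

Definition gcol g j := spread (@mpolyC (m * n) K) g (fun i j => 'X_(mxvec_index i j)) j.

Lemma gcolE g i j : gcol g j 0 i = G_act g 'X_(mxvec_index i j).
Proof.
by rewrite spreadE G_actX; apply: eq_bigr => l _; rewrite mulrC mul_mpolyC.
Qed.

Lemma det_gcol_ideal g t (r : 'I_t -> 'I_m) (c : 'I_t -> 'I_n) :
  G_image g (determinantal_ideal t) (\det (\matrix_(a, b) gcol g (c b) 0 (r a))).
Proof.
exists (\det (mxsub r c X)); first exact: det_mxsub_ideal.
rewrite G_actE -det_map_mx; congr (\det _); apply/matrixP => a b.
by rewrite mxE gcolE !mxE.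
Qed.

(** A ring morphism on S is given by [f] on constants and [h] on variables; whether it sends the
    ideal into [J] is decided on the minors. It serves with [J] zero, to prove vanishing, and with
    [J] the multiples of a polynomial. *)
Lemma G_image_mmap t g (R : comNzRingType) (f : {rmorphism K -> R})
    (h : 'I_(m * n) -> R) (J : R -> Prop) p : is_ideal J ->
    (forall (r : 'I_t -> 'I_m) (c : 'I_t -> 'I_n), injective r -> injective c ->
       J (\det (\matrix_(a, b) spread f g (fun i j => h (mxvec_index i j)) (c b) 0 (r a)))) ->
  G_image g (determinantal_ideal t) p -> J (mmap f h p).
Proof.
move=> JI JP [q Iq ->].
have -> : mmap f h (G_act g q) = (mmap f h \o comp_mpoly (G_subst g)) q by [].
apply: determinantal_ideal_morph JI _ Iq => r c r_inj c_inj.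
suff -> : mxsub r c (map_mx (mmap f h \o comp_mpoly (G_subst g)) X) =
  \matrix_(a, b) spread f g (fun i j => h (mxvec_index i j)) (c b) 0 (r a) by apply: JP.
apply/matrixP => a b; rewrite !mxE spreadE /= mPoXU tnth_G_subst raddf_sum.
by apply: eq_bigr => l _; rewrite /= mmapZ mmapX mmap1U mulrC.
Qed.

End Determinantal.

(** * Generic families of matrices *)

Section Generic.
Variables (K : fieldType) (m n : nat).
Local Notation T := ('I_n -> 'M[K]_m).
Implicit Types (g : T) (P Q : T -> Prop) (phi psi : T -> K).

Definition polyfun phi :=
  exists f : {mpoly K[n * (m * m)]}, forall g, phi g = f.@[G_coords g].

Lemma polyfun_const c : polyfun (fun=> c).
Proof. by exists c%:MP => g; rewrite mevalC. Qed.

Lemma polyfun_entry j a b : polyfun (fun g => g j a b).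
Proof.
by exists 'X_(mxvec_index j (mxvec_index a b)) => g; rewrite mevalXU /G_coords mxvecE mxE mxvecE.
Qed.

Lemma polyfunD phi psi : polyfun phi -> polyfun psi -> polyfun (fun g => phi g + psi g).
Proof. by move=> [f fE] [h hE]; exists (f + h) => g; rewrite mevalD fE hE. Qed.

Lemma polyfunM phi psi : polyfun phi -> polyfun psi -> polyfun (fun g => phi g * psi g).
Proof. by move=> [f fE] [h hE]; exists (f * h) => g; rewrite mevalM fE hE. Qed.

Lemma polyfunN phi : polyfun phi -> polyfun (fun g => - phi g).
Proof. by move=> [f fE]; exists (- f) => g; rewrite mevalN fE. Qed.

Lemma polyfunB phi psi : polyfun phi -> polyfun psi -> polyfun (fun g => phi g - psi g).
Proof. by move=> ? ?; apply/polyfunD/polyfunN. Qed.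

Lemma polyfun_sum (I : Type) (r : seq I) (A : pred I) (F : I -> T -> K) :
  (forall i, polyfun (F i)) -> polyfun (fun g => \sum_(i <- r | A i) F i g).
Proof.
move=> H; elim: r => [|i r [f fE]].
  by exists 0 => g; rewrite big_nil meval0.
case: (H i) => h hE; exists (if A i then h + f else f) => g; rewrite big_cons.
by case: ifP => _; rewrite ?mevalD fE ?hE.
Qed.

Lemma polyfun_prod (I : Type) (r : seq I) (A : pred I) (F : I -> T -> K) :
  (forall i, polyfun (F i)) -> polyfun (fun g => \prod_(i <- r | A i) F i g).
Proof.
move=> H; elim: r => [|i r [f fE]].
  by exists 1 => g; rewrite big_nil meval1.
case: (H i) => h hE; exists (if A i then h * f else f) => g; rewrite big_cons.
by case: ifP => _; rewrite ?mevalM fE ?hE.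
Qed.

Lemma polyfun_det k (F : T -> 'M[K]_k) :
  (forall a b, polyfun (fun g => F g a b)) -> polyfun (fun g => \det (F g)).
Proof.
move=> H; rewrite /determinant; apply: polyfun_sum => s.
by apply: polyfunM; [apply: polyfun_const|apply: polyfun_prod => i].
Qed.

Lemma polyfun_ext phi psi : phi =1 psi -> polyfun phi -> polyfun psi.
Proof. by move=> e [f fE]; exists f => g; rewrite -e. Qed.

(** A single nonzero polynomial is the witness, so that finite conjunctions are products.
    Invertibility is left out and added through [generic_in_G]. *)
Definition generic P :=
  exists2 f : {mpoly K[n * (m * m)]}, f != 0 & forall g, f.@[G_coords g] != 0 -> P g.

Lemma generic_imp P Q : (forall g, P g -> Q g) -> generic P -> generic Q.
Proof. by move=> PQ [f f0 fP]; exists f => // g /fP/PQ. Qed.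

Lemma generic_and P Q : generic P -> generic Q -> generic (fun g => P g /\ Q g).
Proof.
move=> [f f0 fP] [h h0 hQ]; exists (f * h) => [|g]; first by rewrite mulf_neq0.
by rewrite mevalM mulf_eq0 negb_or => /andP[/fP ? /hQ].
Qed.

Lemma generic_all (I : finType) (P : I -> T -> Prop) :
  (forall i, generic (P i)) -> generic (fun g => forall i, P i g).
Proof.
move=> H; suff [f f0 fP] : generic (fun g => forall i, i \in enum I -> P i g).
  by exists f => // g /fP gP i; apply: gP; rewrite mem_enum.
elim: (enum I) => [|i r IH]; first by exists 1; rewrite ?oner_neq0.
apply: generic_imp (generic_and (H i) IH) => g [Pi Pr] j.
by rewrite inE => /predU1P[->|/Pr].
Qed.

Lemma generic_neq0 phi : polyfun phi -> (exists g, phi g != 0) -> generic (fun g => phi g != 0).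
Proof.
move=> [f fE] [g gP]; exists f => [|h]; last by rewrite fE.
by apply: contraNneq gP => f0; rewrite fE f0 meval0.
Qed.

Lemma generic_in_G : generic (@in_G K m n).
Proof.
apply: (@generic_imp (fun g => forall j, \det (g j) != 0)) => [g H j|].
  by rewrite unitmxE unitfE.
apply: generic_all => j; apply: generic_neq0.
  by apply: polyfun_det => a b; apply: polyfun_entry.
by exists (fun=> 1%:M); rewrite det1 oner_neq0.
Qed.

Lemma generic_exists P : infinite K -> generic P -> exists g, P g.
Proof.
move=> Kinf [f f0 fP]; have [x xP] := mpoly_nonroot Kinf f0.
pose g j : 'M[K]_m := vec_mx (\row_k x (mxvec_index j k)).
exists g; apply: fP; congr (_ != 0): xP; apply: meval_eq => k.
case/mxvec_indexP: k => j k; rewrite /G_coords mxvecE mxE.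
by rewrite vec_mxK mxE.
Qed.

Lemma generic_open P : infinite K -> generic P ->
  exists U, [/\ zariski_open U, exists g, U g & forall g, U g -> in_G g /\ P g].
Proof.
move=> Kinf PG; have [f f0 fP] := PG.
exists (fun g => in_G g /\ f.@[G_coords g] != 0); split.
- by exists (eq f) => g; split=> [[? ?]|[? [_ <-]]]; split=> //; exists f.
- have fG : generic (fun g => f.@[G_coords g] != 0) by exists f.
  exact: generic_exists Kinf (generic_and generic_in_G fG).
- by move=> g [gG /fP].
Qed.

(** One member of the defining family that is nonzero at a point of [U] suffices. The open set
    attached to a given generic initial ideal can thus be intersected with further generic
    conditions. *)
Lemma open_generic (U : T -> Prop) : zariski_open U -> (exists g, U g) -> generic U.
Proof.
move=> [F FP] [g /FP[gG [f Ff fg]]].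
have fG : generic (fun g => f.@[G_coords g] != 0).
  exists f => //; apply: contraNneq fg => ->; apply/eqP; exact: meval0.
apply: generic_imp (generic_and generic_in_G fG) => h [hG fh].
by apply/FP; split=> //; exists f.
Qed.

End Generic.

(** * Monomial ideals and a degree-compatible term order *)

Section MPolyIdeal.
Variables (K : fieldType) (N : nat) (I : {mpoly K[N]} -> Prop).
Hypothesis II : is_ideal I.
Implicit Types p q : {mpoly K[N]}.

Lemma mideal0 : I 0. Proof. by case: II. Qed.

Lemma midealD p q : I p -> I q -> I (p + q). Proof. by case: II => _ H _; apply: H. Qed.

Lemma midealMl a p : I p -> I (a * p). Proof. by case: II => _ _ H; apply: H. Qed.

Lemma midealMr a p : I p -> I (p * a). Proof. by rewrite mulrC; apply: midealMl. Qed.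

Lemma midealZ c p : I p -> I (c *: p).
Proof. by rewrite -mul_mpolyC; apply: midealMl. Qed.

Lemma midealN p : I p -> I (- p). Proof. by rewrite -scaleN1r; apply: midealZ. Qed.

Lemma midealB p q : I p -> I q -> I (p - q).
Proof. by move=> Ip Iq; apply/midealD/midealN. Qed.

Lemma mideal_sum (A : Type) (r : seq A) (P : pred A) (F : A -> {mpoly K[N]}) :
  (forall i, P i -> I (F i)) -> I (\sum_(i <- r | P i) F i).
Proof. by move=> H; elim/big_ind: _ => //; [exact: mideal0|exact: midealD]. Qed.

End MPolyIdeal.

Section MonomialIdeals.
Variables (K : fieldType) (N : nat) (Nu : 'X_{1..N} -> Prop).
Hypothesis NuD : forall u v, Nu u -> Nu (u + v)%MM.

Definition mono_ideal (p : {mpoly K[N]}) := forall u, u \in msupp p -> Nu u.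

Lemma mono_ideal_ideal : is_ideal mono_ideal.
Proof.
split=> [u|p q pJ qJ u /msuppD_le|a p pJ u /msuppM_le/allpairsP[[v w] /= [_ /pJ Nw ->]]].
- by rewrite msupp0.
- by rewrite mem_cat => /orP[/pJ|/qJ].
- by rewrite addmC; apply: NuD.
Qed.

Variable le : rel 'X_{1..N}.
Hypothesis leP : is_term_order le.

Lemma initial_ideal_mono (I : {mpoly K[N]} -> Prop) :
    (forall p u, I p -> is_leading_mon le p u -> Nu u) ->
    (forall u, Nu u -> exists v w p, [/\ u = (v + w)%MM, I p & is_leading_mon le p v]) ->
  forall p, initial_ideal le I p <-> mono_ideal p.
Proof.
move=> IN NI p; split.
  apply: ideal_genP; first exact: mono_ideal_ideal.
  by move=> _ [q [u [/IN Iq /Iq Nu_u ->]]] v; rewrite msuppX inE => /eqP->.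
move=> pJ; rewrite [p]mpolyE; apply: ideal_sum => [|u /pJ Nu_u _]; first exact: ideal_gen_ideal.
have [v [w [q [-> Iq qv]]]] := NI _ Nu_u.
rewrite -mul_mpolyC mpolyXD mulrA.
have II : is_ideal (initial_ideal le I) by exact: ideal_gen_ideal.
by apply: midealMr => //; apply: midealMl => //; apply: ideal_gen_sub; exists q, v.
Qed.

End MonomialIdeals.

(** Drop from [p] its monomials in [Nu]. A power of the remainder [p'] stays in the ideal, since it
    differs from that power of [p] by a multiple of [p - p']. Its leading monomial is a power of
    that of [p'], which would then satisfy [Nu]. *)
Lemma mono_ideal_radical (K : fieldType) N (Nu : pred 'X_{1..N}) (le : rel 'X_{1..N}) :
    is_term_order le -> (forall u v, Nu u -> Nu (u + v)%MM) ->
    (forall u k, (0 < k)%N -> Nu (u *+ k)%MM -> Nu u) ->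
  is_radical (@mono_ideal K N Nu).
Proof.
move=> leP NuD NuM p [|k] pJ.
  have Nu0 : Nu 0%MM by apply: pJ; rewrite expr0 -mpolyC1 msupp1 inE.
  by move=> u _; rewrite -[u]add0m; apply: NuD.
have [J0 JD JM] := mono_ideal_ideal K NuD.
pose p' := \sum_(u <- msupp p | ~~ Nu u) p@_u *: 'X_[u].
have p'E v : p'@_v = if Nu v then 0 else p@_v.
  rewrite raddf_sum /=; under eq_bigr => u _ do rewrite mcoeffZ mcoeffX.
  have [vp|/memN_msupp_eq0 pv0] := boolP (v \in msupp p); last first.
    rewrite pv0 if_same big1 // => u _; case: eqP => [->|_]; by rewrite ?pv0 ?mul0r ?mulr0.
  rewrite -big_filter; case: ifP => Nv.
    rewrite big_seq big1 // => u; rewrite mem_filter => /andP[Nu_u _].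
    case: eqP => [e|_]; last by rewrite mulr0.
    by rewrite -e (negPf Nu_u) in Nv.
  rewrite (bigD1_seq v) ?mem_filter ?Nv ?filter_uniq ?msupp_uniq //= eqxx mulr1 big1 ?addr0 //.
  by move=> u /negPf->; rewrite mulr0.
have pJ' : mono_ideal Nu (p' ^+ k.+1).
  rewrite -[p' ^+ _](subrK (p ^+ k.+1)); apply: JD => //.
  rewrite subrXX mulrC; apply: (JM) => u; rewrite mcoeff_msupp mcoeffB p'E.
  by case: ifP => //; rewrite subrr eqxx.
have [p'0|/(leading_exists leP)[u uP]] := eqVneq p' 0.
  move=> v; rewrite mcoeff_msupp; apply: contraNT => Nv.
  by have := p'E v; rewrite p'0 mcoeff0 (negPf Nv) => <-.
have [_ H] := top_termXn leP k.+1 (leading_top_term uP).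
have Nu_u : Nu u.
  apply: (@NuM _ k.+1) => //; apply: pJ'; rewrite mcoeff_msupp H expf_neq0 //.
  by case: uP; rewrite mcoeff_msupp.
by case: uP; rewrite mcoeff_msupp p'E Nu_u eqxx.
Qed.

Lemma mnmc_le_term_order N : is_term_order (@mnmc_le N).
Proof.
split; first split.
- by move=> u; apply: (@Order.POrderTheory.lexx _ 'X_{1..N}).
- by move=> u v; apply: (@Order.POrderTheory.le_anti _ 'X_{1..N}).
- by move=> v u w; apply: (@Order.POrderTheory.le_trans _ 'X_{1..N}).
- exact: lemc_total.
- split=> [u|u v w uv]; first exact: le0m.
  have : ((w + u)%MM <= (w + v)%MM)%O by rewrite lemc_add2r.
  by rewrite addmC [(w + v)%MM]addmC.
Qed.

Lemma index_allpairs_pair (A B : eqType) (s : seq A) (t : seq B) x y :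
    x \in s -> y \in t ->
  index (x, y) [seq (a, b) | a <- s, b <- t] = (index x s * size t + index y t)%N.
Proof.
move=> xs yt; elim: s xs => //= a s IH; rewrite inE index_cat.
have [<- _|xa /= xs] := eqVneq a x.
  rewrite map_f // mul0n add0n; elim: t yt {IH} => //= b t IH.
  rewrite inE xpair_eqE eqxx /= eq_sym; case: eqVneq => //= _ /IH -> //.
rewrite ifN ?size_map ?IH ?mulSn ?addnA //.
by apply/negP => /mapP[b _ [e]]; rewrite e eqxx in xa.
Qed.

Lemma mxvec_index_val m n (i : 'I_m) (j : 'I_n) : mxvec_index i j = (i * n + j)%N :> nat.
Proof.
have /= <- : index (enum_val (enum_rank (i, j))) (enum {: 'I_m * 'I_n}) = mxvec_index i j.
  by rewrite /enum_val index_uniq -?cardE ?enum_uniq.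
rewrite enum_rankK enumT unlock /= /prod_enum index_allpairs_pair ?mem_enum // size_enum_ord.
by rewrite !index_enum_ord.
Qed.

(** Among variables, [mnmc_le] makes the one of smaller index larger, and the numbering by
    [mxvec_index] is row by row. *)
Lemma mnmc_le_column_decreasing m n : @column_decreasing m n (@mnmc_le _).
Proof.
move=> i i' j ii'.
apply: (@Order.POrderTheory.ltW _ 'X_{1..m * n}); apply/ltmcP; first by rewrite !mdeg1.
have lt_idx : (mxvec_index i j < mxvec_index i' j)%N.
  by rewrite !mxvec_index_val ltn_add2r ltn_pmul2r ?(leq_ltn_trans _ (ltn_ord j)).
exists (mxvec_index i j) => [k kij|]; rewrite !mnm1E.
  by rewrite -!val_eqE /= !gtn_eqF // (ltn_trans kij).
by rewrite -!val_eqE /= eqxx gtn_eqF.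
Qed.

(** * Multigraded components *)

Section Grading.
Variables (K : fieldType) (m n : nat).
Local Notation S := {mpoly K[m * n]}.
Implicit Types (p q : S) (d e : 'rV[int]_n) (g : 'I_n -> 'M[K]_m).

Lemma multidegE u j : @multideg m n u 0 j = (\sum_i u (mxvec_index i j))%:Z.
Proof.
rewrite /multideg summxE (big_morph Posz PoszD (erefl _)); apply: eq_bigr => i _.
rewrite summxE (bigD1 j) //= big1 => [|k kj]; last first.
  by rewrite mulmxnE mxE eqxx eq_sym (negPf kj) mul0rn.
rewrite addr0 mulmxnE mxE !eqxx /=. exact: natz.
Qed.

Lemma multidegD u v : @multideg m n (u + v)%MM = multideg u + multideg v.
Proof.
apply/rowP => j; rewrite mxE !multidegE -PoszD -big_split.
by congr Posz; apply: eq_bigr => i _; rewrite mnmDE.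
Qed.

Lemma multideg0 : @multideg m n 0%MM = 0.
Proof. by apply/rowP => j; rewrite multidegE mxE big1 // => i _; rewrite mnm0E. Qed.

Lemma mxvec_index_inj (i i' : 'I_m) (j j' : 'I_n) :
  mxvec_index i j = mxvec_index i' j' -> i = i' /\ j = j'.
Proof. by rewrite /mxvec_index => /cast_ord_inj/enum_rank_inj[]. Qed.

Lemma multidegU i j : @multideg m n U_(mxvec_index i j)%MM = delta_mx 0 j.
Proof.
apply/rowP => k; rewrite multidegE mxE eqxx /=; case: eqVneq => [->|kj].
  rewrite (bigD1 i) //= mnm1E eqxx big1 ?addn0 // => l li.
  by rewrite mnm1E; case: eqP => // /mxvec_index_inj[e]; rewrite e eqxx in li.
rewrite big1 // => l _.
by rewrite mnm1E; case: eqP => // /mxvec_index_inj[_ e]; rewrite e eqxx in kj.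
Qed.

Lemma mcoeff_hom d p u : (hom_component d p)@_u = if multideg u == d then p@_u else 0.
Proof.
rewrite raddf_sum /=; under eq_bigr => v _ do rewrite mcoeffZ mcoeffX.
have [up|/memN_msupp_eq0 pu0] := boolP (u \in msupp p); last first.
  rewrite pu0 if_same big1 // => v _; case: eqP => [->|_]; by rewrite ?pu0 ?mul0r ?mulr0.
rewrite big_mkcond (bigD1_seq u) ?msupp_uniq //= eqxx mulr1 big1 ?addr0 // => v /negPf->.
by rewrite mulr0 if_same.
Qed.

Lemma hom_sum d (A : Type) (r : seq A) (P : pred A) (F : A -> S) :
  hom_component d (\sum_(i <- r | P i) F i) = \sum_(i <- r | P i) hom_component d (F i).
Proof.
apply/mpolyP => u; rewrite mcoeff_hom !raddf_sum /=.
under [RHS]eq_bigr => i _ do rewrite mcoeff_hom.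
by case: ifP => _ //; rewrite big1.
Qed.

Lemma homZ d c p : hom_component d (c *: p) = c *: hom_component d p.
Proof.
by apply/mpolyP => u; rewrite mcoeff_hom !mcoeffZ mcoeff_hom; case: ifP => _; rewrite ?mulr0.
Qed.

Definition mhomog d p := forall u, u \in msupp p -> multideg u = d.

Lemma hom_mhomog d e p : mhomog e p -> hom_component d p = if e == d then p else 0.
Proof.
move=> pe; apply/mpolyP => u; rewrite mcoeff_hom.
have [/pe ->|/memN_msupp_eq0 pu0] := boolP (u \in msupp p).
  by case: ifP => _; rewrite ?mcoeff0.
by rewrite pu0 if_same; case: ifP => _; rewrite ?pu0 ?mcoeff0.
Qed.

Lemma mhomog_sum d (A : Type) (r : seq A) (P : pred A) (F : A -> S) :
  (forall i, P i -> mhomog d (F i)) -> mhomog d (\sum_(i <- r | P i) F i).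
Proof.
move=> H; elim/big_ind: _ => // [u|p q pd qd u /msuppD_le]; first by rewrite msupp0.
by rewrite mem_cat => /orP[/pd|/qd].
Qed.

Lemma mhomogM d e p q : mhomog d p -> mhomog e q -> mhomog (d + e) (p * q).
Proof.
by move=> pd qe u /msuppM_le/allpairsP[[v w] /= [/pd <- /qe <- ->]]; rewrite multidegD.
Qed.

Lemma mhomog_prod (A : Type) (r : seq A) (P : pred A) (F : A -> S) D :
  (forall i, P i -> mhomog (D i) (F i)) ->
  mhomog (\sum_(i <- r | P i) D i) (\prod_(i <- r | P i) F i).
Proof.
move=> H; elim: r => [|i r IH].
  by rewrite !big_nil => u; rewrite -mpolyC1 msupp1 inE => /eqP->; rewrite multideg0.
by rewrite !big_cons; case: ifP => // /H Hi; apply: mhomogM.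
Qed.

Lemma mhomogZ d c p : mhomog d p -> mhomog d (c *: p).
Proof. by move=> pd u /msuppZ_le/pd. Qed.

Lemma mhomogX u : mhomog (multideg u) 'X_[u].
Proof. by move=> v; rewrite msuppX inE => /eqP->. Qed.

Lemma mhomog_minor t p : @is_minor K m n t p -> exists d, mhomog d p.
Proof.
move=> [r [c [_ _ ->]]]; exists (\sum_b delta_mx 0 (c b)).
rewrite -det_tr; apply: mhomog_sum => s _.
rewrite -(rmorph_sign (@mpolyC _ _)) mul_mpolyC; apply: mhomogZ.
by apply: mhomog_prod => b _; rewrite !mxE -(multidegU (r (s b))); apply: mhomogX.
Qed.

Lemma determinantal_graded t : is_graded_ideal (@determinantal_ideal K m n t).
Proof.
have II := ideal_gen_ideal (@is_minor K m n t); split=> // d p [s sG ->].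
rewrite hom_sum; apply: ideal_sum => // -[a q] aq_s _ /=.
have [e qe] := mhomog_minor (sG _ aq_s).
rewrite [a]mpolyE mulr_suml hom_sum; apply: mideal_sum => // u _.
have uqe : mhomog (multideg u + e) ((a@_u *: 'X_[u]) * q).
  by apply: mhomogM => //; apply/mhomogZ/mhomogX.
rewrite (hom_mhomog _ uqe); case: ifP => _; last exact: mideal0.
by apply: midealMl => //; apply: ideal_gen_sub; apply: (sG _ aq_s).
Qed.

Lemma mhomog_G_act g u : mhomog (multideg u) (G_act g 'X_[u]).
Proof.
rewrite G_actE comp_mpolyX.
have -> : multideg u = \sum_(k < m * n) (@multideg m n U_(k)%MM) *+ u k.
  apply/rowP => j; rewrite multidegE summxE (big_morph Posz PoszD (erefl _)).
  pose F i j' := (@multideg m n U_(mxvec_index i j')%MM *+ u (mxvec_index i j')) 0 j.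
  rewrite (reindex _ (curry_mxvec_bij _ _)); transitivity (\sum_i \sum_j' F i j'); last first.
    by rewrite pair_bigA; apply: eq_bigr => -[i j'].
  rewrite /F.
  apply: eq_bigr => i _; rewrite (bigD1 j) //= big1 => [|k kj]; last first.
    by rewrite multidegU mulmxnE mxE eqxx eq_sym (negPf kj) mul0rn.
  by rewrite multidegU mulmxnE mxE !eqxx addr0 /=; apply/esym/natz.
apply: mhomog_prod => k _; case/mxvec_indexP: k => i j.
rewrite multidegU; elim: (u _) => [|b IH].
  by rewrite expr0 mulr0n => v; rewrite -mpolyC1 msupp1 inE => /eqP->; rewrite multideg0.
rewrite exprS mulrS; apply: mhomogM => //; rewrite tnth_G_subst.
by apply: mhomog_sum => l _; apply: mhomogZ; rewrite -(multidegU l); apply: mhomogX.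
Qed.

(** The action mixes only variables of the same column, so it preserves multidegrees. An element of
    [g I] can therefore be replaced by its component containing a given monomial. *)
Lemma hom_G_act g d p : hom_component d (G_act g p) = G_act g (hom_component d p).
Proof.
rewrite [in RHS]/hom_component !G_actE [X in X \mPo _]mpolyE.
rewrite !(raddf_sum (comp_mpoly (G_subst g))) hom_sum [RHS]big_mkcond; apply: eq_bigr => u _ /=.
rewrite comp_mpolyZ homZ -G_actE (hom_mhomog _ (@mhomog_G_act g u)).
by case: ifP => _; rewrite ?scaler0 // comp_mpolyZ.
Qed.

Lemma G_image_hom g (I : S -> Prop) d p :
  is_graded_ideal I -> G_image g I p -> G_image g I (hom_component d p).
Proof. by move=> [_ IH] [q Iq ->]; exists (hom_component d q); [apply: IH|apply: hom_G_act]. Qed.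

End Grading.

Section CartwrightSturmfels.
Variables (K : fieldType) (m n t : nat) (Nu : pred 'X_{1..m * n}).
Hypothesis Kinf : infinite K.
Hypothesis NuD : forall u v, Nu u -> Nu (u + v)%MM.
Hypothesis NuM : forall u k, (0 < k)%N -> Nu (u *+ k)%MM -> Nu u.

(** Since [Nu] does not depend on [g], the two inclusions for generic [g] make the initial ideal
    constant on an open set; [NuM] then makes it radical. *)
Lemma cartwright_sturmfels_mono :
    generic (fun g : 'I_n -> 'M[K]_m =>
      (forall p u, G_image g (determinantal_ideal t) p -> is_leading_mon (@mnmc_le _) p u -> Nu u) /\
      (forall u, Nu u -> exists v w p,
         [/\ u = (v + w)%MM, G_image g (determinantal_ideal t) p & is_leading_mon (@mnmc_le _) p v])) ->
  cartwright_sturmfels (@determinantal_ideal K m n t).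
Proof.
move=> gP; split; first exact: determinantal_graded.
have leP := mnmc_le_term_order (m * n).
exists (@mnmc_le _), (@mono_ideal K _ Nu); split=> //.
- exact: mnmc_le_column_decreasing.
- have [U [Uo U0 UP]] := generic_open Kinf gP; exists U; split=> // g /UP[gG [H1 H2]] p.
  exact: initial_ideal_mono.
- exact: (mono_ideal_radical leP NuD NuM).
Qed.

End CartwrightSturmfels.

Lemma mnm_neq0 N (u : 'X_{1..N}) : u != 0%MM -> exists i, u i != 0%N.
Proof.
move=> u0; apply/existsP; rewrite -[X in is_true X]negbK negb_exists; apply: contra u0 => /forallP H.
by apply/eqP/mnmP => i; rewrite mnm0E; apply/eqP; rewrite -[_ == _]negbK.
Qed.

Lemma cartwright_sturmfels1 (K : fieldType) m n : infinite K -> (0 < m)%N -> (0 < n)%N ->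
  cartwright_sturmfels (@determinantal_ideal K m n 1).
Proof.
move=> Kinf m0 n0.
apply: (@cartwright_sturmfels_mono _ _ _ _ (fun u => u != 0%MM)) => //.
- by move=> u v; apply: contraNneq => /eqP; rewrite mnmD_eq0 => /andP[].
- by move=> u [|k] // _; apply: contraNneq => ->; apply/eqP/mnmP => i; rewrite mulmnE mnm0E.
apply: generic_imp (generic_in_G K m n) => g gG; split.
  (* A constant leading monomial would be a nonzero constant term, but evaluation at the origin
     kills every 1-minor. *)
  move=> p u gp [up _]; apply: contraTneq up => ->; rewrite mcoeff_msupp negbK.
  have -> : p@_0%MM = mmap idfun (fun=> 0) p.
    rewrite -/(meval (fun=> 0) p) mevalE [in LHS](mpolyE p) raddf_sum /=.
    apply: eq_bigr => v _; rewrite mcoeffZ mcoeffX; congr (_ * _).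
    case: eqVneq => [->|/mnm_neq0[i vi]]; first by rewrite big1 // => i _; rewrite mnm0E expr0.
    by apply/esym/eqP/prodf_eq0; exists i => //; rewrite expr0n (negPf vi).
  have JI : is_ideal (fun x : K => x = 0).
    by split=> // [a b -> ->|a b ->]; rewrite ?addr0 ?mulr0.
  apply/eqP; apply: (G_image_mmap JI _ gp) => r c _ _.
  by rewrite det_mx11 mxE spreadE big1 // => l _; rewrite mul0r.
move=> u /mnm_neq0[i ui].
exists U_(i)%MM, (u - U_(i))%MM, 'X_i; split.
- by rewrite addmC submK // lep1mP.
- case/mxvec_indexP: i {ui} => i j.
  rewrite -(G_actK 'X_(mxvec_index i j) gG) G_actX.
  exists (\sum_(l < m) invmx (g j) l i *: 'X_(mxvec_index l j)) => //.
  apply: mideal_sum => [|l _]; first exact: ideal_gen_ideal.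
  apply: midealZ; first exact: ideal_gen_ideal.
  have := @det_mxsub_ideal K m n 1 (fun _ : 'I_1 => l) (fun _ : 'I_1 => j).
  by rewrite det_mx11 !mxE.
- by split=> [|v]; rewrite msuppX inE // => /eqP->; apply: (@Order.POrderTheory.lexx _ 'X_{1..m * n}).
Qed.

(** * Maximal minors with at most as many rows as columns *)

Section Substitution.
Variables (K : fieldType) (m n t : nat).
Local Notation S := {mpoly K[m * n]}.
Implicit Types (g : 'I_n -> 'M[K]_m).
Local Notation x_ i j := ('X_(mxvec_index i j) : S).
Local Notation U_ i j := (mnm1 (mxvec_index i j)).

(** The substitution kills [p], because it kills all minors, whereas [leading_comp_neq0] says that
    it cannot kill a polynomial whose leading monomial uses only variables with [C] nonzero. The
    shift [P] must be the same for all variables. *)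
Lemma leading_excluded g (y : 'I_m -> 'I_n -> S) P (C : 'I_m -> 'I_n -> K) p (u : 'X_{1..m * n}) :
    (forall i j, top_term (@mnmc_le _) (P + U_ i j)%MM (C i j) (y i j)) ->
    (forall i j, u (mxvec_index i j) != 0%N -> C i j != 0) ->
    (forall (r : 'I_t -> 'I_m) (c : 'I_t -> 'I_n), injective r -> injective c ->
      \det (\matrix_(a, b) spread (@mpolyC (m * n) K) g y (c b) 0 (r a)) = 0) ->
  G_image g (determinantal_ideal t) p -> is_leading_mon (@mnmc_le _) p u -> False.
Proof.
move=> yP CP y0 gp pu.
pose Y : (m * n).-tuple S := [tuple mxvec (\matrix_(i, j) y i j) 0 k | k < m * n].
have YE i j : tnth Y (mxvec_index i j) = y i j by rewrite tnth_mktuple mxvecE mxE.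
have /eqP[] : p \mPo Y != 0.
  apply: (@leading_comp_neq0 _ _ _ (mnmc_le_term_order _) Y P (mxvec (\matrix_(i, j) C i j) 0) p u) => //.
  - exact: lemc_mdeg.
  - by move=> k; case/mxvec_indexP: k => i j; rewrite YE mxvecE mxE.
  - by move=> k; case/mxvec_indexP: k => i j /CP; rewrite mxvecE mxE.
have JI : is_ideal (fun q : S => q = 0).
  by split=> // [a b -> ->|a b ->]; rewrite ?addr0 ?mulr0.
have H := @G_image_mmap K m n t g S (@mpolyC (m * n) K) (tnth Y) _ p JI _ gp.
apply: H => r c r_inj c_inj; rewrite -[RHS](y0 r c r_inj c_inj).
by apply: (congr1 determinant); apply/matrixP => a b; rewrite !mxE !spreadE; apply: eq_bigr => l _; rewrite YE.
Qed.

Variable le : rel 'X_{1..m * n}.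
Hypothesis leP : is_term_order le.
Hypothesis le_dec : column_decreasing le.

Lemma U_lt (i i' : 'I_m) (j : 'I_n) : (i < i')%N -> U_ i' j != U_ i j.
Proof. by move=> ii'; rewrite eq_mnm1; apply: contraTneq ii' => /mxvec_index_inj[->]; rewrite ltnn. Qed.

Lemma top_term_column (s : 'I_m) (j : 'I_n) (f : 'I_m -> K) (F : 'I_m -> S) :
    (forall l, F l = (f l)%:MP) ->
  top_term le (U_ s j) (f s) (\sum_(l < m | (s <= l)%N) x_ l j * F l).
Proof.
move=> FE; rewrite (bigD1 s) //= -[f s]addr0; apply: top_termD.
  by rewrite FE -{1}[f s]mul1r; apply: top_termMr => //; apply: top_termX.
apply: top_term_sum0 => l /andP[sl ls]; have {}sl : (s < l)%N by rewrite ltn_neqAle eq_sym ls.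
apply: (@top_term_lt _ _ _ leP (U_ l j) _ (1 * f l)); [exact: le_dec|exact: U_lt|].
by rewrite FE; apply: top_termMr => //; apply: top_termX.
Qed.

Lemma squarefree_le N q (z : 'I_q -> 'I_N) (u : 'X_{1..N}) : injective z ->
  (forall a, u (z a) != 0%N) -> (\big[+%MM/0%MM]_a U_(z a) <= u)%MM.
Proof.
move=> z_inj uz; apply/mnm_lepP => k; rewrite mnm_sumE.
have [/existsP[a /eqP <-]|] := boolP [exists a, z a == k].
  rewrite (bigD1 a) //= mnm1E eqxx big1 ?addn0 ?lt0n // => b ba.
  by rewrite mnm1E; case: eqP => // /z_inj e; rewrite e eqxx in ba.
rewrite negb_exists => /forallP H; rewrite big1 // => a _.
by rewrite mnm1E (negPf (H a)).
Qed.

End Substitution.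

Lemma inj_cover (n q : nat) (A : {set 'I_n}) : (#|A| <= q)%N -> (q <= n)%N ->
  exists2 c : 'I_q -> 'I_n, injective c & forall j, j \in A -> j \in codom c.
Proof.
move=> Aq qn; pose s := take q (enum A ++ enum (~: A)).
have sz : size (enum A ++ enum (~: A)) = n by rewrite size_cat -!cardE cardsC card_ord.
have size_s : size s = q by rewrite size_takel ?sz.
have us : uniq s.
  rewrite take_uniq // cat_uniq !enum_uniq andbT /=; apply/hasPn => j.
  by rewrite !mem_enum inE.
have tP : size s == q by apply/eqP.
pose c (a : 'I_q) := tnth (Tuple tP) a.
exists c => [|j jA]; first exact/tuple_uniqP.
have : j \in s by rewrite /s take_cat -cardE ltnNge Aq /= mem_cat mem_enum jA.
move=> js; have /tnthP[a ->] : j \in Tuple tP by [].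
exact: codom_f.
Qed.

Section LaplaceRow.
Variables (R : comNzRingType) (m : nat) (A : 'M[R]_(m, 1 + m)).

(** The signed maximal minors of [A], as cofactors of a first row of zeros: a vector killed by [A],
    whose pairing with any [x] is a determinant. *)
Definition cofactor_row : 'cV[R]_(1 + m) :=
  \col_k cofactor (col_mx (0 : 'M_(1, _)) A) (lshift m 0) k.

Lemma det_cofactor_row (x : 'rV[R]_(1 + m)) : \det (col_mx x A) = (x *m cofactor_row) 0 0.
Proof.
rewrite (expand_det_row _ (lshift m 0)) mxE; apply: eq_bigr => k _.
rewrite col_mxEu mxE; congr (_ * (_ * \det _)); apply/matrixP => a b; rewrite !mxE.
have -> : lift (lshift m 0) a = rshift 1 a by apply/val_inj.
by rewrite !(unsplitK (inr a)).
Qed.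

Lemma cofactor_row_alt a : (row a A *m cofactor_row) 0 0 = 0.
Proof.
rewrite -det_cofactor_row (@determinant_alternate _ _ _ (lshift m 0) (rshift 1 a)) //.
by move=> k; rewrite col_mxEu col_mxEd mxE.
Qed.

End LaplaceRow.

Lemma det_null_vector (R : idomainType) k (A : 'M[R]_k) (v : 'cV[R]_k) :
  v != 0 -> A *m v = 0 -> \det A = 0.
Proof.
move=> v0 Av; apply/eqP; rewrite -det_tr; apply/det0P; exists v^T; last by rewrite -trmx_mul Av trmx0.
by rewrite -trmx0 (inj_eq (@trmx_inj _ _ _)).
Qed.

Section RowsGeneric.
Variables (K : fieldType) (m n : nat).

Definition rows_generic (g : 'I_n -> 'M[K]_m) :=
  forall c : {ffun 'I_m -> 'I_m * 'I_n}, injective c ->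
    \det (\matrix_(a, k) g (c a).2 (c a).1 k) != 0.

(** For each choice [c], putting the k-th unit vector at position [c k] and zero elsewhere makes the
    determinant 1, so each of these finitely many conditions is a nonzero polynomial. *)
Lemma rows_genericP : generic rows_generic.
Proof.
apply: generic_all => c; have [/injectiveP c_inj|c_ninj] := boolP (injectiveb c); last first.
  exists 1 => [|g _ /injectiveP cb]; first exact: oner_neq0.
  by rewrite cb in c_ninj.
apply: (@generic_imp _ _ _ (fun g => \det (\matrix_(a, k) g (c a).2 (c a).1 k) != 0)) => //.
apply: generic_neq0.
  apply: polyfun_det => a k; apply: (polyfun_ext _ (polyfun_entry K (c a).2 (c a).1 k)) => g.
  by rewrite mxE.
exists (fun j => \matrix_(i, k) (c k == (i, j))%:R).
rewrite (_ : \matrix_(a, k) _ = 1%:M) ?det1 ?oner_neq0 //.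
by apply/matrixP => a k; rewrite !mxE -surjective_pairing (inj_eq c_inj) eq_sym.
Qed.

End RowsGeneric.

Section MaximalMinorsRows.
Variables (K : fieldType) (m' n : nat).
Local Notation m := (1 + m')%N.
Local Notation S := {mpoly K[m * n]}.
Local Notation x_ i j := ('X_(mxvec_index i j) : S).
Local Notation U_ i j := (mnm1 (mxvec_index i j)).
Local Notation o := (lshift m' (0 : 'I_1)).
Hypothesis mn : (m <= n)%N.

(** Products of first-row variables from [m] distinct columns will generate the initial ideal; this
    set holds the columns available for such a product. *)
Definition row_support (u : 'X_{1..m * n}) := [set j | u (mxvec_index o j) != 0%N].

Lemma gcol_top (g : 'I_n -> 'M[K]_m) j k :
  top_term (@mnmc_le _) (U_ o j) (g j o k) (gcol g j 0 k).
Proof.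
rewrite spreadE; have := top_term_column (mnmc_le_term_order _) (@mnmc_le_column_decreasing m n)
  o j (fun l => erefl (g j l k)%:MP).
by rewrite (eq_bigl predT).
Qed.

(** The maximal minor on the columns [c] has the product of their first-row variables on top, with
    coefficient the determinant of the first rows of the matrices [g (c a)]. *)
Lemma top_rows_leading (g : 'I_n -> 'M[K]_m) u : rows_generic g -> (m <= #|row_support u|)%N ->
  exists v w p, [/\ u = (v + w)%MM, G_image g (determinantal_ideal m) p
    & is_leading_mon (@mnmc_le _) p v].
Proof.
move=> gG um; pose c : {ffun 'I_m -> 'I_n} := [ffun a => enum_val (widen_ord um a)].
have c_inj : injective c.
  by move=> a b; rewrite !ffunE => /enum_val_inj/(congr1 val)/= e; apply/val_inj.
have uc a : u (mxvec_index o (c a)) != 0%N.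
  by have := enum_valP (widen_ord um a); rewrite inE ffunE.
clearbody c; pose v := (\big[+%MM/0%MM]_a U_ o (c a))%MM.
have vu : (v <= u)%MM by apply: squarefree_le => // a b /mxvec_index_inj[_ /c_inj].
exists v, (u - v)%MM, (\det (\matrix_(a, b) gcol g (c b) 0 a)); split.
- by rewrite addmC submK.
- exact: (@det_gcol_ideal _ _ _ g m id c).
- have cc_inj : injective [ffun a => (o, c a)] by move=> a b; rewrite !ffunE => -[/c_inj].
  apply: top_term_leading (gG _ cc_inj) _; rewrite -[X in top_term _ _ _ X]det_tr.
  apply: top_term_det => [|a k]; first exact: mnmc_le_term_order.
  by rewrite !mxE ffunE; apply: gcol_top.
Qed.

Lemma top_rows_excluded (g : 'I_n -> 'M[K]_m) p u : rows_generic g ->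
    G_image g (determinantal_ideal m) p -> is_leading_mon (@mnmc_le _) p u ->
  (m <= #|row_support u|)%N.
Proof.
move=> gG gp pu; rewrite leqNgt; apply/negP; rewrite ltnS => um.
have leP := mnmc_le_term_order (m * n).
have [c c_inj cP] := inj_cover um (ltnW mn).
pose VA : 'M[S]_(m', m) := \matrix_(a, k) gcol g (c a) 0 k.
pose b l j := map_mx (@mpolyC (m * n) K) (row l (g j)).
pose D l j := \det (col_mx (b l j) VA).
pose P := (\big[+%MM/0%MM]_a U_ o (c a))%MM.
pose d l j := \det (col_mx (row l (g j)) (\matrix_(a, k) g (c a) o k)).
have D_top l j : top_term (@mnmc_le _) P (d l j) (D l j).
  have -> : P = (\big[+%MM/0%MM]_(i < m) (if split i is inr a then U_ o (c a) else 0))%MM.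
    by rewrite big_split_ord /= big_ord1 (unsplitK (inl _)) add0m; apply: eq_bigr => a _; rewrite (unsplitK (inr a)).
  apply: top_term_det => // i k; rewrite !mxE; case: (split i) => a; rewrite !mxE.
    exact: top_termC.
  exact: gcol_top.
(* All columns are forced into the hyperplane orthogonal to [eta], which already contains those in
   [codom c]. Any other column is scaled by [D o j], and its first-row entry is then solved for.
   Only that entry loses its top term; hence the zero in [C], harmless because [u] does not involve
   it. *)
pose y l j : S := if j \in codom c then x_ l j * 'X_[P]
  else if l == o then - \sum_(l' < m | l' != o) x_ l' j * D l' j else x_ l j * D o j.
pose C l j := if j \in codom c then 1 else if l == o then 0 else d o j.
pose eta := cofactor_row VA.
have etaE l j : (b l j *m eta) 0 0 = D l j by rewrite -det_cofactor_row.
clearbody D.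
have y_eta j : (spread (@mpolyC (m * n) K) g y j *m eta) 0 0 = 0.
  rewrite mulmx_suml summxE; under eq_bigr => l _ do rewrite -scalemxAl mxE etaE.
  have [/codomP[a ->]|jc] := boolP (j \in codom c).
    rewrite (eq_bigr (fun l => 'X_[P] * (x_ l (c a) * D l (c a)))) => [|l _].
      rewrite -mulr_sumr; have := cofactor_row_alt VA a.
      have -> : row a VA = gcol g (c a) by apply/rowP => k; rewrite !mxE.
      rewrite mulmx_suml summxE; under eq_bigr => l _ do rewrite -scalemxAl mxE etaE.
      by move=> ->; rewrite mulr0.
    by rewrite /y codom_f mulrCA -mulrA mulrCA mulrA [X in X * _]mulrC -mulrA.
  rewrite (bigD1 o) //= /y (negPf jc) eqxx mulNr mulr_suml addrC.
  apply/eqP; rewrite subr_eq0; apply/eqP; apply: eq_bigr => l lo.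
  by rewrite ifN //; apply: mulrAC.
have d_neq0 j : j \notin codom c -> d o j != 0.
  move=> /negPf jc; pose c' : {ffun 'I_m -> 'I_m * 'I_n} := [ffun i => (o, if split i is inr a then c a else j)].
  have : injective c'.
    move=> i1 i2; rewrite !ffunE; case: (split_ordP i1) => a1 ->; case: (split_ordP i2) => a2 ->;
    rewrite ?(unsplitK (inl _)) ?(unsplitK (inr _)).
  - by rewrite !ord1.
  - by move=> [e]; rewrite e codom_f in jc.
  - by move=> [e]; rewrite -e codom_f in jc.
  - by move=> [/c_inj ->].
move=> /gG; congr (\det _ != 0); apply/matrixP => i1 k.
  by rewrite !mxE ffunE; case: (split i1) => a; rewrite !mxE.
apply: (@leading_excluded _ _ _ m g y P C p u) => //.
- move=> i j; rewrite /y /C; case: ifP => jc.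
    by rewrite addmC -[1]mul1r; apply: top_termM => //; apply: top_termX.
  case: eqP => [->|_]; last first.
    by rewrite addmC -[d o j]mul1r; apply: top_termM => //; apply: top_termX.
  suff /(top_termN leP) : top_term (@mnmc_le _) (P + U_ o j)%MM 0 (\sum_(l' < m | l' != o) x_ l' j * D l' j).
    by rewrite oppr0.
  apply: top_term_sum0 => l lo; have {}lo : (0 < l)%N.
    by rewrite lt0n; apply: contraNneq lo => l0; apply/eqP/val_inj.
  apply: (@top_term_lt _ _ _ leP (P + U_ l j)%MM _ (1 * d l j)).
  + by apply: term_order_add => //; [case: leP => -[]|apply: mnmc_le_column_decreasing].
  + by apply: contraNneq (@U_lt m n o l j lo) => /addmI ->.
  + by rewrite addmC; apply: top_termM => //; apply: top_termX.
- move=> i j uij; rewrite /C; case: ifP => [_|jc]; first exact: oner_neq0.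
  case: (i =P o) => [i0|_]; first rewrite i0 in uij.
    by have := cP j; rewrite inE uij jc => /(_ isT).
  by apply: d_neq0; rewrite jc.
- move=> r c' r_inj c'_inj.
  pose s := perm r_inj; rewrite -det_tr.
  apply: (@det_null_vector _ _ _ (\col_a eta (r a) 0)).
    (* [eta] is nonzero: its pairing [D o j0] with a row of a column outside [codom c] has a nonzero
       top coefficient. *)
    have [j0 j0c] : exists j, j \notin codom c.
      apply/existsP; rewrite -[X in is_true X]negbK negb_exists; apply/negP => /forallP H.
      suff : (n <= m')%N by rewrite leqNgt mn.
      rewrite -{1}(card_ord n) -(card_ord m') -(card_codom c_inj); apply: subset_leq_card.
      by apply/subsetP => j _; rewrite -[_ \in _]negbK.
    apply: contraNneq (d_neq0 _ j0c) => eta0; have [_ <-] := D_top o j0.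
    rewrite -etaE mxE big1 ?mcoeff0 // => k _.
    have [a ->] : exists a, k = r a by exists (s^-1 k)%g; rewrite -[r _](permE r_inj) permKV.
    by have /colP/(_ a) := eta0; rewrite !mxE => ->; rewrite mulr0.
  apply/colP => i; rewrite !mxE -[RHS](y_eta (c' i)) mxE.
  rewrite [RHS](reindex_inj r_inj); apply: eq_bigr => a _ /=; by rewrite !mxE.
Qed.

Lemma cartwright_sturmfels_rows : infinite K ->
  cartwright_sturmfels (@determinantal_ideal K m n m).
Proof.
move=> Kinf; apply: (@cartwright_sturmfels_mono _ _ _ _ (fun u => m <= #|row_support u|)%N) => //.
- move=> u v um; apply: leq_trans um _; apply: subset_leq_card; apply/subsetP => j.
  by rewrite !inE mnmDE addn_eq0 negb_and => ->.
- move=> u [|k] // _ um; apply: leq_trans um _; apply: subset_leq_card; apply/subsetP => j.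
  by rewrite !inE mulmnE muln_eq0 orbF.
apply: generic_imp (rows_genericP K m n) => g gG; split=> [p u|u].
  exact: top_rows_excluded.
exact: top_rows_leading.
Qed.

End MaximalMinorsRows.

(** * Maximal minors with at least as many rows as columns *)

Section Multilinear.
Variables (K : fieldType) (m n : nat).
Local Notation S := {mpoly K[m * n]}.
Implicit Types g : 'I_n -> 'M[K]_m.
Local Notation U_ i j := (mnm1 (mxvec_index i j)).

Lemma mhomog_gcol g j k : mhomog (delta_mx 0 j) (gcol g j 0 k).
Proof.
by rewrite gcolE -(multidegU k); apply: mhomog_G_act.
Qed.

Lemma multilinear_mon q (c : 'I_q -> 'I_n) (u : 'X_{1..m * n}) : injective c ->
    multideg u = \sum_a delta_mx 0 (c a) ->
  exists k : 'I_q -> 'I_m, u = (\big[+%MM/0%MM]_a U_ (k a) (c a))%MM.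
Proof.
move=> c_inj ud.
have du j : (\sum_i u (mxvec_index i j) = (j \in codom c))%N.
  suff dE : (\sum_a delta_mx 0 (c a) : 'rV[int]_n) 0 j = ((j \in codom c) : nat)%:Z.
    by have := multidegE u j; rewrite ud dE => -[].
  rewrite summxE; have [/codomP[a ->]|jc] := boolP (j \in codom c).
    rewrite (bigD1 a) //= mxE !eqxx big1 ?addr0 // => b ba.
    by rewrite mxE eqxx (inj_eq c_inj) eq_sym (negPf ba).
  rewrite big1 // => b _; rewrite mxE eqxx; case: (j =P c b) => // e.
  by rewrite e codom_f in jc.
have [k kP] : exists k : {ffun 'I_q -> 'I_m}, forall a, u (mxvec_index (k a) (c a)) != 0%N.
  have H a : exists i, u (mxvec_index i (c a)) != 0%N.
    apply/existsP; rewrite -[X in is_true X]negbK negb_exists; apply/negP => /forallP H.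
    have := du (c a); rewrite codom_f big1 // => i _.
    by apply/eqP; rewrite -[_ == _]negbK.
  by exists [ffun a => xchoose (H a)] => a; rewrite ffunE; apply: (xchooseP (H a)).
exists k; apply/mnmP => l; case/mxvec_indexP: l => i j; rewrite mnm_sumE.
have [/codomP[a ->]|jc] := boolP (j \in codom c); last first.
  have := du j; rewrite (negPf jc) (bigD1 i) //= => /eqP; rewrite addn_eq0 => /andP[/eqP-> _].
  rewrite big1 // => a _; rewrite mnm1E; case: eqP => // /mxvec_index_inj[_ e].
  by rewrite -e codom_f in jc.
rewrite (bigD1 a) //= big1 ?addn0 => [|b ba]; last first.
  by rewrite mnm1E; case: eqP => // /mxvec_index_inj[_ /c_inj e]; rewrite e eqxx in ba.
rewrite mnm1E; have := du (c a); rewrite codom_f (bigD1 (k a)) //=.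
have := kP a; case E: (u _) => [//|x] _; rewrite addSn => -[] /eqP; rewrite addn_eq0 => /andP[/eqP x0 /eqP s0].
case: (eqVneq i (k a)) => [->|ika]; first by rewrite eqxx E x0.
rewrite [X in nat_of_bool X](_ : _ = false); last first.
  by apply/negP => /eqP/mxvec_index_inj[e]; rewrite e eqxx in ika.
by apply/eqP; move/eqP: s0; rewrite sum_nat_eq0 => /forallP/(_ i)/implyP; apply.
Qed.

Lemma multilinear_mon_inj q (c : 'I_q -> 'I_n) (k : 'I_q -> 'I_m) i a : injective c ->
  (\big[+%MM/0%MM]_a U_ (k a) (c a))%MM (mxvec_index i (c a)) != 0%N -> k a = i.
Proof.
move=> c_inj; rewrite mnm_sumE (bigD1 a) //= big1 ?addn0 => [|b ba].
  by rewrite mnm1E eqb0 negbK => /eqP/mxvec_index_inj[].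
by rewrite mnm1E; case: eqP => // /mxvec_index_inj[_ /c_inj e]; rewrite e eqxx in ba.
Qed.

Lemma multilinear_mon_at q (c : 'I_q -> 'I_n) (k : 'I_q -> 'I_m) a :
  (\big[+%MM/0%MM]_a U_ (k a) (c a))%MM (mxvec_index (k a) (c a)) != 0%N.
Proof. by rewrite mnm_sumE (bigD1 a) //= mnm1E eqxx. Qed.

End Multilinear.

Lemma sum_shrink (I : finType) (e : I -> nat) q : (q <= \sum_i e i)%N ->
  exists b : I -> nat, (forall i, b i <= e i)%N /\ (\sum_i b i = q)%N.
Proof.
move=> qe; have [d] : {d | d = \sum_i e i - q}%N by eexists.
elim: d e qe => [|d IH] e qe de.
  exists e; split=> //; apply/eqP; rewrite eqn_leq qe -subn_eq0 -de eqxx //.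
have lt_qe : (q < \sum_i e i)%N by rewrite -subn_gt0 -de.
have [i ei] : exists i, (0 < e i)%N.
  apply/existsP; rewrite -[X in is_true X]negbK negb_exists; apply/negP => /forallP H.
  by move: lt_qe; rewrite big1 // => i _; apply/eqP; have := H i; rewrite lt0n negbK.
pose e' k := (e k - (k == i))%N.
have e'E : (\sum_k e' k).+1 = (\sum_k e k)%N.
  rewrite (bigD1 i) //= [in RHS](bigD1 i) //= /e' eqxx subn1 -addSn prednK //; congr addn.
  by apply: eq_bigr => k /negPf->; rewrite subn0.
have [|//|b [be bq]] := IH e'.
- by rewrite -ltnS e'E.
- by apply: succn_inj; rewrite de -e'E subSn // -ltnS e'E.
- by exists b; split=> // k; apply: leq_trans (be k) _; apply: leq_subr.
Qed.

Lemma enum_set_ord (I : finType) (T : {set I}) q : #|T| = q ->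
  exists2 tau : 'I_q -> I, injective tau & T = [set tau a | a in 'I_q].
Proof.
move=> <-; exists (fun a => enum_val a) => [|]; first exact: enum_val_inj.
apply/setP => x; apply/idP/imsetP => [xT|[a _ ->]]; last exact: enum_valP.
by exists (enum_rank_in xT x); rewrite // enum_rankK_in.
Qed.

Section MaximalMinorsColumns.
Variables (K : fieldType) (m n : nat).
Local Notation S := {mpoly K[m * n]}.
Local Notation x_ i j := ('X_(mxvec_index i j) : S).
Local Notation U_ i j := (mnm1 (mxvec_index i j)).
Hypothesis nm : (n <= m)%N.
Hypothesis n_gt1 : (1 < n)%N.
Implicit Types (g : 'I_n -> 'M[K]_m) (u : 'X_{1..m * n}).

(** A squarefree generator takes one variable in each column, the row indices, counted from 0,
    having sum at most m - n. There are C(m, n) such choices, as many as maximal minors. *)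
Definition small_transversal u :=
  [exists k : {ffun 'I_n -> 'I_m}, (\sum_j k j <= m - n)%N && [forall j, u (mxvec_index (k j) j) != 0%N]].

(** Let [e j] be the first row used in column [j], or [m] if there is none. These numbers have sum
    above m - n, and lowering them to the exact sum (m - n) + 1 will make a staircase of exactly m +
    1 cells. *)
Lemma no_small_transversal u : ~~ small_transversal u ->
  exists b : 'I_n -> 'I_m, (\sum_j (b j : nat) = (m - n).+1)%N /\
    (forall i j, u (mxvec_index i j) != 0%N -> b j <= i)%N.
Proof.
move=> Nu; pose e j := find (fun i : 'I_m => u (mxvec_index i j) != 0%N) (enum 'I_m).
have uE (i : 'I_m) j : u (mxvec_index i j) != 0%N -> (e j <= i)%N.
  move=> uij; rewrite leqNgt; apply/negP => /(before_find i).
  by rewrite nth_ord_enum uij.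
have [b [be bs]] : exists b : 'I_n -> nat, (forall j, b j <= e j)%N /\ (\sum_j b j = (m - n).+1)%N.
  apply: sum_shrink; rewrite ltnNge; apply: contra Nu => es.
  have em j : (e j < m)%N.
    apply: leq_ltn_trans (leq_trans _ es) _; first by rewrite (bigD1 j) //= leq_addr.
    by rewrite ltn_subrL; case: (n) n_gt1 nm => // n' _; apply: leq_ltn_trans.
  apply/existsP; exists [ffun j => Ordinal (em j)]; rewrite (eq_bigr e) => [|j _]; last by rewrite ffunE.
  rewrite es; apply/forallP => j; rewrite ffunE.
  have := @nth_find _ (Ordinal (em j)) (fun i : 'I_m => u (mxvec_index i j) != 0%N) (enum 'I_m).
  rewrite has_find size_enum_ord => /(_ (em j)).
  by have -> // : nth (Ordinal (em j)) (enum 'I_m) (e j) = Ordinal (em j); apply/val_inj/nth_enum_ord.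
(* Here [n_gt1] is essential: it gives [(m - n).+1 < m]. *)
have bm j : (b j < m)%N.
  apply: (@leq_ltn_trans (m - n).+1); first by rewrite -bs (bigD1 j) //= leq_addr.
  by rewrite -{2}(subnK nm) -addn1 ltn_add2l.
exists (fun j => Ordinal (bm j)); split=> // i j /uE; exact: leq_trans (be j).
Qed.
End MaximalMinorsColumns.

Section MaximalMinorsColumnsExcluded.
Variables (K : fieldType) (m n : nat).
Local Notation S := {mpoly K[m * n]}.
Local Notation x_ i j := ('X_(mxvec_index i j) : S).
Local Notation U_ i j := (mnm1 (mxvec_index i j)).
Hypothesis nm : (n <= m)%N.
Hypothesis n_gt1 : (1 < n)%N.
Implicit Types (g : 'I_n -> 'M[K]_m) (u : 'X_{1..m * n}).

Lemma big_staircase (R : Type) (idx : R) (op : Monoid.com_law idx) (b : 'I_n -> 'I_m)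
    (F : 'I_m * 'I_n -> R) :
  \big[op/idx]_(x in [set x : 'I_m * 'I_n | (x.1 <= b x.2)%N]) F x =
  \big[op/idx]_j \big[op/idx]_(i < m | (i <= b j)%N) F (i, j).
Proof.
rewrite (eq_bigl (fun x : 'I_m * 'I_n => xpredT x.1 && (x.1 <= b x.2)%N)) => [|x]; last by rewrite inE.
rewrite (eq_bigr (fun x => F (x.1, x.2))) => [|[] //].
rewrite -(pair_big_dep xpredT (fun (i : 'I_m) j => (i <= b j)%N) (fun i j => F (i, j))) /=.
by rewrite (exchange_big_dep xpredT).
Qed.

Lemma small_transversal_excluded g p u : rows_generic g ->
    G_image g (determinantal_ideal n) p -> is_leading_mon (@mnmc_le _) p u ->
  small_transversal u.
Proof.
move=> gG gp pu; case: (boolP (small_transversal u)) => // /(no_small_transversal nm n_gt1)[b [bs ub]].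
have leP := mnmc_le_term_order (m * n); exfalso.
(* The staircase under [b] has m + 1 cells, one more than the dimension, so vectors indexed by it
   satisfy a linear relation. *)
pose T := [set x : 'I_m * 'I_n | (x.1 <= b x.2)%N].
have cT : #|T| = (1 + m)%N.
  rewrite -sum1_card big_staircase (eq_bigr (fun j => b j + 1)%N) => [|j _].
    rewrite big_split /= bs sum_nat_const card_ord muln1 addSn subnK //.
  by rewrite (big_ord_narrow (ltn_ord (b j))) sum1_card card_ord addn1.
have [tau tau_inj TE] := enum_set_ord cT.
pose rho (x : 'I_m * 'I_n) : 'I_(1 + m) := odflt ord0 [pick a | tau a == x].
have rhoK a : rho (tau a) = a.
  by rewrite /rho; case: pickP => [c /eqP/tau_inj //|/(_ a)]; rewrite eqxx.
have tauT a : ((tau a).1 <= b (tau a).2)%N.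
  by have : tau a \in T; [rewrite TE imset_f|rewrite inE].
pose t j := U_ (b j) j.
pose wt x : 'X_{1..m * n} := if x.1 == b x.2 then t x.2 else 0%MM.
pose P := (\big[+%MM/0%MM]_j t j)%MM.
have sum_tau (R : Type) (idx : R) (op : Monoid.com_law idx) F :
    \big[op/idx]_a F (tau a) = \big[op/idx]_j \big[op/idx]_(i < m | (i <= b j)%N) F (i, j).
  by rewrite -big_staircase -/T TE big_imset //= => x y _ _; apply: tau_inj.
have PE a : (wt (tau a) + \big[+%MM/0%MM]_a' wt (tau (lift a a')) = P)%MM.
  transitivity (\big[+%MM/0%MM]_s wt (tau s))%MM; first by rewrite [RHS](bigD1_ord a).
  rewrite (sum_tau _ _ _ wt).
  apply: eq_bigr => j _; rewrite (bigD1 (b j)) //= /wt /= eqxx big1 ?addm0 // => i /andP[_ /negPf].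
  by move=> /= ->.
pose br i j := map_mx (@mpolyC (m * n) K) (row i (g j)).
(* The last cell of a column carries the part of that column from row [b j] on; every other cell
   carries a constant row. Their relation [kap] is given by maximal minors. *)
pose Nr x := if x.1 == b x.2 then \sum_(i < m | (b x.2 <= i)%N) x_ i x.2 *: br i x.2 else br x.1 x.2.
have Nr_top x k : top_term (@mnmc_le _) (wt x) (g x.2 x.1 k) (Nr x 0 k).
  rewrite /Nr /wt; case: (x.1 =P b x.2) => [->|_]; last by rewrite !mxE; apply: top_termC.
  rewrite summxE; under eq_bigr => i _ do rewrite mxE.
  apply: (top_term_column leP (@mnmc_le_column_decreasing m n) (b x.2) x.2 (f := fun i => g x.2 i k)) => l.
  by rewrite !mxE.
pose A : 'M[S]_(m, 1 + m) := \matrix_(k, a) Nr (tau a) 0 k.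
pose kap := cofactor_row A.
have Akap k : \sum_a kap a 0 * Nr (tau a) 0 k = 0.
  rewrite -[RHS](cofactor_row_alt A k) mxE; apply: eq_bigr => a _; rewrite mulrC.
  by congr (_ * _); rewrite !mxE.
pose c0 (a : 'I_(1 + m)) : K := (-1) ^+ a * \det (\matrix_(a', k) g (tau (lift a a')).2 (tau (lift a a')).1 k).
have kap_top a : top_term (@mnmc_le _) (\big[+%MM/0%MM]_a' wt (tau (lift a a'))) (c0 a) (kap a 0).
  rewrite mxE /cofactor add0n -(rmorph_sign (@mpolyC (m * n) K)); apply: top_termMl => //.
  rewrite -[X in top_term _ _ _ X]det_tr; apply: top_term_det => // a' k; rewrite !mxE.
  have -> : lift (lshift m 0) k = rshift 1 k by apply/val_inj.
  by rewrite (unsplitK (inr k)) mxE; apply: Nr_top.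
have c0_neq0 a : c0 a != 0.
  rewrite mulf_neq0 ?signr_eq0 //; pose c := [ffun a' => tau (lift a a')].
  have /gG : injective c by move=> a1 a2; rewrite !ffunE => /tau_inj/lift_inj.
  by congr (\det _ != 0); apply/matrixP => a' k; rewrite !mxE ffunE.
clearbody kap.
(* The relation [kap], regrouped by columns, says that the columns with entries [z] add up to zero.
   For i below [b j] the entry has too small a top term, but [u] does not use that variable. *)
pose z (i : 'I_m) (j : 'I_n) : S := if (b j <= i)%N then kap (rho (b j, j)) 0 * x_ i j else kap (rho (i, j)) 0.
pose C (i : 'I_m) (j : 'I_n) : K := if (b j <= i)%N then c0 (rho (b j, j)) else 0.
have tau_rho (i : 'I_m) j : (i <= b j)%N -> tau (rho (i, j)) = (i, j).
  move=> ib; have : (i, j) \in T by rewrite inE.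
  by rewrite TE => /imsetP[a _ ->]; rewrite rhoK.
have z0 k : \sum_j \sum_i z i j * (g j i k)%:MP = 0.
  rewrite -[RHS](Akap k).
  transitivity (\sum_a kap (rho (tau a)) 0 * Nr (tau a) 0 k); last first.
    by apply: eq_bigr => a _; rewrite rhoK.
  rewrite (sum_tau _ _ _ (fun x => kap (rho x) 0 * Nr x 0 k)); apply: eq_bigr => j _.
  rewrite (bigID (fun i : 'I_m => b j <= i)%N) [RHS](bigD1 (b j)) //=; congr (_ + _).
    rewrite /Nr /= eqxx summxE mulr_sumr; apply: eq_bigr => i bi.
    by rewrite /z bi !mxE mulrA.
  apply: eq_big => [i|i]; first by rewrite -ltnNge ltn_neqAle andbC.
  by rewrite -ltnNge => ib; rewrite /z /Nr /= leqNgt ib /= -val_eqE (ltn_eqF ib) !mxE.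
(* The top monomial of [kap] at the last cell of column [j] is [P - t j]; the factor ['X_[t j]]
   restores a shift [P] common to all columns. *)
apply: (@leading_excluded _ _ _ n g (fun i j => 'X_[t j] * z i j) P C p u) => //.
- move=> i j; rewrite /z /C; case: leqP => bi.
    have {1}-> : (P + U_ i j = t j + (\big[+%MM/0%MM]_a' wt (tau (lift (rho (b j, j)) a')) + U_ i j))%MM.
      by rewrite addmA -(PE (rho (b j, j))) {1}/wt tau_rho //= eqxx.
    rewrite -[c0 _]mul1r -[c0 _]mulr1; do 2?[apply: top_termM => //]; exact: top_termX.
  apply: (@top_term_lt _ _ _ leP (t j + P)%MM _ (1 * c0 (rho (i, j)))).
  + rewrite addmC; apply: term_order_add => //; first by case: leP => -[].
    exact: mnmc_le_column_decreasing.
  + by rewrite addmC; apply: contraNneq (@U_lt m n i (b j) j bi) => /addmI e; apply/eqP.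
  apply: top_termM => //; first exact: top_termX.
  rewrite -(PE (rho (i, j))) {1}/wt tau_rho 1?ltnW //= -val_eqE (ltn_eqF bi) add0m.
  exact: kap_top.
- by move=> i j /ub bi; rewrite /C bi.
move=> r c r_inj c_inj; pose xi j : S := 'X_[P - t j].
apply: (@det_null_vector _ _ _ (\col_a xi (c a))).
  have n0 : (0 < n)%N := ltnW n_gt1.
  apply/eqP => /colP/(_ (Ordinal n0))/eqP; rewrite !mxE => /eqP xi0.
  have : (xi (c (Ordinal n0)))@_(P - t (c (Ordinal n0)))%MM = 0 by rewrite xi0 mcoeff0.
  by move/eqP; rewrite mcoeffX eqxx oner_eq0.
apply/colP => a; rewrite !mxE.
transitivity ('X_[P] * \sum_j \sum_i z i j * (g j i (r a))%:MP); last by rewrite z0 mulr0.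
rewrite mulr_sumr [RHS](reindex_inj c_inj); apply: eq_bigr => a' _.
rewrite !mxE spreadE mulr_suml mulr_sumr; apply: eq_bigr => i _.
have -> : 'X_[P] = 'X_[t (c a')] * xi (c a').
  rewrite -mpolyXD addmC submK // /P (bigD1 (c a')) //=; exact: lem_addr.
by rewrite -!mulrA; congr (_ * _); rewrite mulrC -!mulrA mulrC -mulrA.
Qed.

End MaximalMinorsColumnsExcluded.

Section MaximalMinorsColumnsLeading.
Variables (K : fieldType) (m n : nat).
Local Notation S := {mpoly K[m * n]}.
Local Notation x_ i j := ('X_(mxvec_index i j) : S).
Local Notation U_ i j := (mnm1 (mxvec_index i j)).
Hypothesis nm : (n <= m)%N.
Hypothesis n_gt1 : (1 < n)%N.
Implicit Types (g : 'I_n -> 'M[K]_m) (u : 'X_{1..m * n}).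

Lemma G_act_invK g (p : S) : in_G g -> G_act (fun j => invmx (g j)) (G_act g p) = p.
Proof. by move=> gG; rewrite G_act_comp G_act_id // => j; rewrite mulVmx ?gG. Qed.

(** Evaluation at these zero-one matrices separates the maximal minors, which proves them linearly
    independent. *)
Lemma minor_indicator (r r' : n.-tuple 'I_m) :
    sorted ltn (map val r) -> sorted ltn (map val r') ->
  \det (\matrix_(i, j) (tnth r i == tnth r' j)%:R : 'M[K]_n) = (r == r')%:R.
Proof.
move=> r_sorted r'_sorted.
have tnth_inj (s : n.-tuple 'I_m) : sorted ltn (map val s) -> injective (tnth s).
  move=> s_sorted; apply/tuple_uniqP; rewrite -(map_inj_uniq val_inj).
  exact: (sorted_uniq ltn_trans ltnn).
case: eqVneq => [<-|rr'].
  rewrite (_ : \matrix_(i, j) _ = 1%:M) ?det1 //; apply/matrixP => i j.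
  by rewrite !mxE (inj_eq (tnth_inj _ r_sorted)).
have [i iP] : exists i, tnth r i \notin r'.
  apply/existsP; rewrite -[X in is_true X]negbK negb_exists; apply: contra rr' => /forallP H.
  have rr' : {subset r <= r'} by move=> _ /tnthP[i ->]; rewrite -[_ \in _]negbK.
  have r_uniq : uniq r by apply/tuple_uniqP/tnth_inj.
  have [|_ e] := uniq_min_size r_uniq rr'; first by rewrite !size_tuple.
  apply/eqP/val_inj/(inj_map val_inj).
  apply: (irr_sorted_eq ltn_trans ltnn) => // l.
  by apply/mapP/mapP => -[x xr ->]; exists x => //; rewrite ?e // -e.
apply: etrans (expand_det_row _ i) _; apply: big1 => j _; rewrite mxE.
case: eqP => [e|_]; last by rewrite mul0r.
by rewrite e mem_tnth in iP.
Qed.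

(** The maximal minors span a space of dimension C(m, n), and the exclusion leaves just as many
    possible leading monomials. A nonzero combination cannot vanish at all of them, so the
    coefficient matrix [M] is invertible, and a row of its inverse gives an element involving
    exactly one of them, which must lead. *)
Lemma small_transversal_leading g u : in_G g -> rows_generic g -> small_transversal u ->
  exists v w p, [/\ u = (v + w)%MM, G_image g (determinantal_ideal n) p
    & is_leading_mon (@mnmc_le _) p v].
Proof.
move=> gU gG /existsP[k /andP[ks /forallP ku]].
have leP := mnmc_le_term_order (m * n).
pose Kset := [set t : n.-tuple 'I_(m - n).+1 | (\sum_(i <- t) i <= m - n)%N].
pose Rset := [set t : n.-tuple 'I_m | sorted ltn (map val t)].
have cK : #|Kset| = 'C(m, n) by rewrite card_partial_ord_partitions subnKC.
have cR : #|Rset| = 'C(m, n) by rewrite card_ltn_sorted_tuples.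
have [kap kap_inj KE] := enum_set_ord cK; have [rho rho_inj RE] := enum_set_ord cR.
have rhoS b : sorted ltn (map val (rho b)).
  by have : rho b \in Rset; [rewrite RE imset_f|rewrite inE].
have wm : ((m - n).+1 <= m)%N by rewrite -{2}(subnK nm) -addn1 leq_add2l ltnW.
pose kk a j := widen_ord wm (tnth (kap a) j).
pose v a : 'X_{1..m * n} := (\big[+%MM/0%MM]_j U_ (kk a j) j)%MM.
have v_inj : injective v.
  move=> a a' e; apply/kap_inj/eq_from_tnth => j; apply/val_inj.
  have H i : v a (mxvec_index (kk a' i) i) != 0%N by rewrite e; exact: multilinear_mon_at.
  by have := multilinear_mon_inj (@inj_id _) (H j) => /(congr1 val).
pose F (c : 'rV[K]_'C(m, n)) := \sum_b c 0 b *: \det (\matrix_(i, j) gcol g j 0 (tnth (rho b) i)).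
have FI c : G_image g (determinantal_ideal n) (F c).
  have II := G_image_ideal gU (ideal_gen_ideal (@is_minor K m n n)).
  apply: mideal_sum => // b _; apply: midealZ => //.
  exact: (@det_gcol_ideal _ _ _ g n (tnth (rho b)) id).
have Fhom c : mhomog (\sum_j delta_mx 0 j) (F c).
  apply: mhomog_sum => b _; apply: mhomogZ; rewrite -det_tr; apply: mhomog_sum => s _.
  rewrite -(rmorph_sign (@mpolyC _ _)) mul_mpolyC; apply: mhomogZ; apply: mhomog_prod => j _.
  by rewrite !mxE; apply: mhomog_gcol.
have Flead c w : is_leading_mon (@mnmc_le _) (F c) w -> exists a, w = v a.
  move=> wF; have [wk] := wF; have := small_transversal_excluded nm n_gt1 gG (FI c) wF.
  move=> /existsP[k' /andP[k's /forallP wk']] _.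
  have [h wh] := @multilinear_mon m n n id w (@inj_id _) (Fhom _ _ wk).
  have hk' : h =1 k'.
    by move=> a; apply: (multilinear_mon_inj (@inj_id _)); have := wk' a; rewrite {1}wh.
  have lt_k' j : (k' j < (m - n).+1)%N by rewrite ltnS (leq_trans _ k's) // (bigD1 j) //= leq_addr.
  have : [tuple Ordinal (lt_k' j) | j < n] \in Kset.
    by rewrite inE big_tuple (eq_bigr (fun j => k' j : nat)) // => j _; rewrite tnth_mktuple.
  rewrite KE => /imsetP[a _ ka]; exists a; rewrite wh; apply: eq_bigr => j _.
  by congr (U_ _ _); apply/val_inj; rewrite hk' /= -ka tnth_mktuple.
have F_inj c : F c = 0 -> c = 0.
  move=> Fc0; apply/rowP => b0.
  pose h := \sum_b c 0 b *: \det (\matrix_(i, j) x_ (tnth (rho b) i) j).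
  have h0 : h = 0.
    rewrite -(G_act_invK h gU); suff -> : G_act g h = F c.
      by rewrite Fc0 G_actE comp_mpoly0.
    rewrite G_actE (raddf_sum (comp_mpoly (G_subst g))); apply: eq_bigr => b _ /=.
    rewrite comp_mpolyZ; congr (_ *: _); rewrite -det_map_mx; apply: (congr1 determinant).
    by apply/matrixP => i j; rewrite !mxE gcolE G_actE.
  pose e := mxvec (\matrix_(i, j) (i == tnth (rho b0) j)%:R : 'M[K]_(m, n)) 0.
  have : h.@[e] = 0 by rewrite h0 meval0.
  rewrite (raddf_sum (meval e)) (bigD1 b0) //= big1 => [|b bb0]; rewrite mevalZ -det_map_mx.
    rewrite addr0 (_ : map_mx _ _ = \matrix_(i, j) (tnth (rho b0) i == tnth (rho b0) j)%:R).
      by rewrite minor_indicator // eqxx mulr1 mxE.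
    by apply/matrixP => i j; rewrite !mxE /= mevalXU /e mxvecE mxE.
  rewrite (_ : map_mx _ _ = \matrix_(i, j) (tnth (rho b) i == tnth (rho b0) j)%:R).
    by rewrite minor_indicator // (inj_eq rho_inj) (negPf bb0) mulr0.
  by apply/matrixP => i j; rewrite !mxE /= mevalXU /e mxvecE mxE.
pose M := \matrix_(b, a) (\det (\matrix_(i, j) gcol g j 0 (tnth (rho b) i)))@_(v a).
have FM c a : (F c)@_(v a) = (c *m M) 0 a.
  by rewrite raddf_sum mxE; apply: eq_bigr => b _ /=; rewrite mcoeffZ mxE.
have M_unit : M \in unitmx.
  rewrite -row_free_unit; apply: inj_row_free => c cM; apply: F_inj; apply/eqP.
  apply: contraT => /(leading_exists leP)[w wF]; have [a wa] := Flead _ _ wF.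
  by case: wF; rewrite mcoeff_msupp wa FM cM mxE eqxx.
have lt_k j : (k j < (m - n).+1)%N by rewrite ltnS (leq_trans _ ks) // (bigD1 j) //= leq_addr.
have : [tuple Ordinal (lt_k j) | j < n] \in Kset.
  by rewrite inE big_tuple (eq_bigr (fun j => k j : nat)) // => j _; rewrite tnth_mktuple.
rewrite KE => /imsetP[a0 _ ka0]; pose c := row a0 (invmx M).
have FcE a : (F c)@_(v a) = (a0 == a)%:R by rewrite FM -row_mul mulVmx // !mxE.
have Fc0 : F c != 0.
  by apply/eqP => Fc0; have := FcE a0; rewrite Fc0 mcoeff0 eqxx => /esym/eqP; rewrite oner_eq0.
have [w wF] := leading_exists leP Fc0; have [a wa] := Flead _ _ wF.
have {a wa}wa0 : w = v a0.
  by have [] := wF; rewrite mcoeff_msupp wa FcE; case: (a0 =P a) => [->|_] //; rewrite eqxx.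
exists (v a0), (u - v a0)%MM, (F c); split=> //; last by rewrite -wa0.
rewrite addmC submK //; apply: squarefree_le => [j j' /mxvec_index_inj[]//|j].
suff -> : kk a0 j = k j by exact: ku.
by apply/val_inj; rewrite /= -ka0 tnth_mktuple.
Qed.

Lemma cartwright_sturmfels_columns : infinite K ->
  cartwright_sturmfels (@determinantal_ideal K m n n).
Proof.
move=> Kinf; apply: (@cartwright_sturmfels_mono _ _ _ _ (@small_transversal m n)) => //.
- move=> u v /existsP[k /andP[ks /forallP ku]]; apply/existsP; exists k; rewrite ks.
  by apply/forallP => j; rewrite mnmDE addn_eq0 negb_and ku.
- move=> u [|d] // _ /existsP[k /andP[ks /forallP ku]]; apply/existsP; exists k; rewrite ks.
  by apply/forallP => j; have := ku j; rewrite mulmnE muln_eq0 orbF.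
apply: generic_imp (generic_and (generic_in_G K m n) (rows_genericP K m n)) => g [gU gG].
split=> [p u|u]; first exact: small_transversal_excluded.
exact: small_transversal_leading.
Qed.

End MaximalMinorsColumnsLeading.

(** * Two-minors *)

Section InverseColumnsGeneric.
Variables (K : fieldType) (m n : nat).
Implicit Types g : 'I_n -> 'M[K]_m.

Definition inv_columns_generic g :=
  forall c : {ffun 'I_m -> 'I_m * 'I_n}, injective c ->
    \det (\matrix_(k, a) invmx (g (c a).2) k (c a).1) != 0.

Lemma det_scale_columns (R : comNzRingType) k (A : 'M[R]_k) (s : 'I_k -> R) :
  \det (\matrix_(i, a) (s a * A i a)) = (\prod_a s a) * \det A.
Proof.
have -> : \matrix_(i, a) (s a * A i a) = A *m diag_mx (\row_a s a).
  by rewrite mul_mx_diag; apply/matrixP => i a; rewrite !mxE mulrC.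
by rewrite det_mulmx det_diag mulrC; congr (_ * _); apply: eq_bigr => a _; rewrite mxE.
Qed.

(** Adjugates replace inverses to get polynomial conditions. A family where such a condition holds
    is found by inverting a family [h] whose corresponding columns are independent. *)
Lemma inv_columns_genericP : infinite K -> generic inv_columns_generic.
Proof.
move=> Kinf; apply: generic_all => c; have [/injectiveP c_inj|c_ninj] := boolP (injectiveb c); last first.
  exists 1 => [|g _ /injectiveP cb]; first exact: oner_neq0.
  by rewrite cb in c_ninj.
pose phi g := \det (\matrix_(k, a) (\adj (g (c a).2) k (c a).1)).
have phiE g : in_G g ->
    phi g = (\prod_a \det (g (c a).2)) * \det (\matrix_(k, a) invmx (g (c a).2) k (c a).1).
  move=> gG; rewrite -det_scale_columns; congr (\det _); apply/matrixP => k a.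
  rewrite !mxE /invmx gG !mxE mulrA mulfV ?mul1r //.
  by have := gG (c a).2; rewrite unitmxE unitfE.
have phi_poly : polyfun phi.
  apply: polyfun_det => k a; pose r := (c a).1; pose j := (c a).2.
  have H : polyfun (fun g : 'I_n -> 'M[K]_m => (-1) ^+ (r + k) * \det (row' r (col' k (g j)))).
    apply: polyfunM; first exact: polyfun_const.
    apply: polyfun_det => a' b'; apply: (polyfun_ext _ (polyfun_entry K j (lift r a') (lift k b'))) => g.
    by rewrite !mxE.
  by apply: polyfun_ext H => g; rewrite !mxE.
have cols : generic (fun h : 'I_n -> 'M[K]_m => \det (\matrix_(k, a) h (c a).2 k (c a).1) != 0).
  apply: generic_neq0.
    apply: polyfun_det => k a; apply: (polyfun_ext _ (polyfun_entry K (c a).2 k (c a).1)) => g.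
    by rewrite mxE.
  exists (fun j => \matrix_(k, i) (c k == (i, j))%:R).
  rewrite (_ : \matrix_(k, a) _ = 1%:M) ?det1 ?oner_neq0 //.
  by apply/matrixP => k a; rewrite !mxE -surjective_pairing (inj_eq c_inj).
have [h [hG hc]] := generic_exists Kinf (generic_and (generic_in_G K m n) cols).
have phi_generic : generic (fun g => phi g != 0).
  apply: generic_neq0 => //; exists (fun j => invmx (h j)).
  have hG' : in_G (fun j => invmx (h j)) by move=> j; rewrite unitmx_inv hG.
  rewrite phiE // mulf_neq0 //; last first.
    by congr (\det _ != 0): hc; apply/matrixP => k a; rewrite !mxE invmxK.
  by apply/prodf_neq0 => a _; have := hG' (c a).2; rewrite unitmxE unitfE.
apply: generic_imp (generic_and (generic_in_G K m n) phi_generic) => g [gG].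
by rewrite phiE // mulf_eq0 negb_or => /andP[].
Qed.

End InverseColumnsGeneric.

Lemma det2 (R : comNzRingType) (A : 'M[R]_2) : \det A = A 0 0 * A 1 1 - A 0 1 * A 1 0.
Proof.
rewrite (expand_det_row _ 0) !big_ord_recl big_ord0 addr0 /cofactor !det_mx11 !mxE.
have -> : lift 0 (0 : 'I_1) = 1 :> 'I_2 by apply/val_inj.
have -> : lift (1 : 'I_2) (0 : 'I_1) = 0 :> 'I_2 by apply/val_inj.
by rewrite expr0 expr1 mul1r mulN1r mulrN.
Qed.

Lemma det2_outer (R : comNzRingType) (p w : 'I_2 -> R) :
  \det (\matrix_(a, b) (p b * w a)) = 0.
Proof. by rewrite det2 !mxE; ring. Qed.

Section TwoMinorsExcluded.
Variables (K : fieldType) (m' n : nat).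
Local Notation m := (1 + m')%N.
Local Notation S := {mpoly K[m * n]}.
Local Notation x_ i j := ('X_(mxvec_index i j) : S).
Local Notation U_ i j := (mnm1 (mxvec_index i j)).
Hypothesis n_gt0 : (0 < n)%N.
Implicit Types (g : 'I_n -> 'M[K]_m) (u : 'X_{1..m * n}).

(* [k j = ord_max] means that no variable is selected in column [j]. *)
Definition high_corank u :=
  [exists k : {ffun 'I_n -> 'I_m}, (m <= \sum_j (m' - k j))%N &&
    [forall j, (k j == ord_max) || (u (mxvec_index (k j) j) != 0%N)]].

(** Let [e j] be the first row used in column [j], capped at [m']; the sum of the [m' - e j] is then
    at most [m']. Equality is wanted because it fixes a number of cells later on. *)
Lemma not_high_corank u : ~~ high_corank u ->
  exists k : 'I_n -> 'I_m, (\sum_j (m' - k j) = m')%N /\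
    (forall i j, u (mxvec_index i j) != 0%N -> k j <= i)%N.
Proof.
move=> Nu; pose e j := minn (find (fun i : 'I_m => u (mxvec_index i j) != 0%N) (enum 'I_m)) m'.
have em j : (e j < m)%N by rewrite ltnS geq_minr.
have uE (i : 'I_m) j : u (mxvec_index i j) != 0%N -> (e j <= i)%N.
  move=> uij; rewrite leqNgt; apply/negP => ie; have := leq_trans ie (geq_minl _ _).
  by move/(before_find i); rewrite nth_ord_enum uij.
have es : (\sum_j (m' - e j) <= m')%N.
  rewrite -ltnS ltnNge; apply: contra Nu => es.
  apply/existsP; exists [ffun j => Ordinal (em j)].
  rewrite (eq_bigr (fun j => m' - e j)%N) => [|j _]; last by rewrite ffunE.
  rewrite es; apply/forallP => j; rewrite ffunE -val_eqE /=.
  case: (leqP m' (find (fun i : 'I_m => u (mxvec_index i j) != 0%N) (enum 'I_m))) => h.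
    by apply/orP; left; rewrite /e (minn_idPr h) eqxx.
  have := @nth_find _ ord0 (fun i : 'I_m => u (mxvec_index i j) != 0%N) (enum 'I_m).
  rewrite has_find size_enum_ord => /(_ (ltnW h)).
  suff -> : nth ord0 (enum 'I_m) (find (fun i : 'I_m => u (mxvec_index i j) != 0%N) (enum 'I_m)) =
    Ordinal (em j) by move=> ->; rewrite orbT.
  by apply/ord_inj; rewrite nth_enum_ord ?ltnS ?(ltnW h) //; exact: (esym (minn_idPl (ltnW h))).
(* The whole deficit [d] is absorbed by lowering the entry of one column; it fits because the other
   summands are nonnegative. *)
pose j0 := Ordinal n_gt0; pose d := (m' - \sum_j (m' - e j))%N.
have dE : (\sum_j (m' - e j) + d = m')%N by rewrite subnKC.
have d0 : (d <= e j0)%N.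
  rewrite -(leq_add2l (m' - e j0)) subnK ?geq_minr // -{2}dE leq_add2r.
  by rewrite (bigD1 j0) //= leq_addr.
have km j : (e j - (if j == j0 then d else 0) < m)%N by apply: leq_ltn_trans (leq_subr _ _) (em j).
exists (fun j => Ordinal (km j)); split=> [|i j /uE]; last exact/leq_trans/leq_subr.
rewrite -[RHS]dE (bigD1 j0) //= ?eqxx [in RHS](bigD1 j0) //= addnAC; congr (_ + _)%N.
  by rewrite subnBA // addnBAC ?geq_minr.
by apply: eq_bigr => j /negPf ->; rewrite subn0.
Qed.

Lemma high_corank_excluded g p u : in_G g -> inv_columns_generic g ->
    G_image g (determinantal_ideal 2) p -> is_leading_mon (@mnmc_le _) p u ->
  high_corank u.
Proof.
move=> gU gG gp pu; case: (boolP (high_corank u)) => // /not_high_corank[k [ks uk]].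
have leP := mnmc_le_term_order (m * n); exfalso.
(* There are [m'] cells strictly beyond the [k j], so one more cell [(k j, j)] completes them to as
   many dual vectors as the dimension. *)
pose T := [set x : 'I_m * 'I_n | (k x.2 < x.1)%N].
have cT : #|T| = m'.
  rewrite -sum1_card (eq_bigl (fun x : 'I_m * 'I_n => xpredT x.1 && (k x.2 < x.1)%N)) => [|x]; last by rewrite inE.
  rewrite -(pair_big_dep xpredT (fun (i : 'I_m) j => (k j < i)%N) (fun _ _ => 1%N)) /=.
  rewrite (exchange_big_dep xpredT) //= -[RHS]ks; apply: eq_bigr => j _.
  have := sum1_card 'I_m; rewrite card_ord (bigID (fun i : 'I_m => k j < i)%N) /=.
  rewrite [X in (_ + X)%N](eq_bigl (fun i : 'I_m => i < (k j).+1)%N) => [|i]; last by rewrite -leqNgt.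
  rewrite (big_ord_narrow (ltn_ord (k j))) [X in (_ + X)%N]sum1_card card_ord => /eqP.
  by rewrite addnS eqSS => /eqP e; apply/eqP; rewrite -(eqn_add2r (k j)) e subnK // -ltnS.
have [tau tau_inj TE] := enum_set_ord cT.
have tauT a : (k (tau a).2 < (tau a).1)%N.
  by have : tau a \in T; [rewrite TE imset_f|rewrite inE].
pose j0 := Ordinal n_gt0.
pose c j : {ffun 'I_m -> 'I_m * 'I_n} := [ffun s => if split s is inr a then tau a else (k j, j)].
have c_inj j : injective (c j).
  move=> s1 s2; rewrite !ffunE; case: (split_ordP s1) => a1 ->; case: (split_ordP s2) => a2 ->;
    rewrite ?(unsplitK (inl _)) ?(unsplitK (inr _)).
  - by rewrite !ord1.
  - by move=> e; have := tauT a2; rewrite -e ltnn.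
  - by move=> e; have := tauT a1; rewrite e ltnn.
  - by move=> /tau_inj ->.
pose Lam j : 'M[K]_m := \matrix_(r, s) invmx (g (c j s).2) r (c j s).1.
have Lam_unit j : Lam j \in unitmx by rewrite unitmxE unitfE; apply: gG.
(* The rows of [W] are dual to the cells of [T] and one extra cell, so that at the cell [tau a] the
   forms [l] see a single coordinate. *)
pose W := invmx (Lam j0).
pose l i j s : K := (row s W *m invmx (g j)) 0 i.
have l_tau s a : l (tau a).1 (tau a).2 s = (s == rshift 1 a)%:R.
  have : (W *m Lam j0) s (rshift 1 a) = (s == rshift 1 a)%:R by rewrite mulVmx // mxE.
  by move=> <-; rewrite /l !mxE; apply: eq_bigr => r _; rewrite !mxE ffunE (unsplitK (inr a)).
(* Row 0 of [W] is orthogonal to all cells of [T]; if it were also orthogonal to [(k j, j)], the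
   invertible matrix [Lam j] would kill it. *)
have l0_neq0 j : l (k j) j (lshift m' 0) != 0.
  apply/eqP => l0; have : row (lshift m' 0) W *m Lam j = 0.
    apply/rowP => s; rewrite !mxE; case: (split_ordP s) => a ->.
      rewrite -[RHS]l0 /l mxE; apply: eq_bigr => r _; rewrite !mxE ffunE.
      by rewrite (unsplitK (inl _)).
    have l1 : l (tau a).1 (tau a).2 (lshift m' 0) = 0 by rewrite l_tau eq_lrshift.
    by rewrite -[RHS]l1 /l mxE; apply: eq_bigr => r _; rewrite !mxE ffunE (unsplitK (inr a)).
  move/(congr1 (fun w => w *m invmx (Lam j) *m Lam j0)); rewrite mulmxK // !mul0mx -row_mul mulVmx //.
  by move/rowP/(_ (lshift m' 0))/eqP; rewrite !mxE eqxx oner_eq0.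
pose t j := U_ (k j) j.
pose P := (\big[+%MM/0%MM]_j t j)%MM.
have tP j : (t j <= P)%MM by rewrite /P (bigD1 j) //=; apply: lem_addr.
(* Chosen so that the cell [tau a], after multiplication by ['X_[t j]], becomes exactly [P] times
   its variable. All but the first are smaller than [P], because the row of a cell of [T] exceeds
   [k j]. *)
pose wm (s : 'I_m) : 'X_{1..m * n} := if split s is inr a then (P - t (tau a).2 + U_ (tau a).1 (tau a).2)%MM else P.
have wm_top s : top_term (@mnmc_le _) P (s == lshift m' 0)%:R ('X_[wm s] : S).
  rewrite /wm; case: (split_ordP s) => a ->; rewrite ?(unsplitK (inl _)) ?(unsplitK (inr _)).
    by rewrite [a]ord1 eqxx; apply: top_termX.
  rewrite eq_rlshift; have lt_a := tauT a.
  apply: (@top_term_lt _ _ _ leP _ _ 1); last exact: top_termX.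
    rewrite -{2}(submK (tP (tau a).2)); apply: term_order_add => //; first by case: leP => -[].
    exact: mnmc_le_column_decreasing.
  apply: contraNneq (@U_lt m n _ _ (tau a).2 lt_a) => e; apply/eqP.
  by rewrite -[RHS]/(t _); apply: (@addmI _ (P - t (tau a).2)%MM); rewrite e submK.
pose y i j : S := 'X_[t j] * \sum_s (l i j s)%:MP * 'X_[wm s].
pose C (i : 'I_m) j : K := if (i < k j)%N then 0 else if i == k j then l i j (lshift m' 0) else 1.
apply: (@leading_excluded _ _ _ 2 g y P C p u) => //.
- move=> i j; have H : top_term (@mnmc_le _) (t j + P)%MM (l i j (lshift m' 0)) (y i j).
    rewrite -[l _ _ _]mul1r; apply: top_termM => //; first exact: top_termX.
    have -> : l i j (lshift m' 0) = \sum_s l i j s * (s == lshift m' 0)%:R.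
      by rewrite (bigD1 (lshift m' 0)) //= ?eqxx mulr1 big1 ?addr0 // => s /negPf ->; rewrite mulr0.
    by apply: top_term_sum => s _; apply: top_termMl.
  rewrite /C; case: ltnP => ik.
    apply: top_term_lt H => //; rewrite addmC.
      by apply: term_order_add => //; [case: leP => -[]|apply: mnmc_le_column_decreasing].
    by apply: contraNneq (@U_lt m n _ _ j ik) => /addmI e; apply/eqP.
  case: (i =P k j) => [e|/eqP ne]; first by rewrite {1}e addmC.
  have {}ik : (k j < i)%N by rewrite ltn_neqAle eq_sym -val_eqE in ne *; rewrite ne.
  have : (i, j) \in T by rewrite inE.
  rewrite TE => /imsetP[a _ ea]; rewrite /y (bigD1 (rshift 1 a)) //= big1 ?addr0.
    rewrite (_ : l i j _ = 1); last by have := l_tau (rshift 1 a) a; rewrite -ea /= eqxx.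
    rewrite mpolyC1 mul1r /wm (unsplitK (inr a)) -ea /= -mpolyXD addmA [(t j + _)%MM]addmC submK //.
    exact: top_termX.
  move=> s sa; rewrite (_ : l i j s = 0) ?mpolyC0 ?mul0r //.
  by have := l_tau s a; rewrite -ea /= (negPf sa).
- move=> i j /uk ik; rewrite /C ltnNge ik /=; case: (i =P k j) => [->|_]; first exact: l0_neq0.
  exact: oner_neq0.
(* Up to the factor ['X_[t j]], every spread column is the same vector [om], so the matrix has rank
   at most one. *)
move=> r c' _ _; pose om i : S := \sum_s 'X_[wm s] * (W s i)%:MP.
have yE j i : spread (@mpolyC (m * n) K) g y j 0 i = 'X_[t j] * om i.
  rewrite spreadE /y /om; under eq_bigr => i' _ do rewrite -mulrA mulr_suml.
  rewrite -mulr_sumr exchange_big; congr (_ * _); apply: eq_bigr => s _.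
  under eq_bigr => i' _ do rewrite mulrAC -mpolyCM mulrC.
  rewrite -mulr_sumr -rmorph_sum; congr (_ * _%:MP).
  have -> : W s i = (row s W *m invmx (g j) *m g j) 0 i by rewrite mulmxKV ?gU // mxE.
  by rewrite [RHS]mxE.
rewrite -[RHS](det2_outer (fun b => 'X_[t (c' b)]) (fun a => om (r a))).
by apply: (congr1 determinant); apply/matrixP => a b; rewrite [LHS]mxE [RHS]mxE yE.
Qed.

End TwoMinorsExcluded.

Section TwoMinorsLeading.
Variables (K : fieldType) (m' n : nat).
Local Notation m := (1 + m')%N.
Local Notation S := {mpoly K[m * n]}.
Local Notation x_ i j := ('X_(mxvec_index i j) : S).
Local Notation U_ i j := (mnm1 (mxvec_index i j)).
Hypothesis n_gt0 : (0 < n)%N.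
Implicit Types (g : 'I_n -> 'M[K]_m) (u : 'X_{1..m * n}).

Section Straightening.
Variables (q : nat) (c : 'I_q -> 'I_n).
Hypothesis c_inj : injective c.

Definition transversal_prod (f : 'I_q -> 'I_m) : S := \prod_a x_ (f a) (c a).

Lemma transversal_prod_tperm f a b :
  determinantal_ideal 2 (transversal_prod f - transversal_prod (f \o tperm a b)).
Proof.
have II := ideal_gen_ideal (@is_minor K m n 2).
have [->|ab] := eqVneq a b.
  rewrite (_ : transversal_prod _ = transversal_prod f) ?subrr; first exact: mideal0.
  by apply: eq_bigr => e _; rewrite /= tperm1 perm1.
rewrite /transversal_prod (bigD1 a) // (bigD1 b) 1?eq_sym //=.
rewrite [X in _ - X](bigD1 a) // [X in _ - (_ * X)](bigD1 b) 1?eq_sym //= tpermL tpermR.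
rewrite [X in _ - _ * (_ * X)](eq_bigr (fun e => x_ (f e) (c e))) => [|e /andP[ea eb]]; last first.
  by rewrite tpermD // eq_sym.
rewrite !mulrA -mulrBl; apply: midealMr => //.
have := det_mxsub_ideal K (fun e : 'I_2 => if e == 0 then f a else f b) (fun e : 'I_2 => if e == 0 then c a else c b).
by rewrite det2 !mxE /= [x_ (f b) (c a) * _]mulrC.
Qed.

Lemma transversal_prod_perm f (s : 'S_q) :
  determinantal_ideal 2 (transversal_prod f - transversal_prod (f \o s)).
Proof.
have II := ideal_gen_ideal (@is_minor K m n 2).
have [ts -> _] := prod_tpermP s; elim: ts f => [|[a b] ts IH] f.
  rewrite big_nil (_ : transversal_prod (f \o _) = transversal_prod f) ?subrr; first exact: mideal0.
  by apply: eq_bigr => e _; rewrite /= perm1.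
rewrite big_cons /=.
have -> : transversal_prod (f \o (tperm a b * \prod_(i <- ts) tperm i.1 i.2)%g) =
    transversal_prod ((f \o (\prod_(i <- ts) tperm i.1 i.2)%g) \o tperm a b).
  by apply: eq_bigr => e _; rewrite /= permM.
rewrite -(subrKA (transversal_prod (f \o (\prod_(i <- ts) tperm i.1 i.2)%g))).
by apply: midealD => //; apply: transversal_prod_tperm.
Qed.

(** Modulo 2-minors the rows may be permuted among the columns, so sorted products span the
    multilinear part of the quotient; transporting them by [g] gives the same modulo [g I_2]. *)
Lemma transversal_prod_span g p : in_G g ->
    (exists f, p = transversal_prod f) ->
  exists e : {ffun q.-tuple 'I_m -> K}, G_image g (determinantal_ideal 2)
    (p - \sum_(s : q.-tuple 'I_m | sorted leq (map val s)) e s *: G_act g (transversal_prod (tnth s))).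
Proof.
move=> gU [f ->].
have II := G_image_ideal gU (ideal_gen_ideal (@is_minor K m n 2)).
pose ok p := exists e : {ffun q.-tuple 'I_m -> K}, G_image g (determinantal_ideal 2)
    (p - \sum_(s : q.-tuple 'I_m | sorted leq (map val s)) e s *: G_act g (transversal_prod (tnth s))).
have okD p1 p2 : ok p1 -> ok p2 -> ok (p1 + p2).
  move=> [e1 H1] [e2 H2]; exists [ffun s => e1 s + e2 s].
  under eq_bigr => s _ do rewrite ffunE scalerDl.
  by rewrite big_split opprD addrACA; apply: midealD.
have okZ a p1 : ok p1 -> ok (a *: p1).
  move=> [e1 H1]; exists [ffun s => a * e1 s].
  under eq_bigr => s _ do rewrite ffunE -scalerA.
  by rewrite -scaler_sumr -scalerBr; apply: midealZ.
have ok0 : ok 0.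
  exists [ffun=> 0]; rewrite big1 ?subrr; first exact: mideal0.
  by move=> s _; rewrite ffunE scale0r.
have ok_prod h : ok (G_act g (transversal_prod h)).
  pose l := [tuple h a | a < q].
  have /tuple_permP[s sE] : perm_eq (sort_tuple (fun i j : 'I_m => i <= j)%N l) l by rewrite perm_sort.
  pose l' := sort_tuple (fun i j : 'I_m => i <= j)%N l.
  have l'_sorted : sorted leq (map val l').
    by rewrite sorted_map; apply: sort_sorted => i j; apply: leq_total.
  exists [ffun s => (s == l')%:R]; rewrite (bigD1 l') //= ffunE eqxx scale1r big1 => [|s' /andP[_ /negPf s'l']].
    rewrite addr0; exists (transversal_prod h - transversal_prod (tnth l')).
      rewrite (_ : transversal_prod (tnth l') = transversal_prod (h \o s)); first exact: transversal_prod_perm.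
      apply: eq_bigr => a _; congr 'X_(mxvec_index _ _).
      by rewrite (tnth_nth (h a)) sE (nth_map a) ?size_enum_ord ?ltn_ord // nth_ord_enum tnth_mktuple.
    by rewrite !G_actE raddfB.
  by rewrite ffunE s'l' scale0r.
rewrite -/(ok _) -(G_actK (transversal_prod f) gU).
have -> : G_act (fun j => invmx (g j)) (transversal_prod f) =
    \sum_(h : {ffun 'I_q -> 'I_m}) (\prod_a invmx (g (c a)) (h a) (f a)) *: transversal_prod h.
  rewrite G_actE rmorph_prod; under eq_bigr => a _ do rewrite /= -G_actE G_actX.
  rewrite bigA_distr_bigA; apply: eq_bigr => h _ /=.
  by rewrite -mul_mpolyC rmorph_prod -big_split; apply: eq_bigr => a _; rewrite /= mul_mpolyC.
rewrite G_actE (raddf_sum (comp_mpoly (G_subst g))).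
elim/big_ind: _ => // h _ /=; rewrite comp_mpolyZ; apply: okZ; exact: ok_prod.
Qed.

End Straightening.

Lemma transversal_prodE q (c : 'I_q -> 'I_n) (f : 'I_q -> 'I_m) :
  transversal_prod c f = 'X_[\big[+%MM/0%MM]_a U_ (f a) (c a)].
Proof. by rewrite /transversal_prod mprodXE. Qed.

(** In the selected columns, the multilinear monomials that cannot lead are as many as the sorted
    products. Adding the given monomial forces a linear relation modulo the ideal, and only the
    added monomial can lead it. *)
Lemma high_corank_leading g u : in_G g -> inv_columns_generic g -> high_corank u ->
  exists v w p, [/\ u = (v + w)%MM, G_image g (determinantal_ideal 2) p
    & is_leading_mon (@mnmc_le _) p v].
Proof.
move=> gU gG /existsP[k /andP[ks /forallP ku]].
have leP := mnmc_le_term_order (m * n).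
have II := G_image_ideal gU (ideal_gen_ideal (@is_minor K m n 2)).
pose A := [set j | k j != ord_max]; pose q := #|A|; pose c (a : 'I_q) := enum_val a.
have c_inj : injective c by move=> a b /enum_val_inj.
have cA a : c a \in A by apply: enum_valP.
pose mon (f : 'I_q -> 'I_m) : 'X_{1..m * n} := (\big[+%MM/0%MM]_a U_ (f a) (c a))%MM.
have vu : (mon (k \o c) <= u)%MM.
  apply: squarefree_le => [a b /mxvec_index_inj[_ /c_inj]//|a].
  by have := ku (c a); have := cA a; rewrite inE => /negPf ->.
have kq : (m <= \sum_(a < q) (m' - k (c a)))%N.
  apply: leq_trans ks _; rewrite (bigID (mem A)) /= [X in (_ + X)%N]big1 ?addn0.
    by rewrite big_enum_val.
  by move=> j; rewrite inE negbK => /eqP ->; rewrite subnn.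
pose std := [set t : q.-tuple 'I_m'.+1 | (\sum_(i <- t) i <= m')%N].
pose srt := [set t : q.-tuple 'I_m'.+1 | sorted leq (map val t)].
have c_std : #|std| = 'C(q + m', q) by exact: card_partial_ord_partitions.
have c_srt : #|srt| = 'C(q + m', q) by exact: card_sorted_tuples.
have [sg sg_inj SE] := enum_set_ord c_std; have [rho rho_inj RE] := enum_set_ord c_srt.
pose D := 'C(q + m', q).
(* Index 0 is the given monomial. The others are all choices of rows whose distances to the last row
   have sum at most [m']; [rev_ord] turns a distance into a row. *)
pose rows (s : 'I_(1 + D)) (a : 'I_q) : 'I_m := if split s is inr b then rev_ord (tnth (sg b) a) else k (c a).
have span s : exists e : {ffun q.-tuple 'I_m -> K}, G_image g (determinantal_ideal 2)
    (transversal_prod c (rows s) - \sum_(s : q.-tuple 'I_m | sorted leq (map val s))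
       e s *: G_act g (transversal_prod c (tnth s))).
  by apply: transversal_prod_span => //; exists (rows s).
have [e eP] := fin_all_exists span.
pose B := \matrix_(s < 1 + D, b < D) e s (rho b).
have [al al0 alB] : exists2 al : 'rV[K]_(1 + D), al != 0 & al *m B = 0.
  have : kermx B != 0.
    by rewrite -mxrank_eq0 mxrank_ker subn_eq0 -ltnNge (leq_ltn_trans (rank_leq_col B)).
  move=> kB; have [i iP] : exists i, row i (kermx B) != 0.
    apply/existsP; rewrite -[X in is_true X]negbK negb_exists; apply: contra kB => /forallP H.
    by apply/eqP/row_matrixP => i; rewrite row0; apply/eqP; rewrite -[_ == _]negbK.
  by exists (row i (kermx B)); rewrite // -row_mul mulmx_ker row0.
pose F := \sum_s al 0 s *: transversal_prod c (rows s).
have FI : G_image g (determinantal_ideal 2) F.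
  have -> : F = \sum_s al 0 s *: (transversal_prod c (rows s) - \sum_(t : q.-tuple 'I_m | sorted leq (map val t))
       e s t *: G_act g (transversal_prod c (tnth t))).
    under [RHS]eq_bigr => s _ do rewrite scalerBr.
    rewrite sumrB -[LHS]subr0; congr (_ - _); apply/esym.
    under eq_bigr => s _ do rewrite scaler_sumr.
    rewrite exchange_big big1 // => t tS; have : t \in srt by rewrite inE.
    rewrite RE => /imsetP[b _ ->]; under eq_bigr => s _ do rewrite scalerA.
    rewrite -scaler_suml; have /rowP/(_ b) := alB; rewrite !mxE => H.
    rewrite (_ : \sum_s al 0 s * e s (rho b) = 0) ?scale0r // -[RHS]H.
    by apply: eq_bigr => s _; rewrite [in RHS]mxE.
  by apply: mideal_sum => // s _; apply: midealZ.
have rows_inj s s' : rows s =1 rows s' -> s = s'.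
  have nk b : rows (lshift D 0) =1 rows (rshift 1 b) -> False.
    move=> H; suff : (\sum_(a < q) (m' - k (c a)) <= m')%N by rewrite leqNgt kq.
    have bS : sg b \in std by rewrite SE imset_f.
    rewrite inE big_tuple in bS; apply: leq_trans bS; apply: leq_sum => a _.
    have := H a; rewrite /rows (unsplitK (inl _)) (unsplitK (inr _)) => -> /=.
    by rewrite subSS subKn // -ltnS.
  case: (split_ordP s) => b ->; case: (split_ordP s') => b' -> H.
  - by rewrite !ord1.
  - by case: (nk b') => a; rewrite -H [b]ord1.
  - by case: (nk b) => a; rewrite H [b']ord1.
  - congr rshift; apply/sg_inj/eq_from_tnth => a; have := H a.
    by rewrite /rows !(unsplitK (inr _)) => /rev_ord_inj.
have mon_inj f f' : mon f = mon f' -> f =1 f'.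
  move=> ff' a; apply: (multilinear_mon_inj c_inj).
  by rewrite -/(mon f) ff'; apply: multilinear_mon_at.
have Fc s : F@_(mon (rows s)) = al 0 s.
  rewrite raddf_sum (bigD1 s) //= mcoeffZ transversal_prodE mcoeffX eqxx mulr1 big1 ?addr0 // => s' s's.
  rewrite mcoeffZ transversal_prodE mcoeffX; case: eqP => [/mon_inj/rows_inj e'|]; last by rewrite mulr0.
  by rewrite e' eqxx in s's.
have F0 : F != 0.
  by apply: contraNneq al0 => F0; apply/eqP/rowP => s; rewrite mxE -Fc F0 mcoeff0.
have [w wF] := leading_exists leP F0.
have [s ws] : exists s, w = mon (rows s).
  have [wF' _] := wF; have /flattenP := msupp_sum_le wF'.
  by move=> [_ /mapP[s _ ->]] /msuppZ_le; rewrite transversal_prodE msuppX inE => /eqP ->; exists s.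
have sE : s = lshift D 0.
  have := high_corank_excluded n_gt0 gU gG FI wF.
  case: (split_ordP s) => b sb; first by rewrite sb ord1.
  move=> /existsP[k' /andP[k's /forallP wk']]; suff : (m <= m')%N by rewrite ltnn.
  have k'A j : j \notin A -> k' j = ord_max.
    move=> jA; have := wk' j => /orP[/eqP //|]; rewrite ws mnm_sumE big1 // => a _.
    rewrite mnm1E; case: eqP => // /mxvec_index_inj[_ e'].
    by rewrite -e' cA in jA.
  have bS : sg b \in std by rewrite SE imset_f.
  rewrite inE big_tuple in bS; apply: leq_trans k's _; apply: leq_trans bS.
  rewrite (bigID (mem A)) /= [X in (_ + X)%N]big1 ?addn0 => [|j /k'A ->]; last by rewrite subnn.
  rewrite big_enum_val; apply: leq_sum => a _.
  have /orP[/eqP ->|] := wk' (c a); first by rewrite subnn.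
  rewrite ws => /(multilinear_mon_inj c_inj) <-; rewrite sb /rows (unsplitK (inr _)) /=.
  by rewrite subSS subKn // -ltnS.
exists (mon (k \o c)), (u - mon (k \o c))%MM, F; split=> //; first by rewrite addmC submK.
suff <- : w = mon (k \o c) by [].
by rewrite ws sE; apply: eq_bigr => a _; rewrite /rows (unsplitK (inl _)).
Qed.

Lemma cartwright_sturmfels2 : infinite K -> cartwright_sturmfels (@determinantal_ideal K m n 2).
Proof.
move=> Kinf; apply: (@cartwright_sturmfels_mono _ _ _ _ (@high_corank m' n)) => //.
- move=> u v /existsP[k /andP[ks /forallP ku]]; apply/existsP; exists k; rewrite ks.
  by apply/forallP => j; have /orP[->//|kj] := ku j; rewrite mnmDE addn_eq0 negb_and kj orbT.
- move=> u [|d] // _ /existsP[k /andP[ks /forallP ku]]; apply/existsP; exists k; rewrite ks.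
  by apply/forallP => j; have := ku j; rewrite mulmnE muln_eq0 orbF.
apply: generic_imp (generic_and (generic_in_G K m n) (inv_columns_genericP m n Kinf)) => g [gU gG].
split=> [p u|u]; first exact: high_corank_excluded.
exact: high_corank_leading.
Qed.

End TwoMinorsLeading.

(** * Brackets *)

Section Bracket.
Variables (R : comNzRingType) (k : nat).
Local Notation m := (4 + k)%N.
Implicit Types (Om : 'I_k -> 'rV[R]_m) (p q s : 'I_4 -> 'rV[R]_m).

(** Fixing the rows [Om] amounts to projecting from their span onto a space of dimension four, so
    the geometry is that of lines in three-space. The inner default [ord0] is never reached. *)
Definition bracket Om p : R :=
  \det (\matrix_(r, l) (if split r is inr r' then Om r' else p (if split r is inl i then i else ord0)) 0 l).

Definition four (T : Type) (x0 x1 x2 x3 : T) (i : 'I_4) : T :=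
  match val i with 0 => x0 | 1 => x1 | 2 => x2 | _ => x3 end.

Lemma eq_bracket Om p q : p =1 q -> bracket Om p = bracket Om q.
Proof.
move=> e; apply: (congr1 determinant); apply/matrixP => r l; rewrite !mxE.
by case: (split r) => ?; rewrite ?e.
Qed.

Lemma bracket_linear Om i a p q s : (forall i', i' != i -> q i' = p i') ->
    (forall i', i' != i -> s i' = p i') -> p i = a *: q i + s i ->
  bracket Om p = a * bracket Om q + bracket Om s.
Proof.
move=> pq ps pi; rewrite -[X in _ + X]mul1r.
apply: (@determinant_multilinear _ _ _ _ _ (lshift k i)).
- by apply/rowP => l; rewrite !mxE !(unsplitK (inl _)) pi !mxE mul1r.
- apply/matrixP => r l; rewrite !mxE; case: (split_ordP (lift (lshift k i) r)) => i' e //.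
  by rewrite pq //; apply/eqP => e'; have := neq_lift (lshift k i) r; rewrite e e' eqxx.
- apply/matrixP => r l; rewrite !mxE; case: (split_ordP (lift (lshift k i) r)) => i' e //.
  by rewrite ps //; apply/eqP => e'; have := neq_lift (lshift k i) r; rewrite e e' eqxx.
Qed.

Lemma bracket_alt Om p i i' : i != i' -> p i = p i' -> bracket Om p = 0.
Proof.
move=> ii' pp; apply: (@determinant_alternate _ _ _ (lshift k i) (lshift k i')).
  by rewrite (inj_eq (@lshift_inj _ _)).
by move=> l; rewrite !mxE !(unsplitK (inl _)) pp.
Qed.

Lemma bracket_alt_row Om p i r : p i = Om r -> bracket Om p = 0.
Proof.
move=> pr; apply: (@determinant_alternate _ _ _ (lshift k i) (rshift 4 r)).
  by rewrite eq_lrshift.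
by move=> l; rewrite !mxE !(unsplitK (inl _)) !(unsplitK (inr _)) pr.
Qed.

Lemma bracket_absorb Om p q i (I : finType) (P : pred I) (x : I -> R) (z : I -> 'rV[R]_m) :
    (forall i', i' != i -> q i' = p i') -> q i = p i + \sum_(l | P l) x l *: z l ->
    (forall l, P l -> (exists r, z l = Om r) \/ (exists2 i', i' != i & z l = p i')) ->
  bracket Om q = bracket Om p.
Proof.
move=> qp qi zP; pose upd w i' := if i' == i then w else p i'.
have updE : bracket Om q = bracket Om (upd (q i)).
  by apply: eq_bracket => i'; rewrite /upd; case: eqP => [->//|/eqP/qp].
rewrite updE qi; elim/big_rec: _ => [|l w Pl IH].
  by rewrite addr0; apply: eq_bracket => i'; rewrite /upd; case: eqP => [->|].
rewrite addrCA (@bracket_linear _ i (x l) _ (upd (z l)) (upd (p i + w))); first last.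
- by rewrite /upd eqxx.
- by move=> i' /negPf i'i; rewrite /upd i'i.
- by move=> i' /negPf i'i; rewrite /upd i'i.
rewrite IH; have [[r zr]|[i' i'i zi']] := zP l Pl.
  by rewrite (@bracket_alt_row _ _ i r) ?mulr0 ?add0r // /upd eqxx.
rewrite (@bracket_alt _ _ i i') ?mulr0 ?add0r 1?eq_sym //.
by rewrite /upd eqxx (negPf i'i).
Qed.

Local Notation BR Om x0 x1 x2 x3 := (bracket Om (four x0 x1 x2 x3)).

Lemma bracketD0 Om a x y x1 x2 x3 :
  BR Om (a *: x + y) x1 x2 x3 = a * BR Om x x1 x2 x3 + BR Om y x1 x2 x3.
Proof. by apply: (@bracket_linear _ 0) => //; case=> [[|[|[|[|]]]]]. Qed.

Lemma bracketD1 Om a x y x0 x2 x3 :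
  BR Om x0 (a *: x + y) x2 x3 = a * BR Om x0 x x2 x3 + BR Om x0 y x2 x3.
Proof. by apply: (@bracket_linear _ 1) => //; case=> [[|[|[|[|]]]]]. Qed.

End Bracket.

Notation BR Om x0 x1 x2 x3 := (bracket Om (four x0 x1 x2 x3)).

Lemma bracket_map (R R' : comNzRingType) (f : {rmorphism R -> R'}) k (Om : 'I_k -> 'rV[R]_(4 + k)) p :
  f (bracket Om p) = bracket (fun r => map_mx f (Om r)) (fun i => map_mx f (p i)).
Proof.
rewrite /bracket -det_map_mx; apply: (congr1 determinant); apply/matrixP => r l; rewrite !mxE.
by case: (split r) => ?; rewrite mxE.
Qed.

Section BracketTop.
Variables (K : fieldType) (N k : nat) (le : rel 'X_{1..N}).
Hypothesis leP : is_term_order le.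

Lemma bracket_top (Om : 'I_k -> 'rV[{mpoly K[N]}]_(4 + k)) (p : 'I_4 -> 'rV_(4 + k))
    (Omc : 'I_k -> 'rV[K]_(4 + k)) (pc : 'I_4 -> 'rV[K]_(4 + k)) W0 W1 W2 W3 V :
    (forall r l, top_term le (V r) (Omc r 0 l) (Om r 0 l)) ->
    (forall i l, top_term le (four W0 W1 W2 W3 i) (pc i 0 l) (p i 0 l)) ->
  top_term le ((W0 + W1 + W2 + W3) + \big[+%MM/0%MM]_r V r)%MM
    (bracket Omc pc) (bracket Om p).
Proof.
move=> OmP pP; pose WV (r : 'I_(4 + k)) :=
  if split r is inr r' then V r' else four W0 W1 W2 W3 (if split r is inl i then i else ord0).
have -> : ((W0 + W1 + W2 + W3) + \big[+%MM/0%MM]_r V r = \big[+%MM/0%MM]_r WV r)%MM.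
  rewrite big_split_ord /= !big_ord_recl big_ord0 addm0 /WV !(unsplitK (inl _)) /four /= -!addmA.
  by do 4!congr (_ + _)%MM; apply: eq_bigr => r _; rewrite (unsplitK (inr _)).
apply: top_term_det => // r l; rewrite !mxE /WV.
by case: (split r) => ?.
Qed.

End BracketTop.

Section SpecialRows.
Variables (K : fieldType) (N m t : nat).
Local Notation S := {mpoly K[N]}.
Variables (J : S -> Prop) (w : 'I_t -> 'rV[S]_m).
Hypothesis JI : is_ideal J.
Hypothesis wJ : forall psi : 'I_t -> 'I_m, J (\det (\matrix_(a, b) w a 0 (psi b))).

(* Laplace expansion along the rows that do not come from [w]. *)
Lemma det_special_rows s (M : 'M[S]_s) (psi : 'I_s -> 'I_m) (phi : 'I_t -> 'I_s) :
  injective phi -> (forall a l, M (phi a) l = w a 0 (psi l)) -> J (\det M).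
Proof.
elim: s M psi phi => [|s IH] M psi phi phi_inj MP.
  have t0 : t = 0%N by have := leq_card phi phi_inj; rewrite !card_ord leqn0 => /eqP.
  have := wJ (fun a => psi (phi a)); suff -> : \det (\matrix_(a, b) w a 0 (psi (phi b))) = \det M by [].
  by case: t t0 w wJ phi phi_inj MP => // _ *; rewrite !det_mx00.
have [i ni|phi_surj] := pickP (fun i => i \notin codom phi).
  rewrite (expand_det_row _ i); apply: mideal_sum => // l _; apply: midealMl => //.
  have phi' a : {a' | lift i a' = phi a}.
    case: (unliftP i (phi a)) => [a' ->|e]; first by exists a'.
    by rewrite -e codom_f in ni.
  rewrite /cofactor -(rmorph_sign (@mpolyC _ _)) mul_mpolyC; apply: midealZ => //.
  apply: (IH _ (fun l' => psi (lift l l')) (fun a => sval (phi' a))) => [a b e|a l'].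
    by apply: phi_inj; rewrite -(svalP (phi' a)) -(svalP (phi' b)) e.
  by rewrite !mxE (svalP (phi' a)) MP.
have ts : t = s.+1.
  have le_ts := leq_card phi phi_inj; rewrite !card_ord in le_ts.
  have : (#|'I_s.+1| <= #|codom phi|)%N.
    by apply: subset_leq_card; apply/subsetP => i _; have /negbFE := phi_surj i.
  by rewrite (card_codom phi_inj) !card_ord => le_st; apply/eqP; rewrite eqn_leq le_ts.
case: _ / ts M psi phi phi_inj MP {phi_surj IH} => M psi phi phi_inj MP.
have -> : \det M = (-1) ^+ (perm phi_inj) * \det (row_perm (perm phi_inj) M).
  by rewrite det_row_perm mulrA -expr2 sqrr_sign mul1r.
apply: midealMl => //; suff -> : row_perm (perm phi_inj) M = \matrix_(a, b) w a 0 (psi b) by [].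
by apply/matrixP => a b; rewrite !mxE permE MP.
Qed.

End SpecialRows.

Section InitialMonomials.
Variables (K : fieldType) (N : nat) (le : rel 'X_{1..N}).
Hypothesis leP : is_term_order le.
Variable I : {mpoly K[N]} -> Prop.
Hypothesis II : is_ideal I.

(** A monomial occurring in a combination of monomials is a multiple of one of them, and a monomial
    multiple of an element of [I] has the corresponding leading monomial. *)
Lemma initial_ideal_lead u : initial_ideal le I 'X_[u] -> exists2 p, I p & is_leading_mon le p u.
Proof.
move=> [s sG sE]; have us : u \in msupp (\sum_(x <- s) x.1 * x.2) by rewrite -sE msuppX inE.
have /flattenP[r /mapP[x xs ->]] := msupp_sum_le us.
rewrite filter_predT in xs; move=> /msuppM_le/allpairsP[[v w] /= [_ wx ->]].
have [p [w' [Ip pw' xE]]] := sG _ xs.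
move: wx; rewrite xE msuppX inE => /eqP ->; exists ('X_[v] * p); first exact: midealMl.
have [pn0 _] := pw'; rewrite mcoeff_msupp in pn0.
have := top_termM leP (top_termX K leP v) (leading_top_term pw'); rewrite mul1r.
exact: top_term_leading.
Qed.

End InitialMonomials.

(** * Leading monomials forced by collinearity *)

Lemma bracket_alt12 (R : comNzRingType) k (Om : 'I_k -> 'rV[R]_(4 + k)) x y z : BR Om x y y z = 0.
Proof. exact: (@bracket_alt _ _ _ _ 1 2). Qed.

Lemma elim1_expand (R : comNzRingType) (x a b a' b' : R) :
  (x * a + a') * b - a * (x * b + b') = a' * b - a * b'.
Proof. by ring. Qed.

Lemma elim3_expand (R : comNzRingType) (x y h1 h1' h2 h2' m00 m01 m10 m11 : R) :
  h1 * h2 * (y * (x * m00 + m10) + (x * m01 + m11)) - h1 * (y * h2 + h2') * (x * m00 + m10)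
    - (x * h1 + h1') * h2 * (y * m00 + m01) + (x * h1 + h1') * (y * h2 + h2') * m00 =
  h1 * h2 * m11 - h1 * h2' * m10 - h1' * h2 * m01 + h1' * h2' * m00.
Proof. by ring. Qed.

Section Degenerate.
Variables (K : fieldType) (kap e n : nat).
Local Notation k := (kap + e)%N.
Local Notation m := (4 + k)%N.
Local Notation t := (3 + e)%N.
Local Notation S := {mpoly K[m * n]}.
Local Notation x_ i j := ('X_(mxvec_index i j) : S).
Local Notation U_ i j := (mnm1 (mxvec_index i j)).
Local Notation ix i := (inord i : 'I_m).
Implicit Types (g : 'I_n -> 'M[K]_m) (j : 'I_n) (c : 'I_e -> 'I_n).

Lemma ix_kap : ix kap = kap :> nat.
Proof. by rewrite inordK // -[X in (_ < X)%N]/((3 + k).+1) ltnS addnC -addnA leq_addr. Qed.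

Lemma ix_kap1 : ix kap.+1 = kap.+1 :> nat.
Proof. by rewrite inordK // -[X in (_ < X)%N]/((2 + k).+2) !ltnS addnC -addnA leq_addr. Qed.

Lemma ix0 : ix 0 = 0%N :> nat. Proof. by rewrite inordK. Qed.

Lemma ix1 : ix 1 = 1%N :> nat. Proof. by rewrite inordK. Qed.

Definition brow g i j : 'rV[S]_m := map_mx (@mpolyC (m * n) K) (row i (g j)).

Lemma kap_le_m : (kap <= m)%N.
Proof. by rewrite addnC -addnA leq_addr. Qed.

Definition low_row (i : 'I_kap) : 'I_m := widen_ord kap_le_m i.

(** The rows of index below [kap] of column [j] will absorb the corresponding variables of that
    column; the [e] full columns, together with three more in the bracket, make up the t columns of
    a minor. *)
Definition OmS g c j (r : 'I_k) : 'rV[S]_m :=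
  match split r with inl i => brow g (low_row i) j | inr s => gcol g (c s) end.

Definition OmK g c j (r : 'I_k) : 'rV[K]_m :=
  match split r with inl i => row (low_row i) (g j) | inr s => row (ix 0) (g (c s)) end.

Definition tail g (s : 'I_m) j : 'rV[S]_m := \sum_(l < m | (s <= l)%N) x_ l j *: brow g l j.

Lemma gcol_tail g (s : 'I_m) j :
  gcol g j = tail g s j + \sum_(l < m | (l < s)%N) x_ l j *: brow g l j.
Proof.
rewrite /gcol /spread (bigID (fun l : 'I_m => s <= l)%N) /=; congr (_ + _).
by apply: eq_bigl => l; rewrite -ltnNge.
Qed.

Lemma gcol_tail1 g j : gcol g j = x_ (ix 0) j *: brow g (ix 0) j + tail g (ix 1) j.
Proof.
rewrite (gcol_tail g (ix 1)) addrC; congr (_ + _).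
rewrite (big_pred1 (ix 0)) // => l; rewrite ix1 ltnS leqn0.
apply/eqP/eqP => [l0|->]; last exact: ix0.
by apply/ord_inj; rewrite l0 ix0.
Qed.

(** Three full columns among the first four rows and [e] more in [OmS] are t columns; Laplace
    expansion along all other rows leaves t-minors. *)
Lemma bracket_ideal g c j p (i1 i2 i3 : 'I_4) j1 j2 j3 : in_G g ->
    uniq [:: i1; i2; i3] -> p i1 = gcol g j1 -> p i2 = gcol g j2 -> p i3 = gcol g j3 ->
  G_image g (determinantal_ideal t) (bracket (OmS g c j) p).
Proof.
move=> gU; rewrite /= !inE negb_or -!andbA => /and4P[i12 i13 i23 _] p1 p2 p3.
have II := G_image_ideal gU (ideal_gen_ideal (@is_minor K m n t)).
pose cc (a : 'I_t) := match split a with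
  inl i => match val i with 0 => j1 | 1 => j2 | _ => j3 end | inr s => c s end.
pose phi (a : 'I_t) : 'I_m := match split a with
  inl i => lshift k (match val i with 0 => i1 | 1 => i2 | _ => i3 end)
  | inr s => rshift 4 (rshift kap s) end.
apply: (@det_special_rows _ _ m t _ (fun a => gcol g (cc a)) II _ _ _ id phi).
- move=> psi; rewrite -det_tr.
  rewrite (_ : _^T = \matrix_(a, b) gcol g (cc b) 0 (psi a)); first exact: det_gcol_ideal.
  by apply/matrixP => a b; rewrite !mxE.
- move=> a b; rewrite /phi; case: (split_ordP a) => a' ->; case: (split_ordP b) => b' ->;
    rewrite ?(unsplitK (inl _)) ?(unsplitK (inr _)).
  + move/lshift_inj; case: a' => [[|[|[|]]] ?] //; case: b' => [[|[|[|]]] ?] //= e';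
      rewrite ?e' ?eqxx // in i12 i13 i23 *; first [by apply: congr1; apply: val_inj|by rewrite -e' eqxx in i12 i13 i23].
  + by move/eqP; rewrite eq_lrshift.
  + by move/eqP; rewrite eq_rlshift.
  + by move/rshift_inj/rshift_inj ->.
- move=> a l; rewrite mxE /phi /cc; case: (split a) => [i|s].
    by rewrite (unsplitK (inl _)); case: i => [[|[|[|]]] ?] //=; rewrite ?p1 ?p2 ?p3.
  by rewrite (unsplitK (inr _)) /OmS (unsplitK (inr _)).
Qed.

Variable le : rel 'X_{1..m * n}.
Hypothesis leP : is_term_order le.
Hypothesis le_dec : column_decreasing le.

Lemma top_term_eqw w w' a (p : S) : w = w' -> top_term le w a p -> top_term le w' a p.
Proof. by move=> ->. Qed.

Lemma tail_top g s j l : top_term le (U_ s j) (row s (g j) 0 l) (tail g s j 0 l).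
Proof.
rewrite summxE mxE; under eq_bigr => i _ do rewrite mxE.
by apply: (top_term_column leP le_dec s j (f := fun i => g j i l)) => i; rewrite !mxE.
Qed.

Lemma brow_top g i j l : top_term le 0%MM (row i (g j) 0 l) (brow g i j 0 l).
Proof. by rewrite !mxE; apply: top_termC. Qed.

Lemma gcol_top0 g j l : top_term le (U_ (ix 0) j) (row (ix 0) (g j) 0 l) (gcol g j 0 l).
Proof.
rewrite (gcol_tail g (ix 0)) big1 ?addr0 => [|i]; first exact: tail_top.
by rewrite ix0.
Qed.

Definition cmon c : 'X_{1..m * n} := (\big[+%MM/0%MM]_s U_ (ix 0) (c s))%MM.

Lemma OmS_top g c j (p : 'I_4 -> 'rV[S]_m) (pc : 'I_4 -> 'rV[K]_m) W0 W1 W2 W3 :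
    (forall i l, top_term le (four W0 W1 W2 W3 i) (pc i 0 l) (p i 0 l)) ->
  top_term le ((W0 + W1 + W2 + W3) + cmon c)%MM (bracket (OmK g c j) pc) (bracket (OmS g c j) p).
Proof.
move=> H; have -> : cmon c = (\big[+%MM/0%MM]_(r < k) match split r with inl _ => 0 | inr s => U_ (ix 0) (c s) end)%MM.
  rewrite big_split_ord /= big1 ?add0m => [|i _]; last by rewrite (unsplitK (inl _)).
  by apply: eq_bigr => s _; rewrite (unsplitK (inr _)).
apply: bracket_top => // r l; rewrite /OmK /OmS; case: (split r) => i.
  exact: brow_top.
exact: gcol_top0.
Qed.

Lemma OmS_top4 g c j (x0 x1 x2 x3 : 'rV[S]_m) (y0 y1 y2 y3 : 'rV[K]_m) W0 W1 W2 W3 :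
    (forall l, top_term le W0 (y0 0 l) (x0 0 l)) -> (forall l, top_term le W1 (y1 0 l) (x1 0 l)) ->
    (forall l, top_term le W2 (y2 0 l) (x2 0 l)) -> (forall l, top_term le W3 (y3 0 l) (x3 0 l)) ->
  top_term le ((W0 + W1 + W2 + W3) + cmon c)%MM (BR (OmK g c j) y0 y1 y2 y3) (BR (OmS g c j) x0 x1 x2 x3).
Proof.
move=> H0 H1 H2 H3; apply: OmS_top.
case=> [[|[|[|[|i]]]] lt_i] l; [exact: H0|exact: H1|exact: H2|exact: H3|].
by exfalso; move: lt_i.
Qed.

(* Write [v w]_j for the bracket with v_j1, v, row kap of g_j, w and the rows given by
   [OmS g c j].  With a the row 0 of g_j2, the element
   [v_j2 v_j3]_j3 [a v_j4]_j4 - [a v_j3]_j3 [v_j2 v_j4]_j4 of the ideal is unchanged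
   when v_j2 is replaced by its tail without x_0j2, so its leading monomial is the
   following one if this coefficient does not vanish. *)
Definition elim1 g c j1 j2 j3 j4 :=
  BR (OmK g c j3) (row (ix 0) (g j1)) (row (ix 1) (g j2)) (row (ix kap) (g j3)) (row (ix kap.+1) (g j3)) *
  BR (OmK g c j4) (row (ix 0) (g j1)) (row (ix 0) (g j2)) (row (ix kap) (g j4)) (row (ix kap.+1) (g j4)) -
  BR (OmK g c j3) (row (ix 0) (g j1)) (row (ix 0) (g j2)) (row (ix kap) (g j3)) (row (ix kap.+1) (g j3)) *
  BR (OmK g c j4) (row (ix 0) (g j1)) (row (ix 1) (g j2)) (row (ix kap) (g j4)) (row (ix kap.+1) (g j4)).

Lemma elim1_leading g c j1 j2 j3 j4 : in_G g -> elim1 g c j1 j2 j3 j4 != 0 ->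
  exists2 p, G_image g (determinantal_ideal t) p &
    is_leading_mon le p
      (U_ (ix 0) j1 + U_ (ix 0) j1 + U_ (ix 1) j2 + U_ (ix kap.+1) j3 + U_ (ix kap.+1) j4 + cmon c + cmon c)%MM.
Proof.
move=> gU gn0; have II := G_image_ideal gU (ideal_gen_ideal (@is_minor K m n t)).
pose h (j : 'I_n) (v w : 'rV[S]_m) : S := BR (OmS g c j) (gcol g j1) v (brow g (ix kap) j) w.
pose p : S := h j3 (gcol g j2) (gcol g j3) * h j4 (brow g (ix 0) j2) (gcol g j4) -
  h j3 (brow g (ix 0) j2) (gcol g j3) * h j4 (gcol g j2) (gcol g j4).
exists p.
  apply: midealB => //; first apply: midealMr => //; last apply: midealMl => //.
    exact: (@bracket_ideal _ _ _ _ ord0 1 3 j1 j2 j3).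
  exact: (@bracket_ideal _ _ _ _ ord0 1 3 j1 j2 j4).
(* Rows below [kap] occur in [OmS] and row [kap] is the third argument, so only the part of the
   column from row kap + 1 on counts. *)
have h_tail j v : h j v (gcol g j) = h j v (tail g (ix kap.+1) j).
  apply: (@bracket_absorb _ _ _ _ _ 3 _ (fun l : 'I_m => l < ix kap.+1)%N (fun l => x_ l j) (fun l => brow g l j)).
  - by case=> [[|[|[|[|]]]]].
  - exact: gcol_tail.
  - move=> l; rewrite ix_kap1 ltnS leq_eqVlt => /orP[/eqP lk|lk]; [right|left].
      by exists 2 => //=; congr brow; apply/val_inj; rewrite /= lk ix_kap.
    exists (lshift e (Ordinal lk)); rewrite /OmS (unsplitK (inl _)); congr brow.
    exact/val_inj.
have pE : p = h j3 (tail g (ix 1) j2) (tail g (ix kap.+1) j3) * h j4 (brow g (ix 0) j2) (tail g (ix kap.+1) j4) -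
    h j3 (brow g (ix 0) j2) (tail g (ix kap.+1) j3) * h j4 (tail g (ix 1) j2) (tail g (ix kap.+1) j4).
  have hD j w : h j (gcol g j2) w = x_ (ix 0) j2 * h j (brow g (ix 0) j2) w + h j (tail g (ix 1) j2) w.
    by rewrite /h (gcol_tail1 g j2) bracketD1.
  rewrite /p !h_tail !hD; exact: elim1_expand.
have h_top1 j : top_term le (U_ (ix 0) j1 + U_ (ix 1) j2 + 0 + U_ (ix kap.+1) j + cmon c)%MM
    (BR (OmK g c j) (row (ix 0) (g j1)) (row (ix 1) (g j2)) (row (ix kap) (g j)) (row (ix kap.+1) (g j)))
    (h j (tail g (ix 1) j2) (tail g (ix kap.+1) j)).
  by apply: OmS_top4 => l; [exact: gcol_top0|exact: tail_top|exact: brow_top|exact: tail_top].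
have h_top0 j : top_term le (U_ (ix 0) j1 + 0 + 0 + U_ (ix kap.+1) j + cmon c)%MM
    (BR (OmK g c j) (row (ix 0) (g j1)) (row (ix 0) (g j2)) (row (ix kap) (g j)) (row (ix kap.+1) (g j)))
    (h j (brow g (ix 0) j2) (tail g (ix kap.+1) j)).
  apply: OmS_top4 => l; [exact: gcol_top0|exact: brow_top|exact: brow_top|exact: tail_top].
rewrite pE; apply: (top_term_leading gn0); rewrite /elim1; apply: (top_termB leP).
  apply: (top_term_eqw _ (top_termM leP (h_top1 j3) (h_top0 j4))).
  by apply/mnmP => z; rewrite !mnmDE !mnm0E; ring.
apply: (top_term_eqw _ (top_termM leP (h_top0 j3) (h_top1 j4))).
  by apply/mnmP => z; rewrite !mnmDE !mnm0E; ring.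
Qed.

(* The analogous cancellation, now removing the variables of row 0 from both v_j1
   and v_j2: this is the coefficient in [p q a_4 v_j4], where p = v_j1 H1(a_1) - a_1 H1(v_j1)
   and q = v_j2 H2(a_2) - a_2 H2(v_j2). *)
Definition elim3 g c j1 j2 j3 j4 :=
  let: (a1, b1, a2, b2) := (row (ix 0) (g j1), row (ix 1) (g j1), row (ix 0) (g j2), row (ix 1) (g j2)) in
  let: (a3, a4, b4) := (row (ix kap) (g j3), row (ix kap) (g j4), row (ix kap.+1) (g j4)) in
  let H1 x := BR (OmK g c j3) x b2 a2 a3 in
  let H2 x := BR (OmK g c j3) x b1 a1 a3 in
  let M x y := BR (OmK g c j4) x y a4 b4 in
  H1 a1 * H2 a2 * M b1 b2 - H1 a1 * H2 b2 * M b1 a2 - H1 b1 * H2 a2 * M a1 b2 + H1 b1 * H2 b2 * M a1 a2.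

Lemma elim3_leading g c j1 j2 j3 j4 : in_G g -> elim3 g c j1 j2 j3 j4 != 0 ->
  exists2 p, G_image g (determinantal_ideal t) p &
    is_leading_mon le p
      ((U_ (ix 1) j1 + U_ (ix 1) j2 + U_ (ix kap) j3) + (U_ (ix 1) j1 + U_ (ix 1) j2 + U_ (ix kap) j3)
        + U_ (ix kap.+1) j4 + cmon c + cmon c + cmon c)%MM.
Proof.
move=> gU gn0; have II := G_image_ideal gU (ideal_gen_ideal (@is_minor K m n t)).
pose v1 := gcol g j1; pose v2 := gcol g j2; pose v3 := gcol g j3; pose v4 := gcol g j4.
pose a1 := brow g (ix 0) j1; pose a2 := brow g (ix 0) j2; pose a4 := brow g (ix kap) j4.
pose v1' := tail g (ix 1) j1; pose v2' := tail g (ix 1) j2.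
pose v3' := tail g (ix kap) j3; pose v4' := tail g (ix kap.+1) j4.
pose H1 x : S := BR (OmS g c j3) x v2 a2 v3; pose H2 x : S := BR (OmS g c j3) x v1 a1 v3.
pose M x y : S := BR (OmS g c j4) x y a4 v4.
have H1v1 : G_image g (determinantal_ideal t) (H1 v1).
  exact: (@bracket_ideal _ _ _ _ 0 1 3 j1 j2 j3).
have H2v2 : G_image g (determinantal_ideal t) (H2 v2).
  exact: (@bracket_ideal _ _ _ _ 0 1 3 j2 j1 j3).
have Mv : G_image g (determinantal_ideal t) (M v1 v2).
  exact: (@bracket_ideal _ _ _ _ 0 1 3 j1 j2 j4).
have absorb3 x y z : BR (OmS g c j3) x y z v3 = BR (OmS g c j3) x y z v3'.
  apply: (@bracket_absorb _ _ _ _ _ 3 _ (fun l : 'I_m => l < ix kap)%N (fun l => x_ l j3) (fun l => brow g l j3)).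
  - by case=> [[|[|[|[|]]]]].
  - exact: gcol_tail.
  - move=> l; rewrite ix_kap => lk; left; exists (lshift e (Ordinal lk)).
    by rewrite /OmS (unsplitK (inl _)); congr brow; apply/val_inj.
have absorb4 x y : M x y = BR (OmS g c j4) x y a4 v4'.
  apply: (@bracket_absorb _ _ _ _ _ 3 _ (fun l : 'I_m => l < ix kap.+1)%N (fun l => x_ l j4) (fun l => brow g l j4)).
  - by case=> [[|[|[|[|]]]]].
  - exact: gcol_tail.
  - move=> l; rewrite ix_kap1 ltnS leq_eqVlt => /orP[/eqP lk|lk]; [right|left].
      by exists 2 => //=; congr brow; apply/val_inj; rewrite /= lk ix_kap.
    exists (lshift e (Ordinal lk)); rewrite /OmS (unsplitK (inl _)); congr brow.
    exact/val_inj.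
have v1E : v1 = x_ (ix 0) j1 *: a1 + v1' by exact: gcol_tail1.
have v2E : v2 = x_ (ix 0) j2 *: a2 + v2' by exact: gcol_tail1.
have tv1 : forall l, top_term le (U_ (ix 1) j1) (row (ix 1) (g j1) 0 l) (v1' 0 l) := tail_top g _ _.
have tv2 : forall l, top_term le (U_ (ix 1) j2) (row (ix 1) (g j2) 0 l) (v2' 0 l) := tail_top g _ _.
have tv3 : forall l, top_term le (U_ (ix kap) j3) (row (ix kap) (g j3) 0 l) (v3' 0 l) := tail_top g _ _.
have tv4 : forall l, top_term le (U_ (ix kap.+1) j4) (row (ix kap.+1) (g j4) 0 l) (v4' 0 l) := tail_top g _ _.
have ta1 : forall l, top_term le 0%MM (row (ix 0) (g j1) 0 l) (a1 0 l) := brow_top g _ _.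
have ta2 : forall l, top_term le 0%MM (row (ix 0) (g j2) 0 l) (a2 0 l) := brow_top g _ _.
have ta4 : forall l, top_term le 0%MM (row (ix kap) (g j4) 0 l) (a4 0 l) := brow_top g _ _.
clearbody v1 v2 v3 v4 v1' v2' v3' v4' a1 a2 a4.
(* Each summand contains [M v1 v2], [H2 v2] or [H1 v1], a bracket with three full columns. Together
   they cancel the first-row variables of both [j1] and [j2]. *)
pose p : S := H1 a1 * H2 a2 * M v1 v2 - H1 a1 * H2 v2 * M v1 a2 - H1 v1 * H2 a2 * M a1 v2 + H1 v1 * H2 v2 * M a1 a2.
exists p.
  apply: midealD => //; last by apply: midealMr => //; apply: midealMr.
  apply: midealB => //; last by apply: midealMr => //; apply: midealMr.
  by apply: midealB => //; [apply: midealMl|apply: midealMr => //; apply: midealMl].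
pose H1' x : S := BR (OmS g c j3) x v2' a2 v3'; pose H2' x : S := BR (OmS g c j3) x v1' a1 v3'.
pose M' x y : S := BR (OmS g c j4) x y a4 v4'.
(* The argument [a2] of [H1] already removes the first-row part of [v2]; likewise [a1] in [H2]. *)
have H1E x : H1 x = H1' x.
  by rewrite /H1 absorb3 v2E bracketD1 bracket_alt12 mulr0 add0r.
have H2E x : H2 x = H2' x.
  by rewrite /H2 absorb3 v1E bracketD1 bracket_alt12 mulr0 add0r.
have H1D : H1' v1 = x_ (ix 0) j1 * H1' a1 + H1' v1' by rewrite v1E; apply: bracketD0.
have H2D : H2' v2 = x_ (ix 0) j2 * H2' a2 + H2' v2' by rewrite v2E; apply: bracketD0.
have MD0 y : M' v1 y = x_ (ix 0) j1 * M' a1 y + M' v1' y by rewrite v1E; apply: bracketD0.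
have MD1 x : M' x v2 = x_ (ix 0) j2 * M' x a2 + M' x v2' by rewrite v2E; apply: bracketD1.
have pE : p = H1' a1 * H2' a2 * M' v1' v2' - H1' a1 * H2' v2' * M' v1' a2
    - H1' v1' * H2' a2 * M' a1 v2' + H1' v1' * H2' v2' * M' a1 a2.
  have ME x y : M x y = M' x y := absorb4 x y.
  rewrite /p !ME !H1E !H2E H1D H2D !MD1 !MD0; exact: elim3_expand.
have top1 (x : 'rV[S]_m) W (xc : 'rV[K]_m) : (forall l, top_term le W (xc 0 l) (x 0 l)) ->
    top_term le (W + U_ (ix 1) j2 + 0 + U_ (ix kap) j3 + cmon c)%MM
      (BR (OmK g c j3) xc (row (ix 1) (g j2)) (row (ix 0) (g j2)) (row (ix kap) (g j3))) (H1' x).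
  by move=> H; apply: OmS_top4.
have top2 (x : 'rV[S]_m) W (xc : 'rV[K]_m) : (forall l, top_term le W (xc 0 l) (x 0 l)) ->
    top_term le (W + U_ (ix 1) j1 + 0 + U_ (ix kap) j3 + cmon c)%MM
      (BR (OmK g c j3) xc (row (ix 1) (g j1)) (row (ix 0) (g j1)) (row (ix kap) (g j3))) (H2' x).
  by move=> H; apply: OmS_top4.
have topM (x y : 'rV[S]_m) W V (xc yc : 'rV[K]_m) : (forall l, top_term le W (xc 0 l) (x 0 l)) ->
    (forall l, top_term le V (yc 0 l) (y 0 l)) ->
    top_term le (W + V + 0 + U_ (ix kap.+1) j4 + cmon c)%MM
      (BR (OmK g c j4) xc yc (row (ix kap) (g j4)) (row (ix kap.+1) (g j4))) (M' x y).
  by move=> H H'; apply: OmS_top4.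
rewrite pE; apply: (top_term_leading gn0); rewrite /elim3.
apply: top_termD; last first.
  apply: (top_term_eqw _ (top_termM leP (top_termM leP (top1 _ _ _ tv1) (top2 _ _ _ tv2))
    (topM _ _ _ _ _ _ ta1 ta2))).
  by apply/mnmP => z; rewrite !mnmDE !mnm0E; ring.
apply: (top_termB leP); last first.
  apply: (top_term_eqw _ (top_termM leP (top_termM leP (top1 _ _ _ tv1) (top2 _ _ _ ta2))
    (topM _ _ _ _ _ _ ta1 tv2))).
  by apply/mnmP => z; rewrite !mnmDE !mnm0E; ring.
apply: (top_termB leP); last first.
  apply: (top_term_eqw _ (top_termM leP (top_termM leP (top1 _ _ _ ta1) (top2 _ _ _ tv2))
    (topM _ _ _ _ _ _ tv1 ta2))).
  by apply/mnmP => z; rewrite !mnmDE !mnm0E; ring.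
apply: (top_term_eqw _ (top_termM leP (top_termM leP (top1 _ _ _ ta1) (top2 _ _ _ ta2))
  (topM _ _ _ _ _ _ tv1 tv2))).
  by apply/mnmP => z; rewrite !mnmDE !mnm0E; ring.
Qed.

End Degenerate.

(** * An explicit family in general position *)

(** Expansion along the first row, on functions of natural numbers, so that integer determinants
    reduce by computation. *)
Fixpoint laplace_det (n : nat) (s : nat -> nat -> int) : int :=
  if n is n'.+1 then
    foldr (fun j acc => s 0%N j * ((-1) ^+ j * laplace_det n' (fun i j' => s i.+1 (bump j j'))) + acc) 0 (iota 0 n)
  else 1.

Lemma laplace_detE n (s : nat -> nat -> int) : \det (\matrix_(i < n, j < n) s i j) = laplace_det n s.
Proof.
elim: n s => [|n IH] s; first by rewrite det_mx00.
rewrite (expand_det_row _ 0); transitivity (\sum_(j < n.+1)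
    s 0%N j * ((-1) ^+ j * laplace_det n (fun i j' => s i.+1 (bump j j')))).
  apply: eq_bigr => j _; rewrite mxE -IH /cofactor add0n; congr (_ * (_ * \det _)).
  by apply/matrixP => i j'; rewrite !mxE.
rewrite -(big_mkord xpredT (fun j => s 0%N j * ((-1) ^+ j * laplace_det n (fun i j' => s i.+1 (bump j j')))))
  unlock /index_iota subn0.
exact: erefl.
Qed.

Section GenericConditions.
Variables (K : fieldType) (kap e n : nat).
Local Notation k := (kap + e)%N.
Local Notation m := (4 + k)%N.
Local Notation ix i := (inord i : 'I_m).
Implicit Types (g : 'I_n -> 'M[K]_m) (j : 'I_n).

Lemma polyfun_bracket (c : 'I_e -> 'I_n) j i0 j0 i1 j1 i2 j2 i3 j3 :
  polyfun (fun g => BR (OmK g c j) (row i0 (g j0)) (row i1 (g j1)) (row i2 (g j2)) (row i3 (g j3))).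
Proof.
apply: polyfun_det => r l; case: (split_ordP r) => a ->.
  case: a => [[|[|[|[|a]]]] lt_a].
  - by apply: (polyfun_ext _ (polyfun_entry K j0 i0 l)) => g; rewrite mxE (unsplitK (inl _)) mxE.
  - by apply: (polyfun_ext _ (polyfun_entry K j1 i1 l)) => g; rewrite mxE (unsplitK (inl _)) mxE.
  - by apply: (polyfun_ext _ (polyfun_entry K j2 i2 l)) => g; rewrite mxE (unsplitK (inl _)) mxE.
  - by apply: (polyfun_ext _ (polyfun_entry K j3 i3 l)) => g; rewrite mxE (unsplitK (inl _)) mxE.
  - by exfalso; move: lt_a.
case: (split_ordP a) => b ->.
  apply: (polyfun_ext _ (polyfun_entry K j (low_row e b) l)) => g.
  by rewrite mxE (unsplitK (inr _)) /OmK (unsplitK (inl _)) mxE.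
apply: (polyfun_ext _ (polyfun_entry K (c b) (ix 0) l)) => g.
by rewrite mxE (unsplitK (inr _)) /OmK (unsplitK (inr _)) mxE.
Qed.

Section Lines.
Variable col : 'I_(4 + e) -> 'I_n.
Hypothesis col_inj : injective col.
Let jj (i : 'I_4) := col (lshift e i).
Let c (s : 'I_e) := col (rshift 4 s).

(* The matrix [dbr ji g a b] defines a bilinear form on the product of the lines
   spanned by rows 0, 1 of the first two matrices; it vanishes at (p, q) when the
   line p q meets the linear space attached to column [ji]. *)
Definition dbr (ji : 'I_4) g (a b : nat) : K :=
  BR (OmK g c (jj ji)) (row (ix a) (g (jj 0))) (row (ix b) (g (jj 1)))
    (row (ix kap) (g (jj ji))) (row (ix kap.+1) (g (jj ji))).

(** By Cramer's rule, these brackets and those of [kbr] describe the coordinates along rows kap + 1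
    and [kap] of a point in the linear space of column [ji]. *)
Definition lbr (ji : 'I_4) g (b : nat) : K :=
  BR (OmK g c (jj ji)) (row (ix 1) (g (jj 0))) (row (ix b) (g (jj 1)))
    (row (ix kap) (g (jj ji))) (row (ix 0) (g (jj 0))).

Definition kbr (ji : 'I_4) g (b : nat) : K :=
  BR (OmK g c (jj ji)) (row (ix 1) (g (jj 0))) (row (ix b) (g (jj 1)))
    (row (ix 0) (g (jj 0))) (row (ix kap.+1) (g (jj ji))).

Definition q2 g := dbr 2 g 1 0 * dbr 3 g 0 0 - dbr 2 g 0 0 * dbr 3 g 1 0.
Definition q1 g := dbr 2 g 1 0 * dbr 3 g 0 1 + dbr 2 g 1 1 * dbr 3 g 0 0
  - dbr 2 g 0 0 * dbr 3 g 1 1 - dbr 2 g 0 1 * dbr 3 g 1 0.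
Definition q0 g := dbr 2 g 1 1 * dbr 3 g 0 1 - dbr 2 g 0 1 * dbr 3 g 1 1.

(* The resultant of q2 X^2 + q1 X Y + q0 Y^2 and x X + y Y; the quadratic form is the
   condition that p q meets both spaces, once p is eliminated. *)
Definition qres g x y := q2 g * y * y - q1 g * x * y + q0 g * x * x.

(** The conditions are cited by index: 0 to 3 are the leading coefficients needed for X_0 to X_3, 4
    says that the form of column 2 is nondegenerate, 5 that the quadratic has degree two, 6 to 8 are
    resultants for coprimality, and 9 and 10 keep two linear coordinates from being proportional. *)
Definition position_functions : seq (('I_n -> 'M[K]_m) -> K) :=
  [:: (fun g => elim1 g c (jj 0) (jj 1) (jj 2) (jj 3));
      (fun g => elim1 g c (jj 1) (jj 0) (jj 2) (jj 3));
      (fun g => elim3 g c (jj 0) (jj 1) (jj 2) (jj 3));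
      (fun g => elim3 g c (jj 0) (jj 1) (jj 3) (jj 2));
      (fun g => dbr 2 g 1 0 * dbr 2 g 0 1 - dbr 2 g 1 1 * dbr 2 g 0 0);
      q2;
      (fun g => qres g (dbr 2 g 0 0) (dbr 2 g 0 1));
      (fun g => qres g (lbr 2 g 0) (lbr 2 g 1));
      (fun g => qres g (lbr 3 g 0) (lbr 3 g 1));
      (fun g => kbr 2 g 0 * lbr 2 g 1 - kbr 2 g 1 * lbr 2 g 0);
      (fun g => kbr 3 g 0 * lbr 3 g 1 - kbr 3 g 1 * lbr 3 g 0)].

Let polyfun_dbr ji a b : polyfun (fun g => dbr ji g a b).
Proof. exact: polyfun_bracket. Qed.

Let polyfun_lbr ji b : polyfun (fun g => lbr ji g b).
Proof. exact: polyfun_bracket. Qed.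

Let polyfun_kbr ji b : polyfun (fun g => kbr ji g b).
Proof. exact: polyfun_bracket. Qed.

Let polyfun_q2 : polyfun q2.
Proof. by apply: polyfunB; apply: polyfunM; apply: polyfun_dbr. Qed.

Let polyfun_q1 : polyfun q1.
Proof. by apply: polyfunB; [apply: polyfunB; [apply: polyfunD|]|]; apply: polyfunM; apply: polyfun_dbr. Qed.

Let polyfun_q0 : polyfun q0.
Proof. by apply: polyfunB; apply: polyfunM; apply: polyfun_dbr. Qed.

Let polyfun_qres phi psi : polyfun phi -> polyfun psi -> polyfun (fun g => qres g (phi g) (psi g)).
Proof.
move=> phiP psiP; apply: polyfunD; [apply: polyfunB|]; apply: polyfunM => //; exact: polyfunM.
Qed.

Lemma position_functions_polyfun : forall i : 'I_11, polyfun (nth (fun=> 0) position_functions i).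
Proof.
have H1 j1 j2 j3 j4 : polyfun (fun g => elim1 g c j1 j2 j3 j4).
  by apply: polyfunB; apply: polyfunM; apply: polyfun_bracket.
have H3 j1 j2 j3 j4 : polyfun (fun g => elim3 g c j1 j2 j3 j4).
  have H (phi psi chi : _ -> K) : polyfun phi -> polyfun psi -> polyfun chi ->
      polyfun (fun g => phi g * psi g * chi g) by move=> *; do 2!apply: polyfunM => //.
  by apply: polyfunD; [apply: polyfunB; [apply: polyfunB|]|]; apply: H; exact: polyfun_bracket.
case=> [[|[|[|[|[|[|[|[|[|[|[|i]]]]]]]]]]] lt_i]; rewrite [nth _ _ _]/=.
- exact: H1.
- exact: H1.
- exact: H3.
- exact: H3.
- by apply: polyfunB; apply: polyfunM; apply: polyfun_dbr.
- exact: polyfun_q2.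
- by apply: polyfun_qres; apply: polyfun_dbr.
- by apply: polyfun_qres; apply: polyfun_lbr.
- by apply: polyfun_qres; apply: polyfun_lbr.
- by apply: polyfunB; apply: polyfunM; [apply: polyfun_kbr|apply: polyfun_lbr|apply: polyfun_kbr|apply: polyfun_lbr].
- by apply: polyfunB; apply: polyfunM; [apply: polyfun_kbr|apply: polyfun_lbr|apply: polyfun_kbr|apply: polyfun_lbr].
- by exfalso; move: lt_i.
Qed.

Definition embed (s : seq int) : 'rV[K]_m := row_mx (\row_(l < 4) (s`_l)%:~R) 0.

Lemma bracket_embed (Om : 'I_k -> 'rV[K]_m) s0 s1 s2 s3 : (forall r, Om r = delta_mx 0 (rshift 4 r)) ->
  BR Om (embed s0) (embed s1) (embed s2) (embed s3) =
  (laplace_det 4 (fun i l => (nth [::] [:: s0; s1; s2; s3] i)`_l))%:~R.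
Proof.
move=> OmE; rewrite -laplace_detE -det_map_mx.
rewrite /bracket (_ : \matrix_(r, l) _ = block_mx (map_mx intr
    (\matrix_(i < 4, l < 4) (nth [::] [:: s0; s1; s2; s3] i)`_l)) 0 0 1%:M).
  by rewrite det_ublock det1 mulr1.
apply/matrixP => r l; rewrite mxE; case: (split_ordP r) => a ->; case: (split_ordP l) => b ->.
- rewrite block_mxEul !mxE.
  by case: a => [[|[|[|[|a]]]] lt_a] //; rewrite /four row_mxEl mxE.
- rewrite block_mxEur mxE.
  by case: a => [[|[|[|[|a]]]] lt_a] //; rewrite /four row_mxEr mxE.
- by rewrite block_mxEdl OmE !mxE eqxx /= eq_lrshift.
- by rewrite block_mxEdr OmE !mxE eqxx /= eq_rshift eq_sym.
Qed.

(** The two lines are spanned by the unit vectors 0, 1 and 2, 3. The rows entering [OmK] are unit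
    vectors beyond the fourth coordinate, which reduces each bracket to a 4 by 4 integer
    determinant. The quadratic becomes z^2 - 1, so its irreducibility is not at stake. *)
Definition sample_row (a : 'I_(4 + e)) (i : 'I_m) : 'rV[K]_m :=
  match split a with
  | inl j => match val j with
    | 0 => embed (if i == 0%N :> nat then [:: 1; 0; 0; 0] else [:: 0; 1; 0; 0])
    | 1 => embed (if i == 0%N :> nat then [:: 0; 0; 1; 0] else [:: 0; 0; 0; 1])
    | 2 => if insub (val i) is Some r then delta_mx 0 (rshift 4 (lshift e r)) else
        embed (if i == kap :> nat then [:: 1; 0; 1; 0] else [:: 0; 1; 0; 1])
    | _ => if insub (val i) is Some r then delta_mx 0 (rshift 4 (lshift e r)) else
        embed (if i == kap :> nat then [:: 1; 0; 0; 1] else [:: 0; 1; 1; 0])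
    end
  | inr s => delta_mx 0 (rshift 4 (rshift kap s))
  end.

Definition sample j : 'M[K]_m :=
  if [pick a | col a == j] is Some a then \matrix_(i, l) sample_row a i 0 l else 0.

Lemma sampleE a i : row i (sample (col a)) = sample_row a i.
Proof.
rewrite /sample; case: pickP => [b /eqP/col_inj ->|/(_ a)]; last by rewrite eqxx.
by apply/rowP => l; rewrite !mxE.
Qed.

Lemma sample_positions : forall i : 'I_11, nth (fun=> 0) position_functions i sample != 0.
Proof.
have ltk : (kap < kap)%N = false by rewrite ltnn.
have ltk1 : (kap.+1 < kap)%N = false by rewrite ltnNge leqW.
have nek : (kap.+1 == kap) = false by rewrite gtn_eqF.
have r00 : row (ix 0) (sample (jj 0)) = embed [:: 1; 0; 0; 0].
  by rewrite sampleE /sample_row (unsplitK (inl _)) /= ix0.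
have r01 : row (ix 1) (sample (jj 0)) = embed [:: 0; 1; 0; 0].
  by rewrite sampleE /sample_row (unsplitK (inl _)) /= ix1.
have r10 : row (ix 0) (sample (jj 1)) = embed [:: 0; 0; 1; 0].
  by rewrite sampleE /sample_row (unsplitK (inl _)) /= ix0.
have r11 : row (ix 1) (sample (jj 1)) = embed [:: 0; 0; 0; 1].
  by rewrite sampleE /sample_row (unsplitK (inl _)) /= ix1.
have r20 : row (ix kap) (sample (jj 2)) = embed [:: 1; 0; 1; 0].
  by rewrite sampleE /sample_row (unsplitK (inl _)) /= insubF ix_kap ?eqxx.
have r21 : row (ix kap.+1) (sample (jj 2)) = embed [:: 0; 1; 0; 1].
  by rewrite sampleE /sample_row (unsplitK (inl _)) /= insubF ix_kap1 ?nek.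
have r30 : row (ix kap) (sample (jj 3)) = embed [:: 1; 0; 0; 1].
  by rewrite sampleE /sample_row (unsplitK (inl _)) /= insubF ix_kap ?eqxx.
have r31 : row (ix kap.+1) (sample (jj 3)) = embed [:: 0; 1; 1; 0].
  by rewrite sampleE /sample_row (unsplitK (inl _)) /= insubF ix_kap1 ?nek.
have Om2 r : OmK sample c (jj 2) r = delta_mx 0 (rshift 4 r).
  rewrite /OmK; case: (split_ordP r) => a ->; rewrite sampleE /sample_row.
    rewrite (unsplitK (inl _)) /=; case: insubP => [b _ bE|/negP[]]; last exact: ltn_ord.
    by congr (delta_mx _ (rshift _ (lshift _ _))); apply: val_inj.
  by rewrite (unsplitK (inr _)).
have Om3 r : OmK sample c (jj 3) r = delta_mx 0 (rshift 4 r).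
  rewrite /OmK; case: (split_ordP r) => a ->; rewrite sampleE /sample_row.
    rewrite (unsplitK (inl _)) /=; case: insubP => [b _ bE|/negP[]]; last exact: ltn_ord.
    by congr (delta_mx _ (rshift _ (lshift _ _))); apply: val_inj.
  by rewrite (unsplitK (inr _)).
have B2 := fun s0 s1 s2 s3 => @bracket_embed _ s0 s1 s2 s3 Om2.
have B3 := fun s0 s1 s2 s3 => @bracket_embed _ s0 s1 s2 s3 Om3.
have i0 : (0%N : int)%:~R = 0 :> K by [].
have i1 : (1%N : int)%:~R = 1 :> K by [].
have iN1 : (Negz 0)%:~R = -1 :> K by [].
have N1 : -1 != 0 :> K by rewrite oppr_eq0 oner_neq0.
have rE := (r00, r01, r10, r11, r20, r21, r30, r31).
case=> [[|[|[|[|[|[|[|[|[|[|[|i]]]]]]]]]]] lt_i]; rewrite [nth _ _ _]/=.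
all: rewrite /elim1 /elim3 /qres /q2 /q1 /q0 /dbr /lbr /kbr ?rE ?B2 ?B3.
all: try by exfalso; move: lt_i.
all: repeat match goal with |- context [laplace_det 4 ?f] =>
  let z := eval vm_compute in (laplace_det 4 f) in change (laplace_det 4 f) with z end.
all: rewrite ?i0 ?i1 ?iN1 ?(mulr0, mul0r, mulr1, mul1r, mulNr, opprK, oppr0, subr0, sub0r, addr0, add0r).
all: by rewrite ?oppr_eq0 oner_neq0.
Qed.

Lemma generic_positions : generic (fun g => forall i : 'I_11, nth (fun=> 0) position_functions i g != 0).
Proof.
apply: generic_all => i; apply: (generic_neq0 (position_functions_polyfun i)); exists sample.
exact: sample_positions.
Qed.

End Lines.
End GenericConditions.

(** * Points where the minors vanish modulo a quadratic polynomial *)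

Lemma bracketZ0 (R : comNzRingType) k (Om : 'I_k -> 'rV[R]_(4 + k)) a x x1 x2 x3 :
  BR Om (a *: x) x1 x2 x3 = a * BR Om x x1 x2 x3.
Proof.
have B0 : BR Om 0 x1 x2 x3 = 0.
  by have := bracketD0 Om (-1) 0 0 x1 x2 x3; rewrite scaler0 addr0 mulN1r addNr.
by rewrite -[a *: x]addr0 bracketD0 B0 addr0.
Qed.

(** The Bezout identity is a^2 q - (a q2 X + a q1 - q2 b)(a X + b) = resultant. It involves no
    division by [a], which may be zero. *)
Lemma quadratic_coprime_linear (K : fieldType) (q2 q1 q0 a b : K) :
    q2 * b * b - q1 * a * b + q0 * a * a != 0 ->
  coprimep (q2%:P * 'X ^+ 2 + q1%:P * 'X + q0%:P) (a%:P * 'X + b%:P).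
Proof.
move=> res; set r := (X in X != 0) in res; apply/Bezout_eq1_coprimepP.
exists (r^-1 *: (a ^+ 2)%:P, - (r^-1 *: (a%:P * q2%:P * 'X + (a%:P * q1%:P - q2%:P * b%:P)))).
rewrite /= mulNr -!scalerAl -scalerBr; apply: (canLR (scalerK res)).
rewrite -mul_polyC mulr1 /r !(rmorphD, rmorphM, rmorphN, rmorphXn) /=.
by ring.
Qed.

Lemma linear_eq0 (K : fieldType) (a b : K) (q : {poly K}) : (2 < size q)%N ->
  q %| a%:P * 'X + b%:P -> a = 0 /\ b = 0.
Proof.
move=> q3 /dvdp_leq qab; have ab0 : a%:P * 'X + b%:P = 0.
  apply/eqP; apply: contraTT q3 => ab0; rewrite -leqNgt (leq_trans (qab ab0)) //.
  by rewrite size_MXaddC; case: ifP => // _; rewrite ltnS size_polyC leq_b1.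
split; [have := congr1 (fun p : {poly K} => p`_1) ab0|have := congr1 (fun p : {poly K} => p`_0) ab0].
  by rewrite coefD coefMX !coefC /= addr0.
by rewrite coefD coefMX !coefC /= add0r.
Qed.

Lemma dvdp_det (K : fieldType) k (M : 'M[{poly K}]_k) i q : (forall l, q %| M i l) -> q %| \det M.
Proof.
move=> H; rewrite (expand_det_row _ i); apply: (big_ind (fun p => q %| p)) => [|x y|l _]; first exact: dvdp0.
  exact: dvdp_add.
exact: dvdp_mulr.
Qed.

(** This is Cramer's rule. *)
Lemma mul_row_adj (R : comNzRingType) k (A : 'M[R]_k) (x : 'rV_k) i :
  (x *m \adj A) 0 i = \det (\matrix_(r, l) if r == i then x 0 l else A r l).
Proof.
rewrite (expand_det_row _ i) mxE; apply: eq_bigr => l _; rewrite !mxE eqxx; congr (_ * (_ * \det _)).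
by apply/matrixP => r l'; rewrite !mxE eq_sym (negPf (neq_lift _ _)).
Qed.

Lemma bracket_replace (R : comNzRingType) k (Om : 'I_k -> 'rV[R]_(4 + k)) p q (x : 'rV_(4 + k)) i :
    (forall i', i' != i -> q i' = p i') -> q i = x ->
  \det (\matrix_(r, l) if r == lshift k i then x 0 l else
    (\matrix_(r', l') (if split r' is inr r'' then Om r'' else p (if split r' is inl i then i else ord0)) 0 l') r l)
  = bracket Om q.
Proof.
move=> qp qi; apply: (congr1 determinant); apply/matrixP => r l; rewrite !mxE.
case: (split_ordP r) => a ->; last by rewrite eq_rlshift.
by rewrite (inj_eq (@lshift_inj _ _)); case: eqVneq => [->|/qp->]; rewrite ?qi.
Qed.

Lemma span_identity (R : comNzRingType) (d200 d201 d210 d211 d300 d301 d310 d311 x : R) :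
  (d210 * x + d211) * (x * d300 + d301) + - (d200 * x + d201) * (x * d310 + d311) =
  (d210 * d300 - d200 * d310) * x ^+ 2 + (d210 * d301 + d211 * d300 - d200 * d311 - d201 * d310) * x
    + (d211 * d301 - d201 * d311).
Proof. by ring. Qed.

Lemma span_identity0 (R : comNzRingType) (d200 d201 d210 d211 x : R) :
  (d210 * x + d211) * (x * d200 + d201) + - (d200 * x + d201) * (x * d210 + d211) = 0.
Proof. by ring. Qed.

Lemma sum3 (V : nmodType) (F : 'I_3 -> V) : \sum_i F i = F 0 + F 1 + F 2.
Proof.
rewrite !big_ord_recl big_ord0 addr0 !addrA.
by congr (_ + F _ + F _); apply: val_inj.
Qed.

Lemma sum4 (V : nmodType) (F : 'I_4 -> V) : \sum_i F i = F 0 + F 1 + F 2 + F 3.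
Proof.
rewrite !big_ord_recl big_ord0 addr0 !addrA.
by congr (_ + F _ + F _ + F _); apply: val_inj.
Qed.

Lemma ord4_cases (i : 'I_4) : [\/ i = 0, i = 1, i = 2 | i = 3].
Proof.
by case: i => [[|[|[|[|]]]] lt_i] //; [constructor 1|constructor 2|constructor 3|constructor 4]; apply: val_inj.
Qed.

Section Point.
Variables (K : fieldType) (kap e n : nat).
Local Notation k := (kap + e)%N.
Local Notation m := (4 + k)%N.
Local Notation PK := {poly K}.
Local Notation ix i := (inord i : 'I_m).
Variables (col : 'I_(4 + e) -> 'I_n) (g : 'I_n -> 'M[K]_m).
Hypothesis col_inj : injective col.
Local Notation jj i := (col (lshift e i)).
Local Notation c := (fun s : 'I_e => col (rshift 4 s)).

Definition prow i j : 'rV[PK]_m := map_mx polyC (row i (g j)).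

Definition OmP ji (r : 'I_k) : 'rV[PK]_m := map_mx polyC (OmK g c (jj ji) r).

(** On the first line, this is the point where the bilinear form of column 2 vanishes against the
    point of parameter ['X] on the second line. So [span_mx 2] is singular identically, and column 3
    leaves the condition [quad]. *)
Definition pt_x : PK := (dbr col 2 g 1 0)%:P * 'X + (dbr col 2 g 1 1)%:P.
Definition pt_y : PK := - ((dbr col 2 g 0 0)%:P * 'X + (dbr col 2 g 0 1)%:P).

Definition line0 : 'rV[PK]_m := pt_x *: prow (ix 0) (jj 0) + pt_y *: prow (ix 1) (jj 0).
Definition line1 : 'rV[PK]_m := 'X *: prow (ix 0) (jj 1) + prow (ix 1) (jj 1).

Definition span_mx ji : 'M[PK]_m := \matrix_(r, l)
  (if split r is inr r' then OmP ji r' else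
    four line0 line1 (prow (ix kap) (jj ji)) (prow (ix kap.+1) (jj ji))
      (if split r is inl i then i else ord0)) 0 l.

Definition quad : PK := (q2 col g)%:P * 'X ^+ 2 + (q1 col g)%:P * 'X + (q0 col g)%:P.

Lemma bracketP ji i0 j0 i1 j1 i2 j2 i3 j3 :
  BR (OmP ji) (prow i0 j0) (prow i1 j1) (prow i2 j2) (prow i3 j3) =
  (BR (OmK g c (jj ji)) (row i0 (g j0)) (row i1 (g j1)) (row i2 (g j2)) (row i3 (g j3)))%:P.
Proof. by rewrite bracket_map; apply: eq_bracket; case=> [[|[|[|[|]]]]]. Qed.

Lemma bracket_line1 ji i0 j0 i2 j2 i3 j3 :
  BR (OmP ji) (prow i0 j0) line1 (prow i2 j2) (prow i3 j3) =
  'X * (BR (OmK g c (jj ji)) (row i0 (g j0)) (row (ix 0) (g (jj 1))) (row i2 (g j2)) (row i3 (g j3)))%:P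
  + (BR (OmK g c (jj ji)) (row i0 (g j0)) (row (ix 1) (g (jj 1))) (row i2 (g j2)) (row i3 (g j3)))%:P.
Proof. by rewrite bracketD1 !bracketP. Qed.

Lemma bracket_line01 ji i2 j2 i3 j3 :
  BR (OmP ji) line0 line1 (prow i2 j2) (prow i3 j3) =
  pt_x * BR (OmP ji) (prow (ix 0) (jj 0)) line1 (prow i2 j2) (prow i3 j3)
  + pt_y * BR (OmP ji) (prow (ix 1) (jj 0)) line1 (prow i2 j2) (prow i3 j3).
Proof. by rewrite bracketD0 bracketZ0. Qed.

Lemma det_span_mx ji : \det (span_mx ji) =
  pt_x * ('X * (dbr col ji g 0 0)%:P + (dbr col ji g 0 1)%:P)
  + pt_y * ('X * (dbr col ji g 1 0)%:P + (dbr col ji g 1 1)%:P).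
Proof. by rewrite -!bracket_line1 -bracket_line01. Qed.

Lemma det_span_mx2 : \det (span_mx 2) = 0.
Proof. by rewrite det_span_mx; apply: span_identity0. Qed.

Lemma det_span_mx3 : \det (span_mx 3) = quad.
Proof.
by rewrite det_span_mx span_identity /quad /q2 /q1 /q0 !(polyCD, polyCM, polyCN).
Qed.

(** Multiplying one fixed row by the adjugate gives the coefficients of a relation among the rows of
    [span_mx ji], with error [\det (span_mx ji)] times that fixed row. *)
Definition cof ji : 'rV[PK]_m := prow (ix 0) (jj 0) *m \adj (span_mx ji).

Lemma cof3 ji : cof ji 0 (lshift k 3) = pt_y * ((lbr col ji g 0)%:P * 'X + (lbr col ji g 1)%:P).
Proof.
rewrite mul_row_adj (@bracket_replace _ _ _ _
  (four line0 line1 (prow (ix kap) (jj ji)) (prow (ix 0) (jj 0)))) //; last first.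
  by case=> [[|[|[|[|]]]]].
by rewrite bracket_line01 (@bracket_alt _ _ _ _ 0 3) // mulr0 add0r bracket_line1 [_ * 'X]mulrC.
Qed.

Lemma cof2 ji : cof ji 0 (lshift k 2) = pt_y * ((kbr col ji g 0)%:P * 'X + (kbr col ji g 1)%:P).
Proof.
rewrite mul_row_adj (@bracket_replace _ _ _ _
  (four line0 line1 (prow (ix 0) (jj 0)) (prow (ix kap.+1) (jj ji)))) //; last first.
  by case=> [[|[|[|[|]]]]].
by rewrite bracket_line01 (@bracket_alt _ _ _ _ 0 2) // mulr0 add0r bracket_line1 [_ * 'X]mulrC.
Qed.

(** The part of that relation carried by rows 0 to kap + 1 of column [ji], read as a point of the
    linear space they span. *)
Definition trans ji : seq (PK * 'I_m) :=
  [:: (cof ji 0 (lshift k 2), ix kap), (cof ji 0 (lshift k 3), ix kap.+1) &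
    [seq (cof ji 0 (rshift 4 (lshift e i)), low_row e i) | i <- enum 'I_kap]].

(* The point at which forms are evaluated: column [col a] is the sum of the [p.1 * row p.2]. *)
Definition pts (a : 'I_(4 + e)) : seq (PK * 'I_m) :=
  match split a with
  | inl i => four [:: (pt_x, ix 0); (pt_y, ix 1)] [:: ('X, ix 0); (1, ix 1)] (trans 2) (trans 3) i
  | inr _ => [:: (1, ix 0)]
  end.

Definition pt_coord a (l : 'I_m) : PK := \sum_(p <- pts a) p.1 *+ (p.2 == l).

Definition pt : 'M[PK]_(m, n) :=
  \matrix_(i, j) if [pick a | col a == j] is Some a then pt_coord a i else 0.

Definition vec a : 'rV[PK]_m := \sum_(p <- pts a) p.1 *: prow p.2 (col a).

Lemma ptE i a : pt i (col a) = pt_coord a i.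
Proof.
rewrite mxE; case: pickP => [b /eqP/col_inj->//|/(_ a)]; by rewrite eqxx.
Qed.

Lemma spread_pt a : spread polyC g (fun i j => mxvec pt 0 (mxvec_index i j)) (col a) = vec a.
Proof.
rewrite /spread; under eq_bigr => l _ do rewrite mxvecE ptE scaler_suml.
rewrite exchange_big; apply: eq_bigr => p _; rewrite (bigD1 p.2) //= eqxx mulr1n big1 ?addr0 // => l lp.
by rewrite eq_sym (negPf lp) mulr0n scale0r.
Qed.

(** One vector more than the dimension wanted: the third, row 0 of the first column, takes up the
    errors that are divisible by [quad]. *)
Definition basis (s : 'I_(3 + e)) : 'rV[PK]_m :=
  match split s with
  | inl i => match val i with 0 => line0 | 1 => line1 | _ => prow (ix 0) (jj 0) end
  | inr s => prow (ix 0) (c s)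
  end.

Lemma basis_sum (b : 'I_(3 + e) -> PK) : \sum_s b s *: basis s =
  b (lshift e 0) *: line0 + b (lshift e 1) *: line1 + b (lshift e 2) *: prow (ix 0) (jj 0)
  + \sum_s b (rshift 3 s) *: prow (ix 0) (c s).
Proof.
rewrite big_split_ord sum3 /basis !(unsplitK (inl _)) /=.
by congr (_ + _); apply: eq_bigr => s _; rewrite (unsplitK (inr _)).
Qed.

Lemma span_relation ji : \det (span_mx ji) *: prow (ix 0) (jj 0) =
  cof ji 0 (lshift k 0) *: line0 + cof ji 0 (lshift k 1) *: line1
  + \sum_(p <- trans ji) p.1 *: prow p.2 (jj ji)
  + \sum_s cof ji 0 (rshift 4 (rshift kap s)) *: prow (ix 0) (c s).
Proof.
rewrite -mul_mx_scalar -mul_adj_mx mulmxA -/(cof ji) mulmx_sum_row.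
have rowE r : row r (span_mx ji) = if split r is inr r' then OmP ji r' else
    four line0 line1 (prow (ix kap) (jj ji)) (prow (ix kap.+1) (jj ji))
      (if split r is inl i then i else ord0).
  by apply/rowP => l; rewrite !mxE.
rewrite big_split_ord sum4 !rowE !(unsplitK (inl _)) big_split_ord /=.
rewrite !big_cons big_map big_enum /= -!addrA.
do 4!congr (_ + _).
congr (_ + _).
  apply: eq_big => // i _; rewrite rowE (unsplitK (inr _)) /OmP /OmK (unsplitK (inl _)).
  exact: erefl.
apply: eq_bigr => i _; rewrite rowE (unsplitK (inr _)) /OmP /OmK (unsplitK (inr _)).
exact: erefl.
Qed.

(** In columns 2 and 3 the relation is solved for the point, and the third basis vector gets
    coefficient [\det (span_mx ji)], that is 0 or [quad]. The other columns are basis vectors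
    themselves. *)
Lemma vec_basis a : exists2 b : 'I_(3 + e) -> PK,
  vec a = \sum_s b s *: basis s & quad %| b (lshift e 2).
Proof.
have trans_case ji : quad %| \det (span_mx ji) -> a = lshift e ji -> pts a = trans ji ->
    exists2 b : 'I_(3 + e) -> PK, vec a = \sum_s b s *: basis s & quad %| b (lshift e 2).
  move=> qd aE pE; exists (fun s => match split s with
    | inl i => match val i with 0 => - cof ji 0 (lshift k 0) | 1 => - cof ji 0 (lshift k 1)
      | _ => \det (span_mx ji) end
    | inr s => - cof ji 0 (rshift 4 (rshift kap s)) end); last by rewrite (unsplitK (inl _)).
  rewrite basis_sum !(unsplitK (inl _)) /= span_relation /vec pE aE.
  under [X in _ = _ + X]eq_bigr => s _ do rewrite (unsplitK (inr _)) scaleNr.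
  rewrite sumrN !scaleNr; set A := _ *: line0; set B := _ *: line1; set C := \sum_(p <- _) _.
  by set D := \sum_s _; rewrite -opprD -(addrA (A + B)) addKr addrK.
have small (b : 'I_(3 + e) -> PK) : vec a = \sum_s b s *: basis s -> b (lshift e 2) = 0 ->
    exists2 b : 'I_(3 + e) -> PK, vec a = \sum_s b s *: basis s & quad %| b (lshift e 2).
  by move=> vE b0; exists b; rewrite // b0 dvdp0.
have delta s : vec a = basis s -> s != lshift e 2 ->
    exists2 b : 'I_(3 + e) -> PK, vec a = \sum_s b s *: basis s & quad %| b (lshift e 2).
  move=> vE s2; apply: (small (fun s' => (s' == s)%:R)); last by rewrite eq_sym (negPf s2).
  by rewrite (bigD1 s) //= eqxx scale1r big1 ?addr0 // => s' /negPf->; rewrite scale0r.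
case: (split_ordP a) => i aE; last first.
  apply: (delta (rshift 3 i)); last by rewrite eq_rlshift.
  by rewrite /vec /pts /basis aE !(unsplitK (inr _)) big_seq1 scale1r.
case: (ord4_cases i) aE => -> aE.
- apply: (delta (lshift e 0)); last by rewrite (inj_eq (@lshift_inj _ _)).
  by rewrite /vec /pts /basis aE !(unsplitK (inl _)) /= !big_cons big_nil addr0.
- apply: (delta (lshift e 1)); last by rewrite (inj_eq (@lshift_inj _ _)).
  by rewrite /vec /pts /basis aE !(unsplitK (inl _)) /= !big_cons big_nil addr0 scale1r.
- apply: (trans_case 2); [by rewrite det_span_mx2 dvdp0|by []|].
  by rewrite /pts aE (unsplitK (inl _)).
- apply: (trans_case 3); [by rewrite det_span_mx3 dvdpp|by []|].
  by rewrite /pts aE (unsplitK (inl _)).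
Qed.

Lemma spread_basis j : exists2 b : 'I_(3 + e) -> PK,
  spread polyC g (fun i j => mxvec pt 0 (mxvec_index i j)) j = \sum_s b s *: basis s & quad %| b (lshift e 2).
Proof.
have [/codomP[a ->]|jc] := boolP (j \in codom col); first by rewrite spread_pt; apply: vec_basis.
exists (fun=> 0); last exact: dvdp0.
rewrite [RHS]big1 => [|s _]; last by rewrite scale0r.
rewrite /spread big1 // => l _; rewrite mxvecE mxE; case: pickP => [a /eqP ja|_]; last by rewrite scale0r.
by rewrite -ja codom_f in jc.
Qed.

(** The matrix of a t-minor factors through [basis], and one row of the right factor is divisible by
    [quad]. *)
Lemma quad_dvd_eval p : G_image g (determinantal_ideal (3 + e)) p -> quad %| mmap polyC (mxvec pt 0) p.
Proof.
apply: (@G_image_mmap K m n (3 + e) g PK polyC (mxvec pt 0) (fun q => quad %| q)) => [|r c' _ _].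
  by split=> [|a b|a b]; [exact: dvdp0|exact: dvdp_add|exact: dvdp_mull].
have [B BE B2] := fin_all_exists2 spread_basis.
rewrite (_ : \matrix_(a, b) _ = (\matrix_(a, s) basis s 0 (r a)) *m \matrix_(s, b) B (c' b) s).
  by rewrite det_mulmx; apply/dvdp_mull/(@dvdp_det _ _ _ (lshift e 2)) => l; rewrite mxE.
apply/matrixP => a b; rewrite [LHS]mxE BE summxE [RHS]mxE; apply: eq_bigr => s _.
by rewrite !mxE mulrC.
Qed.

End Point.

(** * Four monomials that cannot all be leading *)

Section Conflict.
Variables (K : fieldType) (kap e n : nat).
Local Notation k := (kap + e)%N.
Local Notation m := (4 + k)%N.
Local Notation PK := {poly K}.
Local Notation S := {mpoly K[m * n]}.
Local Notation ix i := (inord i : 'I_m).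
Local Notation U_ i j := (mnm1 (mxvec_index i j)).
Variables (col : 'I_(4 + e) -> 'I_n).
Hypothesis col_inj : injective col.
Local Notation jj i := (col (lshift e i)).
Local Notation c := (fun s : 'I_e => col (rshift 4 s)).

Definition rmon (r : 'I_(4 + e) -> 'I_m) : 'X_{1..m * n} := (\big[+%MM/0%MM]_a U_ (r a) (col a))%MM.

Lemma rmonE r : rmon r = (U_ (r (lshift e 0%R)) (jj 0%R) + U_ (r (lshift e 1%R)) (jj 1%R)
  + U_ (r (lshift e 2%R)) (jj 2%R) + U_ (r (lshift e 3%R)) (jj 3%R)
  + \big[+%MM/0%MM]_s U_ (r (rshift 4 s)) (c s))%MM.
Proof.
rewrite /rmon big_split_ord /= !big_ord_recl big_ord0 addm0 !addmA.
rewrite (_ : lift ord0 ord0 = 1 :> 'I_4); last exact: val_inj.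
rewrite (_ : lift ord0 (lift ord0 ord0) = 2 :> 'I_4); last exact: val_inj.
by rewrite (_ : lift ord0 (lift ord0 (lift ord0 ord0)) = 3 :> 'I_4); last exact: val_inj.
Qed.

Definition low (i : 'I_4) : 'I_m := four (ix 0) (ix 0) (ix kap) (ix kap) i.

Definition high (a : 'I_(4 + e)) : 'I_m :=
  match split a with
  | inl i => four (ix 1) (ix 1) (ix kap.+1) (ix kap.+1) i
  | inr _ => ix 0
  end.

(** [rmon (role i)] is the monomial X_i and [rmon high] is Y. *)
Definition role i a : 'I_m := if a == lshift e i then low i else high a.

Lemma role_lshift i i' : role i (lshift e i') =
  if i' == i then low i else four (ix 1) (ix 1) (ix kap.+1) (ix kap.+1) i'.
Proof. by rewrite /role (inj_eq (@lshift_inj _ _)) /high (unsplitK (inl _)). Qed.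

Lemma role_rshift i s : role i (rshift 4 s) = ix 0.
Proof. by rewrite /role eq_rlshift /high (unsplitK (inr _)). Qed.

Lemma low_high i : (low i < high (lshift e i))%N.
Proof.
rewrite /low /high (unsplitK (inl _)).
by case: (ord4_cases i) => ->; rewrite /four /= ?ix0 ?ix1 ?ix_kap ?ix_kap1.
Qed.

Lemma rmon_role_neq i : rmon (role i) != rmon high.
Proof.
apply/eqP => E; have : rmon high (mxvec_index (high (lshift e i)) (jj i)) != 0%N by apply: multilinear_mon_at.
rewrite -E => /(multilinear_mon_inj col_inj); rewrite /role eqxx => lh.
by have := low_high i; rewrite lh ltnn.
Qed.

Section Order.
Variable le : rel 'X_{1..m * n}.
Hypothesis leP : is_term_order le.
Hypothesis le_dec : column_decreasing le.

Lemma rmon_le (r r' : 'I_(4 + e) -> 'I_m) : (forall a, r' a <= r a)%N -> le (rmon r) (rmon r').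
Proof.
move=> H; apply: (term_order_sum leP) => a _; have := H a; rewrite leq_eqVlt => /orP[/eqP/val_inj->|].
  by case: leP => -[].
exact: le_dec.
Qed.

Variables (g : 'I_n -> 'M[K]_m) (J : S -> Prop).
Hypothesis gU : in_G g.
Hypothesis gP : forall i : 'I_11, nth (fun=> 0) (position_functions K kap col) i g != 0.
Local Notation gI := (G_image g (determinantal_ideal (3 + e))).
Hypothesis JR : is_radical J.
Hypothesis JE : forall p, initial_ideal le gI p <-> J p.

Lemma lead_radical p u w N v : gI p -> is_leading_mon le p w -> (u *+ N = v + w)%MM -> J 'X_[u].
Proof.
move=> pI pw uE; apply: (JR (k := N)); apply/JE; rewrite mpolyXn uE mpolyXD.
exists [:: ('X_[v], 'X_[w])]; last by rewrite big_seq1.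
by move=> _ /[1!inE] /eqP->; exists p, w.
Qed.

(** The leading monomial from [elim1_leading] divides the square of X_i for the two lines; that from
    [elim3_leading] divides its cube for the two linear spaces. The cofactors [v] are the missing
    variables. *)
Lemma role_radical i : J 'X_[rmon (role i)].
Proof.
have sum_c : (\big[+%MM/0%MM]_s U_ (role i (rshift 4 s)) (c s) = cmon kap c)%MM.
  by apply: eq_bigr => s _; rewrite role_rshift.
have := rmonE (role i); rewrite sum_c !role_lshift; case: (ord4_cases i) => -> /= E.
- have [p pI pl] := elim1_leading leP le_dec gU (gP 0).
  apply: (lead_radical (N := 2) (v := (U_ (ix 1) (jj 1%R) + U_ (ix kap.+1) (jj 2%R) + U_ (ix kap.+1) (jj 3%R))%MM) pI pl).
  rewrite E; apply/mnmP => z; rewrite mulmnE !mnmDE; ring.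
- have [p pI pl] := elim1_leading leP le_dec gU (gP 1).
  apply: (lead_radical (N := 2) (v := (U_ (ix 1) (jj 0%R) + U_ (ix kap.+1) (jj 2%R) + U_ (ix kap.+1) (jj 3%R))%MM) pI pl).
  rewrite E; apply/mnmP => z; rewrite mulmnE !mnmDE; ring.
- have [p pI pl] := elim3_leading leP le_dec gU (gP 2).
  apply: (lead_radical (N := 3) (v := (U_ (ix 1) (jj 0%R) + U_ (ix 1) (jj 1%R) + U_ (ix kap) (jj 2%R) + U_ (ix kap.+1) (jj 3%R) + U_ (ix kap.+1) (jj 3%R))%MM) pI pl).
  rewrite E; apply/mnmP => z; rewrite mulmnE !mnmDE; ring.
- have [p pI pl] := elim3_leading leP le_dec gU (gP 3).
  apply: (lead_radical (N := 3) (v := (U_ (ix 1) (jj 0%R) + U_ (ix 1) (jj 1%R) + U_ (ix kap) (jj 3%R) + U_ (ix kap.+1) (jj 2%R) + U_ (ix kap.+1) (jj 2%R))%MM) pI pl).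
  rewrite E; apply/mnmP => z; rewrite mulmnE !mnmDE; ring.
Qed.

Lemma rmon_degree r : multideg (rmon r) = \sum_a delta_mx 0 (col a).
Proof.
rewrite /rmon (big_morph _ (@multidegD m n) (@multideg0 m n)).
by apply: eq_bigr => a _; rewrite multidegU.
Qed.

(** Take X_i minimal for [le]. All monomials of an element led by X_i are at most X_i, so one that
    is at least some X_i' equals X_i. The multigraded component of that degree is multilinear in the
    chosen columns. *)
Lemma minimal_role : exists i F, [/\ gI F, F@_(rmon (role i)) != 0 &
  forall u, u \in msupp F -> exists2 r, u = rmon r &
    forall i', le (rmon (role i')) u -> u = rmon (role i)].
Proof.
have [[le_refl le_anti le_trans le_total] _] := leP.
have [i _ imin] := extremumP (fun i => rmon (role i)) le_refl le_trans le_total (erefl : xpredT (0 : 'I_4)).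
have /JE/initial_ideal_lead[//||F FI [Fi Fl]] := role_radical i.
  exact: G_image_ideal gU (ideal_gen_ideal (@is_minor K m n _)).
exists i, (hom_component (multideg (rmon (role i))) F); split.
- exact/G_image_hom/FI/determinantal_graded.
- by rewrite mcoeff_hom eqxx -mcoeff_msupp.
move=> u; rewrite mcoeff_msupp mcoeff_hom; case: (multideg u =P _); last by rewrite eqxx.
rewrite rmon_degree => /(multilinear_mon col_inj)[r rE]; rewrite -mcoeff_msupp => /Fl ule.
exists r => // i' i'le; apply: le_anti; rewrite ule /=.
exact/(le_trans _ _ _ (imin i' isT)).
Qed.

Local Notation ev := (mmap polyC (mxvec (pt col g) 0)).

Lemma ev_rmon r : ev 'X_[rmon r] = \prod_a pt_coord col g a (r a).
Proof.
rewrite /rmon (big_morph (fun u => ev 'X_[u]) (op1 := *%R) (id1 := 1)) => [|u v|].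
- by apply: eq_bigr => a _; rewrite mmapX mmap1U mxvecE ptE.
- by rewrite mpolyXD rmorphM.
- by rewrite mpolyX0 rmorph1.
Qed.

(** The points use only rows 0 and 1 on a line, 0 to kap + 1 in a linear space, and 0 elsewhere: the
    row of Y, or in the first four columns one at most [low]. *)
Lemma coord_neq0 a l : pt_coord col g a l != 0 ->
  l = high a \/ exists2 i, a = lshift e i & (l <= low i)%N.
Proof.
move=> nz; have : l \in map snd (pts col g a).
  apply: contraNT nz => nl; rewrite /pt_coord big1_seq // => p /andP[_ pp].
  by case: eqP => // pl; rewrite -pl map_f in nl.
have trans_case ji : l \in map snd (trans col g ji) -> l = ix kap.+1 \/ (l <= ix kap)%N.
  rewrite !inE => /or3P[/eqP->|/eqP->|]; [by right|by left|].
  by move=> /mapP[_ /mapP[i _ ->] ->]; right; rewrite ix_kap; exact: (ltnW (ltn_ord i)).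
rewrite /pts /high; case: (split_ordP a) => i ->; last by rewrite inE => /eqP; left.
rewrite /low; case: (ord4_cases i) => ->; rewrite /four /=.
- by rewrite !inE => /orP[] /eqP->; [right; exists 0|left].
- by rewrite !inE => /orP[] /eqP->; [right; exists 1|left].
- by case/trans_case; [left|right; exists 2].
- by case/trans_case; [left|right; exists 3].
Qed.

(** A monomial of [F] that survives at the point and has the row of Y in every column is Y.
    Otherwise some column has a row at most [low], the monomial is at least some X_i' because no row
    exceeds that of Y, and by minimality it is X_i. *)
Lemma minimal_eval : exists i alpha beta, alpha != 0 /\
  quad col g %| alpha%:P * \prod_a pt_coord col g a (role i a) + beta%:P * \prod_a pt_coord col g a (high a).
Proof.
have [i [F [FI Fi FP]]] := minimal_role.
have vanish u : u \in msupp F -> u != rmon (role i) -> u != rmon high -> ev 'X_[u] = 0.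
  move=> /FP[r -> rP] ni nh; apply/eqP; rewrite ev_rmon; apply: contraNT ni => nz.
  have rc a : pt_coord col g a (r a) != 0.
    by apply: contraNneq nz => r0; rewrite (bigD1 a) //= r0 mul0r.
  have [i' i'low|all_high] := pickP (fun i' => r (lshift e i') <= low i')%N; last first.
    case/eqP: nh; apply: eq_bigr => a _; suff -> : r a = high a by [].
    by case: (coord_neq0 (rc a)) => // -[i' ->]; rewrite all_high.
  apply/eqP/(rP i')/rmon_le => // a; rewrite /role; case: eqP => [->//|_].
  by case: (coord_neq0 (rc a)) => [->//|[i'' -> /leq_trans]]; apply; apply/ltnW/low_high.
exists i, F@_(rmon (role i)), F@_(rmon high); split=> //.
rewrite -!ev_rmon; set u1 := rmon (role i); set u2 := rmon high.
have u12 : u1 != u2 by apply: rmon_role_neq.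
pose p := F - F@_u1 *: 'X_[u1] - F@_u2 *: 'X_[u2].
have pE u : p@_u = if (u == u1) || (u == u2) then 0 else F@_u.
  rewrite !mcoeffB !mcoeffZ !mcoeffX ![_ == u]eq_sym.
  case: eqVneq => [->|_]; first by rewrite (negPf u12) mulr1 mulr0 subrr subr0.
  by case: eqVneq => [->|_]; rewrite ?mulr1 ?mulr0 ?subr0 ?subrr.
have p0 : ev p = 0.
  rewrite [p]mpolyE raddf_sum big1_seq // => u /andP[_]; rewrite mcoeff_msupp pE.
  case: ifP; rewrite ?eqxx // => /norP[u1' u2'] Fu /=.
  by rewrite mmapZ vanish ?mulr0 ?mcoeff_msupp.
have -> : (F@_u1)%:P * ev 'X_[u1] + (F@_u2)%:P * ev 'X_[u2] = ev F.
  apply/esym/eqP; rewrite -subr_eq0 -p0 /p !raddfB /= !mmapZ opprD addrA; exact/eqP.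
exact: quad_dvd_eval.
Qed.

Lemma sum_trans ji : \sum_(p <- trans col g ji) p.1 *+ (p.2 == ix kap) = cof col g ji 0 (lshift k 2)
  /\ \sum_(p <- trans col g ji) p.1 *+ (p.2 == ix kap.+1) = cof col g ji 0 (lshift k 3).
Proof.
have kk : (ix kap.+1 == ix kap) = false.
  by apply/negP => /eqP/(congr1 val); rewrite /= ix_kap ix_kap1 => /esym/n_Sn.
have lk (i : 'I_kap) : (low_row e i == ix kap) = false.
  by apply/negP => /eqP/(congr1 val); rewrite /= ix_kap => E; have := ltn_ord i; rewrite E ltnn.
have lk1 (i : 'I_kap) : (low_row e i == ix kap.+1) = false.
  apply/negP => /eqP/(congr1 val); rewrite /= ix_kap1 => E.
  by have := ltn_ord i; rewrite E ltnNge leqnSn.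
rewrite !big_cons !big_map !big1_seq => [|i _|i _]; last 2 first.
- by rewrite lk1.
- by rewrite lk.
by rewrite !eqxx kk eq_sym kk !addr0 add0r.
Qed.

Let h (i : 'I_4) := high (lshift e i).

Lemma coords :
  [/\ pt_coord col g (lshift e 0) (low 0) = pt_x col g, pt_coord col g (lshift e 0) (h 0) = pt_y col g,
    pt_coord col g (lshift e 1) (low 1) = 'X & pt_coord col g (lshift e 1) (h 1) = 1].
Proof.
have i10 : (ix 1 == ix 0) = false by apply/negP => /eqP/(congr1 val); rewrite /= ix0 ix1.
rewrite /h /high /pt_coord /pts !(unsplitK (inl _)) /low /four /= !big_cons !big_nil /=.
have i01 : (ix 0 == ix 1) = false by rewrite eq_sym.
by rewrite !eqxx i10 i01 !mulr0n !mulr1n !addr0 !add0r.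
Qed.

Lemma coords_trans (ji : 'I_4) : (1 < ji)%N ->
  pt_coord col g (lshift e ji) (low ji) =
    pt_y col g * ((kbr col ji g 0)%:P * 'X + (kbr col ji g 1)%:P) /\
  pt_coord col g (lshift e ji) (h ji) =
    pt_y col g * ((lbr col ji g 0)%:P * 'X + (lbr col ji g 1)%:P).
Proof.
rewrite -cof2 -cof3; have [<- <-] := sum_trans ji.
rewrite /h /high /pt_coord /pts !(unsplitK (inl _)) /low.
by case: (ord4_cases ji) => ->.
Qed.

Lemma coprime_pt_y : coprimep (quad col g) (pt_y col g).
Proof.
rewrite /pt_y -scaleN1r coprimepZr ?oppr_eq0 ?oner_neq0 //.
exact/quadratic_coprime_linear/(gP 6).
Qed.

(** This permits cancelling the coordinates of all columns but one modulo [quad]. *)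
Lemma coprime_high a : coprimep (quad col g) (pt_coord col g a (high a)).
Proof.
have [c00 c01 c10 c11] := coords.
case: (split_ordP a) => i ->; last first.
  by rewrite /high /pt_coord /pts !(unsplitK (inr _)) big_seq1 eqxx coprimep1.
rewrite -/(h i); case: (ord4_cases i) => ->.
- by rewrite c01 coprime_pt_y.
- by rewrite c11 coprimep1.
- rewrite (coords_trans _).2 // coprimepMr coprime_pt_y.
  exact/quadratic_coprime_linear/(gP 7).
- rewrite (coords_trans _).2 // coprimepMr coprime_pt_y.
  exact/quadratic_coprime_linear/(gP 8).
Qed.

Lemma singular_pencil (alpha beta a b a' b' : K) : a * b' - b * a' != 0 ->
  alpha * a + beta * a' = 0 -> alpha * b + beta * b' = 0 -> alpha = 0.
Proof.
move=> D A B; apply: (mulIf D); rewrite mul0r.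
rewrite (_ : alpha * _ = (alpha * a + beta * a') * b' - (alpha * b + beta * b') * a'); last by ring.
by rewrite A B !mul0r subrr.
Qed.

Lemma size_quad : (2 < size (quad col g))%N.
Proof.
rewrite ltnNge; apply/negP => /leq_sizeP/(_ 2 (leqnn _)).
rewrite /quad !coefD mulrC coefXnM !coefMX !coefC /= !addr0.
exact/eqP/(gP 5).
Qed.

Lemma conflict : False.
Proof.
have [i [alpha [beta [alpha0 qd]]]] := minimal_eval.
have {qd} : quad col g %| alpha%:P * pt_coord col g (lshift e i) (low i) +
    beta%:P * pt_coord col g (lshift e i) (h i).
  (* X_i and Y differ only in column [i]; the product over the other columns is a common factor
     coprime to [quad]. *)
  move: qd; rewrite (bigD1 (lshift e i)) //= [X in _ + _ * X](bigD1 (lshift e i)) //=.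
  rewrite /role eqxx (eq_bigr (fun a => pt_coord col g a (high a))) => [|a /negPf->//].
  rewrite !mulrA -mulrDl Gauss_dvdpl //.
  by apply: (big_ind (coprimep (quad col g))) => [|x y cx cy|a _]; rewrite ?coprimep1 ?coprimepMr ?cx ?coprime_high.
have [c00 c01 c10 c11] := coords.
have lin (a b a' b' : K) : alpha%:P * (a%:P * 'X + b%:P) + beta%:P * (a'%:P * 'X + b'%:P) =
    (alpha * a + beta * a')%:P * 'X + (alpha * b + beta * b')%:P.
  by rewrite !polyCD !polyCM; ring.
(* A multiple of [quad] of degree at most one is zero, and a nonsingular 2 by 2 system then forces
   alpha = 0. *)
have contra (a b a' b' : K) : a * b' - b * a' != 0 ->
    quad col g %| alpha%:P * (a%:P * 'X + b%:P) + beta%:P * (a'%:P * 'X + b'%:P) -> False.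
  move=> D; rewrite lin => /(linear_eq0 size_quad)[A B]; move: alpha0.
  by rewrite (singular_pencil D A B) eqxx.
have transversal (ji : 'I_4) : (1 < ji)%N -> kbr col ji g 0 * lbr col ji g 1 - kbr col ji g 1 * lbr col ji g 0 != 0 ->
    quad col g %| alpha%:P * pt_coord col g (lshift e ji) (low ji) +
      beta%:P * pt_coord col g (lshift e ji) (h ji) -> False.
  move=> ji1 D; have [-> ->] := coords_trans ji1.
  (* Both coordinates share the factor [pt_y], coprime to [quad]; cancelling it leaves linear
     polynomials. *)
  rewrite !(mulrCA _ (pt_y col g)) -mulrDr Gauss_dvdpr ?coprime_pt_y //; exact: contra.
case: (ord4_cases i) => ->.
- rewrite c00 c01 /pt_x /pt_y opprD -mulNr -!polyCN; apply: contra.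
  by rewrite mulrN mulrN opprK -oppr_eq0 opprD !opprK; apply: (gP 4).
- rewrite c10 c11 (_ : 'X = 1%:P * 'X + 0%:P); last by rewrite mul1r addr0.
  rewrite (_ : 1 = 0%:P * 'X + 1%:P :> PK); last by rewrite mul0r add0r.
  by apply: contra; rewrite mulr1 mulr0 subr0 oner_neq0.
- exact: transversal (gP 9).
- exact: transversal (gP 10).
Qed.

End Order.
End Conflict.

(** * The excluded values of t and the equivalence *)

Lemma not_cartwright_sturmfels (K : fieldType) kap e n : infinite K -> (4 + e <= n)%N ->
  ~ cartwright_sturmfels (@determinantal_ideal K (4 + (kap + e)) n (3 + e)).
Proof.
move=> Kinf en [_ [le [J [leP le_dec [U [Uo U0 UJ]] JR]]]].
have col_inj : injective (widen_ord en) by move=> a b /(congr1 val) /= E; apply: val_inj.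
have [g [[Ug gU] gP]] := generic_exists Kinf
  (generic_and (generic_and (open_generic Uo U0) (generic_in_G K _ n)) (generic_positions K kap col_inj)).
exact: (conflict col_inj leP le_dec gU gP JR (UJ g Ug)).
Qed.

Theorem corollary3p10 (K : fieldType) (m n t : nat) :
  infinite K -> (1 <= t)%N -> (t <= minn m n)%N ->
  cartwright_sturmfels (@determinantal_ideal K m n t) <->
  t = 1%N \/ t = 2%N \/ t = minn m n.
Proof.
move=> Kinf t1 t_min; have := t_min; rewrite leq_min => /andP[tm tn]; split=> [CS|].
  have [->|t_neq1] := eqVneq t 1%N; [by left|right].
  have [->|t_neq2] := eqVneq t 2; [by left|right].
  apply/eqP; rewrite eqn_leq t_min leqNgt; apply/negP; rewrite leq_min => /andP[ltm ltn].
  have tE : t = (3 + (t - 3))%N.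
    by rewrite subnKC //; case: t t1 t_neq1 t_neq2 {CS t_min tm tn ltm ltn} => [|[|[|]]].
  have mE : m = (4 + ((m - t.+1) + (t - 3)))%N.
    by rewrite addnCA [(4 + _)%N]addSn -tE subnK.
  move: (t - 3)%N tE mE => e; move: (m - t.+1)%N => kap tE mE; subst t m.
  exact: not_cartwright_sturmfels CS.
have m0 : (0 < m)%N := leq_trans t1 tm; have n0 : (0 < n)%N := leq_trans t1 tn.
case=> [->|[t2|tE]]; first exact: cartwright_sturmfels1.
  rewrite t2 -(prednK m0); exact: cartwright_sturmfels2.
have [mn|nm] := leqP m n.
  rewrite tE (minn_idPl mn) -(prednK m0); apply: cartwright_sturmfels_rows => //.
  by rewrite add1n prednK.
(* The argument for maximal minors by columns requires two columns; a single column is the case t =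
   1. *)
rewrite tE (minn_idPr (ltnW nm)); have [n1|n1] := leqP n 1.
  by have -> : n = 1%N; [apply/eqP; rewrite eqn_leq n1|apply: cartwright_sturmfels1].
by apply: cartwright_sturmfels_columns => //; apply: ltnW.
Qed.
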